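(* For every real $\nu\ge 0$ the following bounds hold. (i) For every $k\in\mathbb{N}$, $$\left(\widetilde{\theta}_\nu\right)^{-1}\left(\pi\left(k-\tfrac12\right)\right)<j_{\nu,k}<\left(\underline{\theta}_\nu\right)^{-1}\left(\pi\left(k-\tfrac12\right)\right).$$ (ii) For every $k\in\mathbb{N}$, $$\left(\widetilde{\theta}_\nu\right)^{-1}\left(\pi(k-1)\right)<y_{\nu,k}<\left(\underline{\theta}_\nu\right)^{-1}\left(\pi(k-1)\right).$$ (iii) More generally, for all $\tau\in(0,1]$ and all integers $k\ge2$, $$\left(\widetilde{\theta}_\nu\right)^{-1}\left(\pi\left(\tau+k-\tfrac32\right)\right)<c_{\nu,\tau,k}<\left(\underline{\theta}_\nu\right)^{-1}\left(\pi\left(\tau+k-\tfrac32\right)\right).$$ For $k=1$, the upper bound $c_{\nu,\tau,1}<\left(\underline{\theta}_\nu\right)^{-1}\left(\pi\left(\tau-\tfrac12\right)\right)$ is also valid for all $\tau\in(0,1]$, and the lower bound $\left(\widetilde{\theta}_\nu\right)^{-1}\left(\pi\left(\tau-\tfrac12\right)\right)<c_{\nu,\tau,1}$ is valid for $\tau\in\left(\tfrac14,1\right]$.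
   Context: $\mathbb{N}=\{1,2,\dots\}$. $J_\nu,Y_\nu$ are the standard Bessel functions of the first and second kind of order $\nu\ge0$; $j_{\nu,k}$ and $y_{\nu,k}$ denote the $k$th positive zeros (in increasing order) of $J_\nu$ and $Y_\nu$, respectively. For $\tau\in(0,1]$, $\mathcal{C}_{\nu,\tau}(x):=J_\nu(x)\cos(\pi\tau)+Y_\nu(x)\sin(\pi\tau)$, and $c_{\nu,\tau,k}$ is its $k$th positive zero (in increasing order). For $x>\nu\ge0$ define $$\widetilde{\theta}_\nu(x):=\sqrt{x^2-\nu^2}-\nu\arccos\frac{\nu}{x}-\frac{\pi}{4},\qquad \underline{\theta}_\nu(x):=\widetilde{\theta}_\nu(x)-\frac{3x^2+2\nu^2}{24(x^2-\nu^2)^{3/2}},$$ with $\widetilde{\theta}_\nu$ extended continuously to $x=\nu$ by $\widetilde{\theta}_\nu(\nu)=-\frac{\pi}{4}$. Both functions are strictly increasing on $(\nu,+\infty)$, so that the inverse functions $\left(\widetilde{\theta}_\nu\right)^{-1}:\left[-\frac{\pi}{4},+\infty\right)\to[\nu,+\infty)$ and $\left(\underline{\theta}_\nu\right)^{-1}:\mathbb{R}\to(\nu,+\infty)$ are well-defined. *)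

(* Defs.v *)
From Stdlib Require Export Reals Factorial.
From Coquelicot Require Export Coquelicot.
Open Scope R_scope.

(** Reciprocal of the Gamma function on all of R, by the Euler-Gauss limit
    1/Gamma(z) = lim_n z (z+1) ... (z+n) / (n! n^z).  The limit exists for every
    real z and is 0 at the poles z = 0, -1, -2, ... of Gamma. *)
Definition rGamma (z : R) : R :=
  real (Lim_seq (fun n : nat =>
    prod_f_R0 (fun i => z + INR i) n / (INR (fact n) * Rpower (INR n) z))).

(** For x > 0 and any real order nu:
    J_nu(x) = (x/2)^nu sum_m (-1)^m (x/2)^(2m) / (m! Gamma(nu+m+1)).
    [Rpower] is meaningless for x <= 0; only positive arguments are used. *)
Definition bessel_J (nu x : R) : R :=
  Rpower (x / 2) nu *
  PSeries (fun m : nat => (-1) ^ m / INR (fact m) * rGamma (nu + INR m + 1))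
          ((x / 2) ^ 2).

Definition bessel_Y_nonint (nu x : R) : R :=
  (bessel_J nu x * cos (nu * PI) - bessel_J (- nu) x) / sin (nu * PI).

(** The order nu is an integer iff sin (nu PI) = 0; Y_nu is then the limit of
    Y_mu as mu -> nu. *)
Definition bessel_Y (nu x : R) : R :=
  if Req_EM_T (sin (nu * PI)) 0
  then real (Lim (fun mu => bessel_Y_nonint mu x) nu)
  else bessel_Y_nonint nu x.

Definition bessel_C (nu tau x : R) : R :=
  bessel_J nu x * cos (PI * tau) + bessel_Y nu x * sin (PI * tau).

Definition is_next_zero (f : R -> R) (a z : R) : Prop :=
  a < z /\ f z = 0 /\ forall x, a < x < z -> f x <> 0.

(** For k >= 1: z is the k-th positive zero of f.  The case k = 0 only starts
    the recursion at the origin, which need not be a zero of f. *)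
Fixpoint is_kth_pos_zero (f : R -> R) (k : nat) (z : R) : Prop :=
  match k with
  | O => z = 0
  | S k' => exists w, is_kth_pos_zero f k' w /\ is_next_zero f w z
  end.

(** [iota P] is the unique real satisfying P, when there is one. *)
Definition kth_pos_zero (f : R -> R) (k : nat) : R :=
  iota (fun z : R => is_kth_pos_zero f k z).

Definition zero_j (nu : R) (k : nat) : R := kth_pos_zero (bessel_J nu) k.
Definition zero_y (nu : R) (k : nat) : R := kth_pos_zero (bessel_Y nu) k.
Definition zero_c (nu tau : R) (k : nat) : R := kth_pos_zero (bessel_C nu tau) k.

(** At x = nu this takes the value - PI / 4, the continuous extension
    (for nu = 0 because the factor nu kills [acos (0 / 0)]). *)
Definition theta_tilde (nu x : R) : R :=
  sqrt (x ^ 2 - nu ^ 2) - nu * acos (nu / x) - PI / 4.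

Definition theta_low (nu x : R) : R :=
  theta_tilde nu x
  - (3 * x ^ 2 + 2 * nu ^ 2) / (24 * Rpower (x ^ 2 - nu ^ 2) (3 / 2)).

(** Inverse of theta_tilde nu : [nu, +oo) -> [- PI / 4, +oo). *)
Definition theta_tilde_inv (nu y : R) : R :=
  iota (fun x : R => nu <= x /\ theta_tilde nu x = y).

(** Inverse of theta_low nu : (nu, +oo) -> R. *)
Definition theta_low_inv (nu y : R) : R :=
  iota (fun x : R => nu < x /\ theta_low nu x = y).

(* Main.v *)
Require Import Defs.
From Stdlib Require Import Reals Lra Lia ZArith.
From Coquelicot Require Import Coquelicot.
Open Scope R_scope.

(** The zeros are governed by the Bessel phase: a strictly increasing function
    [th] with [J = M cos th], [Y = M sin th], [M = sqrt (J^2 + Y^2)], starting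
    from [- PI/2] at the origin.  The function [J cos b + Y sin b] vanishes where
    [cos (th - b) = 0], so for [0 < b <= PI] its [k]-th positive zero is the point
    where [th = b + PI (k - 3/2)] (lemma [kth_pos_zero_phase]); [b = PI], [PI/2]
    and [PI tau] give [J] (up to sign), [Y] and the general cylinder function.  Everything then
    follows from [theta_low < th < theta_tilde] on [(nu, +oo)], lemmas
    [low_lt_phase] and [phase_lt_tilde].

    These bounds are a Sturm comparison anchored at infinity ([phase_shift]).  An
    increasing [th2] with derivative [psi] is the phase of
    [w'' + (psi^2 + ka' - ka^2) w = 0], where [ka = psi' / (2 psi)], while [th] is
    the phase of [u'' + potential u = 0], [u = sqrt x J].  If one coefficient
    dominates the other and the two phases have the same limit at infinity, then they
    are strictly ordered everywhere.  For [theta_tilde] the coefficient lies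
    below the potential ([tilde_below]), for [theta_low] it lies above
    ([low_above]).

    The comparison needs the exact behaviour at infinity,
    [sqrt x (J + i Y) ~ kamp exp (i (x - nu PI/2 - PI/4))], for functions defined
    by power series at the origin.  The link is Schlafli's integrals: [Hr] and
    [Hi] are explicit solutions of the Bessel equation for every real order, and
    their size at infinity is the same for all orders, up to a rotation.
    Wronskians of two solutions are constant, so they can be evaluated at either
    end.  At the origin they express [Hr] as the regular solution and reduce the
    second Wronskian to the product of [rGamma] with an Euler-type integral, which
    is 1 by a Bohr-Mollerup argument ([kappa_1]).  At infinity the unknown common
    amplitudes are found from the one elementary case, order [1/2], where
    [sqrt x J = kamp sin x] ([amplitudes_infty]).  Hence [J = kamp^2 Hr] for
    positive orders; the recurrence in the order carries the asymptotics of [J] to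
    all real orders, so [Y = kamp^2 Hi] at non-integer orders, and continuity of
    [Hi] in the order computes the limit that defines [Y] at the integers.

    The asymptotics determine the phase only modulo [2 PI].  The missing multiple
    is excluded in [phase_limit_0] by comparing [th] with the two bounds just
    above [nu] and at a point beyond [nu] up to which [J] is still positive. *)

(** * Derivatives of real functions *)

(* Exposes the carrier R of an equation typed in a normed module. *)
Ltac Rring := lazymatch goal with |- ?a = ?b => change (@eq R a b) end; ring.

Lemma derive_eq (f : R -> R) (x a b : R) : is_derive f x a -> a = b -> is_derive f x b.
Proof. intros H <-; exact H. Qed.

Lemma derive_ext (f g : R -> R) (x a : R) :
  (forall t, f t = g t) -> is_derive f x a -> is_derive g x a.
Proof. intros H; apply (is_derive_ext f g x a), H. Qed.

Lemma derive_const (c x : R) : is_derive (fun _ : R => c) x 0.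
Proof. apply (is_derive_const c x). Qed.

Lemma derive_id (x : R) : is_derive (fun t : R => t) x 1.
Proof. apply (is_derive_id x). Qed.

Lemma derive_plus (f g : R -> R) (x a b : R) :
  is_derive f x a -> is_derive g x b -> is_derive (fun t => f t + g t) x (a + b).
Proof. intros Hf Hg. apply (is_derive_plus f g x a b Hf Hg). Qed.

Lemma derive_minus (f g : R -> R) (x a b : R) :
  is_derive f x a -> is_derive g x b -> is_derive (fun t => f t - g t) x (a - b).
Proof. intros Hf Hg. apply (is_derive_minus f g x a b Hf Hg). Qed.

Lemma derive_mult (f g : R -> R) (x a b : R) :
  is_derive f x a -> is_derive g x b ->
  is_derive (fun t => f t * g t) x (a * g x + f x * b).
Proof. intros Hf Hg. apply (is_derive_mult f g x a b Hf Hg). intros; apply Rmult_comm. Qed.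

Lemma derive_comp (f g : R -> R) (x a b : R) :
  is_derive f (g x) a -> is_derive g x b -> is_derive (fun t => f (g t)) x (a * b).
Proof.
  intros Hf Hg. eapply derive_eq; [apply (is_derive_comp f g x a b Hf Hg)|].
  unfold scal; simpl; unfold mult; simpl; ring.
Qed.

Lemma derive_div (f g : R -> R) (x a b : R) : g x <> 0 ->
  is_derive f x a -> is_derive g x b ->
  is_derive (fun t => f t / g t) x ((a * g x - f x * b) / g x ^ 2).
Proof.
  intros H Hf Hg. apply (is_derive_div f g x a b Hf Hg H).
Qed.

Lemma derive_cont_pt (f : R -> R) (x a : R) : is_derive f x a -> continuity_pt f x.
Proof.
  intros H. apply derivable_continuous_pt. exists a. apply is_derive_Reals, H.
Qed.

Lemma increasing_of_derive (f g : R -> R) (x y : R) : x <= y ->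
  (forall t, x <= t <= y -> is_derive f t (g t)) -> (forall t, x <= t <= y -> 0 <= g t) -> f x <= f y.
Proof.
  intros Hxy D G. destruct (MVT_gen f x y g) as [c [Hc E]].
  - intros t Ht. rewrite Rmin_left, Rmax_right in Ht by lra. apply D; lra.
  - intros t Ht. rewrite Rmin_left, Rmax_right in Ht by lra. apply (derive_cont_pt f t (g t)), D; lra.
  - rewrite Rmin_left, Rmax_right in Hc by lra. specialize (G c Hc). nra.
Qed.

Lemma increasing_of_pos_derive (f g : R -> R) (a x y : R) :
  (forall t, a < t -> is_derive f t (g t) /\ 0 < g t) -> a < x -> x < y -> f x < f y.
Proof.
  intros D Hx Hy. destruct (MVT_gen f x y g) as [c [Hc E]].
  - intros t Ht. rewrite Rmin_left in Ht by lra. apply D; lra.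
  - intros t Ht. rewrite Rmin_left in Ht by lra. apply (derive_cont_pt f t (g t)), D; lra.
  - rewrite Rmin_left in Hc by lra. destruct (D c ltac:(lra)) as [_ P]. nra.
Qed.

(** * The reciprocal Gamma function *)


Definition gauss (z : R) (n : nat) : R :=
  prod_f_R0 (fun i => z + INR i) n / (INR (fact n) * Rpower (INR n) z).

Lemma Rpower_pos (x y : R) : 0 < Rpower x y.
Proof. apply exp_pos. Qed.

Lemma exp_le (x y : R) : x <= y -> exp x <= exp y.
Proof.
  intros [H|H]; [left; apply exp_increasing; exact H | rewrite H; apply Rle_refl].
Qed.

(** Both tangent-line inequalities for [exp] at [s u], averaged with weights
    [1 - s] and [s]. *)
Lemma young_exp (s u : R) : 0 <= s <= 1 -> exp (s * u) <= (1 - s) + s * exp u.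
Proof.
  intros Hs.
  pose proof (exp_pos (s * u)) as P.
  assert (A : exp u = exp (s * u) * exp ((1 - s) * u)) by (rewrite <- exp_plus; f_equal; ring).
  assert (B : 1 = exp (s * u) * exp (- (s * u)))
    by (rewrite <- exp_plus, Rplus_opp_r, exp_0; reflexivity).
  pose proof (exp_ineq1_le ((1 - s) * u)) as A1. pose proof (exp_ineq1_le (- (s * u))) as B1.
  assert (A2 : exp (s * u) * (1 + (1 - s) * u) <= exp u) by (rewrite A; apply Rmult_le_compat_l; lra).
  assert (B2 : exp (s * u) * (1 + - (s * u)) <= 1) by (rewrite B at 2; apply Rmult_le_compat_l; lra).
  nra.
Qed.

Lemma prod_f_R0_pos (u : nat -> R) (n : nat) :
  (forall i, 0 < u i) -> 0 < prod_f_R0 u n.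
Proof.
  intros H; induction n as [|n IH]; simpl; [apply H|].
  apply Rmult_lt_0_compat; [exact IH | apply H].
Qed.

Lemma gauss_pos (z : R) (n : nat) : 0 < z -> 0 < gauss z n.
Proof.
  intros Hz; unfold gauss; apply Rdiv_lt_0_compat.
  - apply prod_f_R0_pos; intros i; pose proof (pos_INR i); lra.
  - apply Rmult_lt_0_compat; [apply INR_fact_lt_0 | apply Rpower_pos].
Qed.

Lemma gauss_ratio (z : R) (n : nat) : (1 <= n)%nat ->
  gauss z (S n) =
  gauss z n * ((1 + z / INR (S n)) * Rpower (INR n / INR (S n)) z).
Proof.
  intros Hn.
  assert (H1 : 0 < INR n) by (apply lt_0_INR; lia).
  assert (H2 : 0 < INR (S n)) by (apply lt_0_INR; lia).
  unfold gauss.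
  change (prod_f_R0 (fun i => z + INR i) (S n))
    with (prod_f_R0 (fun i => z + INR i) n * (z + INR (S n))).
  replace (INR (fact (S n))) with (INR (S n) * INR (fact n))
    by (rewrite <- mult_INR; reflexivity).
  replace (Rpower (INR n / INR (S n)) z)
    with (Rpower (INR n) z / Rpower (INR (S n)) z).
  - pose proof (INR_fact_neq_0 n).
    pose proof (Rpower_pos (INR n) z). pose proof (Rpower_pos (INR (S n)) z).
    field; repeat split; lra.
  - unfold Rpower. rewrite ln_div by assumption.
    unfold Rdiv at 1. rewrite <- exp_Ropp, <- exp_plus. f_equal; ring.
Qed.

(** Since [1 + z t <= exp (z t)] and [ln (1 - t) <= - t], the factor relating
    consecutive terms is at most 1. *)
Lemma gauss_decr (z : R) (n : nat) : 0 < z -> (1 <= n)%nat ->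
  gauss z (S n) <= gauss z n.
Proof.
  intros Hz Hn. rewrite gauss_ratio by assumption.
  assert (H1 : 0 < INR n) by (apply lt_0_INR; lia).
  assert (H2 : 0 < INR (S n)) by (apply lt_0_INR; lia).
  rewrite <- (Rmult_1_r (gauss z n)) at 2.
  apply Rmult_le_compat_l; [left; apply gauss_pos; assumption|].
  set (t := / INR (S n)).
  assert (Ht : 0 < t) by (apply Rinv_0_lt_compat; assumption).
  assert (E : INR n / INR (S n) = 1 - t).
  { unfold t. rewrite S_INR in *. field; lra. }
  rewrite E. unfold Rdiv; fold t.
  assert (Ht1 : 0 < 1 - t) by (rewrite <- E; apply Rdiv_lt_0_compat; lra).
  apply Rle_trans with (exp (z * t) * exp (- (z * t))).
  - apply Rmult_le_compat.
    + nra.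
    + left; apply Rpower_pos.
    + apply exp_ineq1_le.
    + unfold Rpower. assert (L : ln (1 - t) <= - t).
      { rewrite <- (ln_exp (- t)). apply ln_le; [assumption|].
        pose proof (exp_ineq1_le (- t)); lra. }
      apply exp_le; nra.
  - rewrite <- exp_plus. replace (z * t + - (z * t)) with 0 by ring.
    rewrite exp_0; lra.
Qed.

Lemma ex_lim_gauss_pos (z : R) : 0 < z -> ex_finite_lim_seq (gauss z).
Proof.
  intros Hz.
  destruct (ex_finite_lim_seq_decr (fun n => gauss z (S n)) 0) as [l Hl].
  - intros n. apply gauss_decr; [assumption | lia].
  - intros n. left; apply gauss_pos; assumption.
  - exists l. apply is_lim_seq_incr_1; exact Hl.
Qed.

Lemma prod_f_R0_shift (z : R) (n : nat) :
  prod_f_R0 (fun i => z + INR i) n * (z + 1 + INR n) =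
  z * prod_f_R0 (fun i => z + 1 + INR i) n.
Proof.
  induction n as [|n IH].
  - simpl; ring.
  - change (prod_f_R0 (fun i => z + INR i) (S n))
      with (prod_f_R0 (fun i => z + INR i) n * (z + INR (S n))).
    change (prod_f_R0 (fun i => z + 1 + INR i) (S n))
      with (prod_f_R0 (fun i => z + 1 + INR i) n * (z + 1 + INR (S n))).
    rewrite <- Rmult_assoc, <- IH, S_INR. ring.
Qed.

Lemma is_lim_seq_shift_factor (z : R) :
  is_lim_seq (fun n => z * (INR n / (z + 1 + INR n))) z.
Proof.
  replace (Finite z) with (Rbar_mult z 1) by (simpl; f_equal; ring).
  apply is_lim_seq_scal_l.
  apply is_lim_seq_ext_loc with (u := fun n => 1 - (z + 1) * / (z + 1 + INR n)).
  - destruct (nfloor_ex (Rabs (z + 1))) as [N HN]; [apply Rabs_pos|].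
    exists (S N); intros n Hn. apply le_INR in Hn. rewrite S_INR in Hn.
    pose proof (Rabs_maj2 (z + 1)). field; lra.
  - replace (Finite 1) with (Finite (1 - (z + 1) * 0)) by (f_equal; ring).
    apply is_lim_seq_minus'; [apply is_lim_seq_const|].
    apply is_lim_seq_mult'; [apply is_lim_seq_const|].
    replace (Finite 0) with (Rbar_inv p_infty) by reflexivity.
    apply is_lim_seq_inv; [|discriminate].
    eapply is_lim_seq_plus; [apply is_lim_seq_const | apply is_lim_seq_INR | reflexivity].
Qed.

Lemma gauss_shift (z : R) :
  eventually (fun n => gauss z n = gauss (z + 1) n * (z * (INR n / (z + 1 + INR n)))).
Proof.
  destruct (nfloor_ex (Rabs (z + 1))) as [N HN]; [apply Rabs_pos|].
  exists (S N); intros n Hn.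
  assert (Hp : 0 < INR n) by (apply lt_0_INR; lia).
  apply le_INR in Hn. rewrite S_INR in Hn.
  pose proof (Rabs_maj2 (z + 1)).
  unfold gauss.
  assert (E : prod_f_R0 (fun i => z + INR i) n =
     z * prod_f_R0 (fun i => z + 1 + INR i) n / (z + 1 + INR n)).
  { rewrite <- prod_f_R0_shift. field; lra. }
  rewrite E, Rpower_plus, Rpower_1 by assumption.
  pose proof (INR_fact_neq_0 n). pose proof (Rpower_pos (INR n) z).
  field; repeat split; lra.
Qed.

(** The functional equation propagates convergence from positive arguments
    to every real argument. *)
Lemma is_lim_gauss (z : R) : is_lim_seq (gauss z) (rGamma z).
Proof.
  assert (H : ex_finite_lim_seq (gauss z)).
  { destruct (nfloor_ex (Rabs z)) as [N HN]; [apply Rabs_pos|].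
    assert (Hz : 0 < z + INR (S N)).
    { rewrite S_INR. pose proof (Rabs_maj2 z); lra. }
    revert Hz; generalize (S N) as m; intros m; clear N HN; revert z.
    induction m as [|m IH]; intros z Hz.
    - apply ex_lim_gauss_pos; simpl in Hz; lra.
    - destruct (IH (z + 1)) as [l Hl]; [rewrite S_INR in Hz; lra|].
      exists (l * z).
      eapply is_lim_seq_ext_loc.
      + eapply filter_imp; [|apply gauss_shift].
        intros n E; symmetry; exact E.
      + apply is_lim_seq_mult'; [exact Hl | apply is_lim_seq_shift_factor]. }
  apply Lim_seq_correct' in H. exact H.
Qed.

Lemma rGamma_rec (z : R) : rGamma z = z * rGamma (z + 1).
Proof.
  assert (H : is_lim_seq (gauss z) (rGamma (z + 1) * z)).
  { eapply is_lim_seq_ext_loc.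
    - eapply filter_imp; [|apply gauss_shift].
      intros n E; symmetry; exact E.
    - apply is_lim_seq_mult'; [apply is_lim_gauss | apply is_lim_seq_shift_factor]. }
  apply is_lim_seq_unique in H.
  pose proof (is_lim_seq_unique _ _ (is_lim_gauss z)) as H2.
  rewrite H2 in H. injection H; intros ->. ring.
Qed.

(** For [z] in (0,1] the sequence with [n + 1] in place of the base [n] is
    increasing, by the Bernoulli inequality, which bounds the limit away from 0. *)
Lemma rGamma_pos_01 (z : R) : 0 < z <= 1 -> 0 < rGamma z.
Proof.
  intros [Hz Hz1].
  set (u := fun n => gauss z n * Rpower (INR n / INR (S n)) z).
  assert (Hinc : forall n, (1 <= n)%nat -> u n <= u (S n)).
  { intros n Hn. unfold u. rewrite gauss_ratio by assumption.
    assert (H1 : 0 < INR n) by (apply lt_0_INR; lia).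
    pose proof (gauss_pos z n Hz) as Hg.
    pose proof (Rpower_pos (INR n / INR (S n)) z) as HA.
    rewrite (Rmult_assoc (gauss z n)).
    apply Rmult_le_compat_l; [lra|].
    rewrite (Rmult_comm (1 + _)), Rmult_assoc.
    rewrite <- (Rmult_1_r (Rpower (INR n / INR (S n)) z)) at 1.
    apply Rmult_le_compat_l; [lra|].
    assert (H2 : 0 < INR (S n)) by (apply lt_0_INR; lia).
    assert (H3 : 0 < INR (S (S n))) by (apply lt_0_INR; lia).
    set (t := / INR (S n)).
    assert (Ht : 0 < t) by (apply Rinv_0_lt_compat; assumption).
    assert (E : INR (S n) / INR (S (S n)) = / (1 + t)).
    { unfold t. rewrite (S_INR (S n)) in *. field; lra. }
    rewrite E. unfold Rdiv; fold t.
    unfold Rpower. rewrite ln_Rinv by lra.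
    replace (z * - ln (1 + t)) with (- (z * ln (1 + t))) by ring. rewrite exp_Ropp.
    pose proof (young_exp z (ln (1 + t)) ltac:(lra)) as Y. rewrite exp_ln in Y by lra.
    apply (Rle_div_r 1 _ _ (exp_pos (z * ln (1 + t)))). lra. }
  assert (Hle : forall n, (1 <= n)%nat -> u n <= gauss z n).
  { intros n Hn. unfold u.
    assert (H1 : 0 < INR n) by (apply lt_0_INR; lia).
    assert (H2 : 0 < INR (S n)) by (apply lt_0_INR; lia).
    rewrite <- (Rmult_1_r (gauss z n)) at 2.
    apply Rmult_le_compat_l; [left; apply gauss_pos; assumption|].
    unfold Rpower. rewrite <- exp_0.
    left; apply exp_increasing.
    assert (ln (INR n / INR (S n)) < 0).
    { rewrite <- ln_1. apply ln_increasing.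
      - apply Rdiv_lt_0_compat; assumption.
      - apply Rlt_div_l; [assumption|]. rewrite S_INR; lra. }
    nra. }
  assert (Hlow : forall n, (1 <= n)%nat -> u 1%nat <= gauss z n).
  { intros n Hn. apply Rle_trans with (u n); [|apply Hle; assumption].
    induction Hn as [|n Hn IH]; [apply Rle_refl|].
    eapply Rle_trans; [exact IH | apply Hinc; assumption]. }
  apply Rlt_le_trans with (u 1%nat).
  - unfold u. apply Rmult_lt_0_compat; [apply gauss_pos; assumption | apply Rpower_pos].
  - apply (is_lim_seq_le_loc (fun _ => u 1%nat) (gauss z) (u 1%nat) (rGamma z)).
    + exists 1%nat; intros n Hn; apply Hlow; assumption.
    + apply is_lim_seq_const.
    + apply is_lim_gauss.
Qed.

Lemma rGamma_pos (z : R) : 0 < z -> 0 < rGamma z.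
Proof.
  intros Hz.
  destruct (nfloor_ex z) as [N HN]; [lra|].
  assert (Hz' : z <= INR (S N)) by (rewrite S_INR; lra).
  revert Hz'; generalize (S N) as m; intros m; clear N HN; revert z Hz.
  induction m as [|m IH]; intros z Hz Hm.
  - simpl in Hm; lra.
  - destruct (Rle_dec z 1) as [H|H]; [apply rGamma_pos_01; lra|].
    rewrite S_INR in Hm.
    assert (Hp : 0 < rGamma (z - 1)) by (apply IH; lra).
    rewrite (rGamma_rec (z - 1)) in Hp.
    replace (z - 1 + 1) with z in Hp by ring.
    apply Rmult_lt_reg_l with (z - 1); lra.
Qed.

(** * The power series of the Bessel functions *)

Definition bcoef (nu : R) (m : nat) : R :=
  (-1) ^ m / INR (fact m) * rGamma (nu + INR m + 1).

Definition Phi (nu y : R) : R := PSeries (bcoef nu) y.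

Lemma bessel_J_Phi (nu x : R) :
  bessel_J nu x = Rpower (x / 2) nu * Phi nu ((x / 2) ^ 2).
Proof. reflexivity. Qed.

(** Beyond the poles, [m |-> rGamma (nu + m + 1)] is positive and eventually
    decreasing because of the recurrence. *)
Lemma rGamma_shift_bounded (nu : R) :
  exists M, forall m, Rabs (rGamma (nu + INR m + 1)) <= M.
Proof.
  destruct (nfloor_ex (Rabs nu)) as [N HN]; [apply Rabs_pos|].
  pose proof (Rabs_maj2 nu) as Hnu.
  assert (Htail : forall m, 0 < rGamma (nu + INR (S N + m) + 1)
                       <= rGamma (nu + INR (S N) + 1)).
  { induction m as [|m IH].
    - rewrite Nat.add_0_r. split; [|apply Rle_refl].
      apply rGamma_pos. rewrite S_INR; lra.
    - rewrite Nat.add_succ_r, (S_INR (S N + m)).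
      replace (nu + (INR (S N + m) + 1) + 1) with (nu + INR (S N + m) + 1 + 1) by ring.
      rewrite (rGamma_rec (nu + INR (S N + m) + 1)) in IH.
      assert (Hz : 1 <= nu + INR (S N + m) + 1).
      { rewrite plus_INR, S_INR. pose proof (pos_INR m); lra. }
      assert (0 < rGamma (nu + INR (S N + m) + 1 + 1)) by (apply rGamma_pos; lra).
      split; [assumption|nra]. }
  assert (Hall : forall k, exists M, forall m, (m < k)%nat ->
            Rabs (rGamma (nu + INR m + 1)) <= M).
  { induction k as [|k [M HM]].
    - exists 0; intros m Hm; lia.
    - exists (Rmax M (Rabs (rGamma (nu + INR k + 1)))). intros m Hm.
      destruct (Nat.eq_dec m k) as [->|Hne]; [apply Rmax_r|].
      apply Rle_trans with M; [apply HM; lia | apply Rmax_l]. }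
  destruct (Hall (S N)) as [M HM].
  exists (Rmax M (rGamma (nu + INR (S N) + 1))); intros m.
  destruct (Compare_dec.le_lt_dec (S N) m) as [H|H].
  - replace m with (S N + (m - S N))%nat by lia.
    destruct (Htail (m - S N)%nat) as [H1 H2].
    rewrite Rabs_right by lra. eapply Rle_trans; [exact H2 | apply Rmax_r].
  - eapply Rle_trans; [apply HM, H | apply Rmax_l].
Qed.

Lemma pow_fact_bounded (r : R) : 0 <= r -> forall n, r ^ n / INR (fact n) <= exp r.
Proof.
  intros Hr n.
  pose proof (is_exp_Reals r) as H.
  assert (E : exp r = PSeries (fun n => / INR (fact n)) r)
    by (symmetry; apply is_pseries_unique; exact H).
  apply Rle_trans with (sum_n (fun k => r ^ k * / INR (fact k)) n).
  - destruct n as [|n].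
    + rewrite sum_O. apply Rle_refl.
    + rewrite sum_Sn. unfold plus; simpl.
      assert (0 <= sum_n (fun k => r ^ k * / INR (fact k)) n).
      { rewrite sum_n_Reals. apply cond_pos_sum. intros k.
        apply Rmult_le_pos; [apply pow_le, Hr|].
        left; apply Rinv_0_lt_compat, INR_fact_lt_0. }
      unfold Rdiv; simpl in *; lra.
  - apply (is_lim_seq_incr_compare (sum_n (fun k => r ^ k * / INR (fact k)))).
    + exact H.
    + intros k. rewrite sum_Sn. unfold plus; simpl.
      assert (0 <= r * r ^ k * / INR (fact k + k * fact k)).
      { apply Rmult_le_pos; [apply (pow_le r (S k)), Hr|].
        left; apply Rinv_0_lt_compat, (INR_fact_lt_0 (S k)). }
      lra.
Qed.

Lemma CV_radius_bcoef (nu : R) : CV_radius (bcoef nu) = p_infty.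
Proof.
  destruct (rGamma_shift_bounded nu) as [M HM].
  assert (HM0 : 0 <= M) by (eapply Rle_trans; [apply Rabs_pos | apply (HM 0%nat)]).
  pose proof (CV_radius_bounded (bcoef nu)) as [Hub _].
  assert (Hr : forall r, 0 <= r -> Rbar_le r (CV_radius (bcoef nu))).
  { intros r Hr. apply Hub. exists (exp r * M). intros n.
    unfold bcoef. rewrite !Rabs_mult, Rabs_div by apply INR_fact_neq_0.
    rewrite pow_1_abs, (Rabs_right (INR _)) by (left; apply INR_fact_lt_0).
    rewrite (Rabs_right (r ^ n)) by (apply Rle_ge, pow_le, Hr).
    replace (1 / INR (fact n) * Rabs (rGamma (nu + INR n + 1)) * r ^ n)
      with (r ^ n / INR (fact n) * Rabs (rGamma (nu + INR n + 1)))
      by (field; apply INR_fact_neq_0).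
    apply Rmult_le_compat.
    - apply Rdiv_le_0_compat; [apply pow_le, Hr | apply INR_fact_lt_0].
    - apply Rabs_pos.
    - apply pow_fact_bounded, Hr.
    - apply HM. }
  destruct (CV_radius (bcoef nu)) as [r| |]; [|reflexivity|].
  - exfalso. pose proof (Hr 0 (Rle_refl 0)) as H0; simpl in H0.
    pose proof (Hr (r + 1)) as H1; simpl in H1. lra.
  - exfalso. exact (Hr 0 (Rle_refl 0)).
Qed.

Lemma ex_pseries_bcoef (nu y : R) : ex_pseries (bcoef nu) y.
Proof. apply CV_radius_inside. rewrite CV_radius_bcoef. exact I. Qed.

Lemma PS_derive_bcoef (nu : R) (n : nat) :
  PS_derive (bcoef nu) n = - bcoef (nu + 1) n.
Proof.
  unfold PS_derive, bcoef.
  replace (nu + INR (S n) + 1) with (nu + 1 + INR n + 1) by (rewrite S_INR; ring).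
  rewrite fact_simpl, mult_INR.
  change ((-1) ^ S n) with (-1 * (-1) ^ n).
  pose proof (INR_fact_neq_0 n). assert (INR (S n) <> 0) by (apply not_0_INR; lia).
  field; split; assumption.
Qed.

Lemma is_derive_Phi (nu y : R) : is_derive (Phi nu) y (- Phi (nu + 1) y).
Proof.
  unfold Phi. rewrite <- PSeries_opp.
  rewrite <- (PSeries_ext (PS_derive (bcoef nu))).
  - apply is_derive_PSeries. rewrite CV_radius_bcoef. exact I.
  - intros n. rewrite PS_derive_bcoef. reflexivity.
Qed.

Lemma Phi_rec (nu y : R) : Phi (nu - 1) y = nu * Phi nu y - y * Phi (nu + 1) y.
Proof.
  unfold Phi. rewrite <- PSeries_scal.
  replace (y * PSeries (bcoef (nu + 1)) y)
    with (- (y * PSeries (PS_derive (bcoef nu)) y)).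
  2: { rewrite (PSeries_ext (PS_derive (bcoef nu)) (PS_opp (bcoef (nu + 1)))).
       - rewrite PSeries_opp; ring.
       - intros n; rewrite PS_derive_bcoef; reflexivity. }
  rewrite <- PSeries_incr_1.
  unfold Rminus; rewrite Ropp_involutive.
  rewrite <- PSeries_plus.
  - apply PSeries_ext; intros n.
    unfold PS_plus, PS_scal, plus, scal; simpl; unfold mult; simpl.
    destruct n as [|n]; unfold PS_incr_1, PS_derive, zero; simpl.
    + unfold bcoef. simpl INR.
      replace (nu + - (1) + 0 + 1) with nu by ring.
      replace (nu + 0 + 1) with (nu + 1) by ring.
      rewrite (rGamma_rec nu). ring.
    + change (match n with O => 1 | S _ => INR n + 1 end) with (INR (S n)).
      unfold bcoef.
      replace (nu + - (1) + INR (S n) + 1) with (nu + INR (S n)) by ring.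
      rewrite (rGamma_rec (nu + INR (S n))).
      ring.
  - apply ex_pseries_scal; [apply Rmult_comm | apply ex_pseries_bcoef].
  - apply ex_pseries_incr_1, ex_pseries_derive. rewrite CV_radius_bcoef. exact I.
Qed.

Lemma Phi_0 (nu : R) : Phi nu 0 = rGamma (nu + 1).
Proof.
  unfold Phi. rewrite PSeries_0. unfold bcoef. simpl. rewrite Rplus_0_r. field.
Qed.

(** * Bessel's equation *)

(** Bessel's equation as a first-order system: Wronskians and asymptotics involve
    the derivative [g] as much as the solution [f]. *)
Definition bessel_sol (nu : R) (f g : R -> R) : Prop :=
  forall x, 0 < x ->
    is_derive f x (g x) /\
    is_derive g x (- g x / x - (1 - nu ^ 2 / x ^ 2) * f x).

(** Three-term recurrence of the series, the only source of Bessel's equation below. *)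
Lemma bessel_J_rec (nu x : R) : 0 < x ->
  bessel_J (nu - 1) x + bessel_J (nu + 1) x = 2 * nu / x * bessel_J nu x.
Proof.
  intros Hx. rewrite !bessel_J_Phi, Phi_rec.
  assert (Hx2 : 0 < x / 2) by lra.
  unfold Rminus. rewrite !Rpower_plus, Rpower_Ropp, Rpower_1 by assumption.
  field. lra.
Qed.

Lemma is_derive_bessel_J (nu x : R) : 0 < x ->
  is_derive (bessel_J nu) x (nu / x * bessel_J nu x - bessel_J (nu + 1) x).
Proof.
  intros Hx.
  assert (Hx2 : 0 < x / 2) by lra.
  assert (D1 : is_derive (fun t => Rpower (t / 2) nu) x (nu / x * Rpower (x / 2) nu)).
  { unfold Rpower. auto_derive; [lra|]. unfold Rdiv. field; lra. }
  assert (D2 : is_derive (fun t => Phi nu ((t / 2) ^ 2)) x (- (x / 2) * Phi (nu + 1) ((x / 2) ^ 2))).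
  { replace (- (x / 2) * Phi (nu + 1) ((x / 2) ^ 2))
      with (scal (x / 2) (- Phi (nu + 1) ((x / 2) ^ 2)))
      by (unfold scal; simpl; unfold mult; simpl; ring).
    apply (is_derive_comp (Phi nu) (fun t => (t / 2) ^ 2)).
    - apply is_derive_Phi.
    - auto_derive; [exact I|]. field. }
  apply (is_derive_ext (fun t => Rpower (t / 2) nu * Phi nu ((t / 2) ^ 2))).
  { intros t; reflexivity. }
  replace (nu / x * bessel_J nu x - bessel_J (nu + 1) x)
    with (nu / x * Rpower (x / 2) nu * Phi nu ((x / 2) ^ 2) +
          Rpower (x / 2) nu * (- (x / 2) * Phi (nu + 1) ((x / 2) ^ 2))).
  - apply (is_derive_mult _ _ x _ _ D1 D2). intros; apply Rmult_comm.
  - rewrite !bessel_J_Phi, Rpower_plus, Rpower_1 by assumption. ring.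
Qed.

Definition bessel_J' (nu x : R) : R := nu / x * bessel_J nu x - bessel_J (nu + 1) x.

Lemma bessel_sol_J (nu : R) : bessel_sol nu (bessel_J nu) (bessel_J' nu).
Proof.
  intros x Hx; split; [apply is_derive_bessel_J, Hx|].
  pose proof (is_derive_bessel_J nu x Hx) as D1.
  pose proof (is_derive_bessel_J (nu + 1) x Hx) as D2.
  pose proof (bessel_J_rec (nu + 1) x Hx) as E.
  replace (nu + 1 - 1) with nu in E by ring.
  unfold bessel_J'.
  eapply derive_eq.
  - apply derive_minus; [|exact D2].
    apply (derive_mult (fun t => nu / t) (bessel_J nu) x (- nu / x ^ 2)); [|exact D1].
    auto_derive; [lra|field; lra].
  - replace (bessel_J (nu + 1 + 1) x)
      with (2 * (nu + 1) / x * bessel_J (nu + 1) x - bessel_J nu x) by lra.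
    field; lra.
Qed.

Lemma bessel_sol_lin (nu a b : R) (f g f1 g1 : R -> R) :
  bessel_sol nu f f1 -> bessel_sol nu g g1 ->
  bessel_sol nu (fun x => a * f x + b * g x) (fun x => a * f1 x + b * g1 x).
Proof.
  intros Hf Hg x Hx. destruct (Hf x Hx) as [F F1], (Hg x Hx) as [G G1].
  split.
  - apply derive_plus; apply is_derive_scal; assumption.
  - eapply derive_eq.
    + apply derive_plus; apply is_derive_scal; [exact F1 | exact G1].
    + field; lra.
Qed.

Lemma bessel_sol_ext (nu : R) (f g f1 g1 : R -> R) :
  (forall x, 0 < x -> f x = f1 x) -> (forall x, 0 < x -> g x = g1 x) ->
  bessel_sol nu f g -> bessel_sol nu f1 g1.
Proof.
  intros E1 E2 H x Hx. destruct (H x Hx) as [F G].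
  assert (L : locally x (fun t => 0 < t)) by (apply (open_gt 0); exact Hx).
  rewrite <- E1, <- E2 by assumption. split.
  - eapply is_derive_ext_loc; [|exact F]. eapply filter_imp; [|exact L].
    intros t Ht; apply E1, Ht.
  - eapply is_derive_ext_loc; [|exact G]. eapply filter_imp; [|exact L].
    intros t Ht; apply E2, Ht.
Qed.

Definition wronskian (f f1 g g1 : R -> R) (x : R) : R := x * (f x * g1 x - f1 x * g x).

Lemma const_of_derive_0 (F : R -> R) (a x y : R) :
  a < x -> a < y -> (forall t, a < t -> is_derive F t 0) -> F x = F y.
Proof.
  intros Hx Hy H.
  destruct (MVT_gen F x y (fun _ => 0)) as [c [_ E]].
  - intros t Ht. apply H. eapply Rlt_trans; [|apply Ht]. apply Rmin_glb_lt; assumption.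
  - intros t Ht. apply derivable_continuous_pt. exists 0. apply is_derive_Reals, H.
    eapply Rlt_le_trans; [|apply Ht]. apply Rmin_glb_lt; assumption.
  - lra.
Qed.

(** By Abel's formula the ordinary Wronskian is a multiple of [1 / x]; the factor
    [x] in [wronskian] makes it constant and so transports information from the
    origin to infinity. *)
Lemma wronskian_const (nu : R) (f g f1 g1 : R -> R) (x y : R) :
  bessel_sol nu f f1 -> bessel_sol nu g g1 -> 0 < x -> 0 < y ->
  wronskian f f1 g g1 x = wronskian f f1 g g1 y.
Proof.
  intros Hf Hg Hx Hy. apply (const_of_derive_0 _ 0); [assumption..|].
  intros t Ht. destruct (Hf t Ht) as [F F1], (Hg t Ht) as [G G1].
  unfold wronskian. eapply derive_eq.
  - apply (derive_mult (fun t => t)); [apply derive_id|].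
    apply derive_minus; apply derive_mult; [exact F|exact G1|exact F1|exact G].
  - cbv beta. field; lra.
Qed.

(** * Integrals depending on a parameter *)

(** Differentiation under the integral sign is done through a remainder of second
    order in the increment, uniform in the integration variable. *)
Lemma derive_of_quadratic (f : R -> R) (x l M eta : R) : 0 < eta ->
  (forall h, Rabs h < eta -> Rabs (f (x + h) - f x - h * l) <= M * h ^ 2) ->
  is_derive f x l.
Proof.
  intros Heta H. apply is_derive_Reals. intros eps Heps.
  set (M' := Rmax M 0 + 1).
  assert (HM : 0 < M') by (unfold M'; pose proof (Rmax_r M 0); lra).
  assert (Hd : 0 < Rmin eta (eps / M'))
    by (apply Rmin_glb_lt; [|apply Rdiv_lt_0_compat]; assumption).
  exists (mkposreal _ Hd). intros h Hh Hlt. simpl in Hlt.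
  pose proof (H h (Rlt_le_trans _ _ _ Hlt (Rmin_l _ _))) as B.
  pose proof (Rlt_le_trans _ _ _ Hlt (Rmin_r _ _)) as B2.
  assert (Hp : 0 < Rabs h) by (apply Rabs_pos_lt, Hh).
  replace ((f (x + h) - f x) / h - l) with ((f (x + h) - f x - h * l) / h) by (field; exact Hh).
  rewrite Rabs_div by exact Hh.
  apply Rlt_div_l; [exact Hp|].
  eapply Rle_lt_trans; [exact B|].
  rewrite <- (pow2_abs h).
  apply Rlt_div_r in B2; [|exact HM].
  assert (M <= M') by (unfold M'; pose proof (Rmax_l M 0); lra).
  nra.
Qed.

Lemma taylor2_bound (f f1 f2 : R -> R) (x h M : R) :
  (forall t, Rmin x (x + h) <= t <= Rmax x (x + h) ->
     is_derive f t (f1 t) /\ is_derive f1 t (f2 t) /\ Rabs (f2 t) <= M) ->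
  Rabs (f (x + h) - f x - h * f1 x) <= M * h ^ 2.
Proof.
  intros H.
  destruct (MVT_gen f x (x + h) f1) as [c [Hc Ec]].
  - intros t Ht. apply H; lra.
  - intros t Ht. apply (derive_cont_pt f t (f1 t)), H, Ht.
  - assert (S : Rmin x (x + h) <= Rmin x c /\ Rmax x c <= Rmax x (x + h)).
    { split.
      - apply Rmin_glb; [apply Rmin_l | apply Hc].
      - apply Rmax_lub; [apply Rmax_l | apply Hc]. }
    destruct (MVT_gen f1 x c f2) as [d [Hd Ed]].
    + intros t Ht. apply H; lra.
    + intros t Ht. apply (derive_cont_pt f1 t (f2 t)), H; lra.
    + assert (Hx : Rabs (c - x) <= Rabs h).
      { destruct (Rle_dec 0 h) as [P|P].
        - rewrite Rmin_left, Rmax_right in Hc by lra. rewrite !Rabs_right; lra.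
        - rewrite Rmin_right, Rmax_left in Hc by lra. rewrite !Rabs_left1; lra. }
      assert (Hd2 : Rabs (f2 d) <= M) by (apply H; lra).
      replace (f (x + h) - f x - h * f1 x) with (h * (f2 d * (c - x))).
      * rewrite !Rabs_mult. rewrite <- (pow2_abs h).
        pose proof (Rabs_pos h). pose proof (Rabs_pos (c - x)). pose proof (Rabs_pos (f2 d)).
        replace (M * Rabs h ^ 2) with (Rabs h * (M * Rabs h)) by ring.
        apply Rmult_le_compat_l; [assumption|]. apply Rmult_le_compat; assumption.
      * rewrite <- Ed. replace (x + h - x) with h in Ec by ring. rewrite Ec; ring.
Qed.

Lemma RInt_eq (f : R -> R) (a b l : R) : is_RInt f a b l -> RInt f a b = l.
Proof. apply (is_RInt_unique f a b l). Qed.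

Lemma is_RInt_scal_R (f : R -> R) (a b c l : R) :
  is_RInt f a b l -> is_RInt (fun s => c * f s) a b (c * l).
Proof. apply (is_RInt_scal f a b c l). Qed.

Lemma RInt_cont_ex (f : R -> R) (a b : R) : (forall s, continuous f s) -> ex_RInt f a b.
Proof. intros H; apply (ex_RInt_continuous f); intros z _; apply H. Qed.

Lemma RInt_lin (f g : R -> R) (a b u v : R) :
  (forall s, continuous f s) -> (forall s, continuous g s) ->
  RInt (fun s => u * f s + v * g s) a b = u * RInt f a b + v * RInt g a b.
Proof.
  intros Hf Hg. apply is_RInt_unique.
  apply (is_RInt_plus (fun s => u * f s) (fun s => v * g s)).
  - apply (is_RInt_scal f a b u). apply (RInt_correct f), RInt_cont_ex, Hf.
  - apply (is_RInt_scal g a b v). apply (RInt_correct g), RInt_cont_ex, Hg.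
Qed.

Lemma RInt_abs_le (f : R -> R) (a b M : R) : a <= b -> (forall s, continuous f s) ->
  (forall s, a <= s <= b -> Rabs (f s) <= M) -> Rabs (RInt f a b) <= M * (b - a).
Proof.
  intros Hab Hf H.
  eapply Rle_trans.
  - apply (norm_RInt_le f (fun _ => M) a b (RInt f a b) (scal (b - a) M)).
    + exact Hab.
    + exact H.
    + apply (RInt_correct f), RInt_cont_ex, Hf.
    + apply (is_RInt_const a b M).
  - unfold scal; simpl; unfold mult; simpl. lra.
Qed.

(** * Fourier-type integrals over the quarter period *)

Definition osc (w k : R -> R) (x : R) : R :=
  RInt (fun s => w s * k (x * cos s)) 0 (PI / 2).

Lemma continuous_cos_lin (a s : R) : continuous (fun s => cos (a * s)) s.
Proof.
  apply (ex_derive_continuous (fun s => cos (a * s))). auto_derive. exact I.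
Qed.

Lemma continuous_osc_integrand (w k : R -> R) (x s : R) :
  (forall s, continuous w s) -> (forall s, continuous k s) ->
  continuous (fun s => w s * k (x * cos s)) s.
Proof.
  intros Hw Hk. apply (continuous_mult w (fun s => k (x * cos s))); [apply Hw|].
  apply (continuous_comp (fun s => x * cos s) k); [|apply Hk].
  apply (ex_derive_continuous (fun s => x * cos s)). auto_derive. exact I.
Qed.

Lemma is_derive_osc (w k k1 k2 : R -> R) (x : R) :
  (forall s, continuous w s) -> (forall s, Rabs (w s) <= 1) ->
  (forall y, is_derive k y (k1 y)) -> (forall y, is_derive k1 y (k2 y)) ->
  (forall y, Rabs (k2 y) <= 1) ->
  is_derive (osc w k) x (osc (fun s => w s * cos s) k1 x).
Proof.
  intros Hw Hw1 Hk Hk1 Hk2.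
  assert (Ck : forall s, continuous k s)
    by (intros s; apply (ex_derive_continuous k); eexists; apply Hk).
  assert (Ck1 : forall s, continuous k1 s)
    by (intros s; apply (ex_derive_continuous k1); eexists; apply Hk1).
  assert (Cwc : forall s, continuous (fun s => w s * cos s) s).
  { intros s. apply (continuous_mult w cos); [apply Hw|].
    apply (ex_derive_continuous cos). auto_derive. exact I. }
  apply derive_of_quadratic with (M := PI / 2) (eta := 1); [lra|].
  intros h _. unfold osc.
  assert (C1 := fun s => continuous_osc_integrand w k (x + h) s Hw Ck).
  assert (C2 := fun s => continuous_osc_integrand w k x s Hw Ck).
  assert (C3 := fun s => continuous_osc_integrand _ k1 x s Cwc Ck1).
  set (F1 := fun s => w s * k ((x + h) * cos s)) in *.
  set (F2 := fun s => w s * k (x * cos s)) in *.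
  set (F3 := fun s => w s * cos s * k1 (x * cos s)) in *.
  replace (RInt F1 0 (PI / 2) - RInt F2 0 (PI / 2) - h * RInt F3 0 (PI / 2))
    with (RInt (fun s => 1 * (1 * F1 s + (-1) * F2 s) + (- h) * F3 s) 0 (PI / 2)).
  2:{ transitivity (1 * RInt (fun s => 1 * F1 s + (-1) * F2 s) 0 (PI / 2)
                    + - h * RInt F3 0 (PI / 2)).
      - apply RInt_lin; [|exact C3].
        intros s. apply (continuous_plus (fun s => 1 * F1 s) (fun s => -1 * F2 s)).
        + apply (continuous_scal_r 1 F1), C1.
        + apply (continuous_scal_r (-1) F2), C2.
      - replace (RInt (fun s => 1 * F1 s + (-1) * F2 s) 0 (PI / 2))
          with (1 * RInt F1 0 (PI / 2) + (-1) * RInt F2 0 (PI / 2)); [Rring|].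
        symmetry; apply RInt_lin; assumption. }
  replace (PI / 2 * h ^ 2) with (h ^ 2 * (PI / 2 - 0)) by ring.
  pose proof PI_RGT_0.
  apply RInt_abs_le; [lra| |].
  - intros s. apply (continuous_plus (fun s => 1 * (1 * F1 s + -1 * F2 s)) (fun s => - h * F3 s)).
    + apply (continuous_scal_r 1 (fun s => 1 * F1 s + -1 * F2 s)).
      apply (continuous_plus (fun s => 1 * F1 s) (fun s => -1 * F2 s)).
      * apply (continuous_scal_r 1 F1), C1.
      * apply (continuous_scal_r (-1) F2), C2.
    + apply (continuous_scal_r (-h) F3), C3.
  - intros s _. unfold F1, F2, F3.
    replace (1 * (1 * (w s * k ((x + h) * cos s)) + -1 * (w s * k (x * cos s))) +
             - h * (w s * cos s * k1 (x * cos s)))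
      with (w s * (k (x * cos s + h * cos s) - k (x * cos s) - (h * cos s) * k1 (x * cos s)))
      by (replace ((x + h) * cos s) with (x * cos s + h * cos s) by ring; ring).
    rewrite Rabs_mult.
    assert (T : Rabs (k (x * cos s + h * cos s) - k (x * cos s) - (h * cos s) * k1 (x * cos s))
                <= 1 * (h * cos s) ^ 2).
    { apply taylor2_bound with (f2 := k2). intros t _; auto. }
    pose proof (COS_bound s) as B. pose proof (Hw1 s). pose proof (Rabs_pos (w s)).
    assert (cos s ^ 2 <= 1) by nra.
    assert ((h * cos s) ^ 2 <= h ^ 2).
    { rewrite Rpow_mult_distr. pose proof (pow2_ge_0 h). nra. }
    apply Rle_trans with (1 * (1 * (h * cos s) ^ 2)); [|lra].
    apply Rmult_le_compat; [assumption | apply Rabs_pos | assumption | assumption].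
Qed.

(** [Ec + i Es] is the integral of [cos (nu s) exp (i x cos s)] over a quarter
    period, the oscillating part of Schlafli's representation; [Ec1] and [Es1] are
    the derivatives in [x]. *)
Definition cosw (nu s : R) : R := cos (nu * s).
Definition Ec (nu : R) : R -> R := osc (cosw nu) cos.
Definition Es (nu : R) : R -> R := osc (cosw nu) sin.
Definition Ec1 (nu x : R) : R := - osc (fun s => cosw nu s * cos s) sin x.
Definition Es1 (nu x : R) : R := osc (fun s => cosw nu s * cos s) cos x.

Lemma continuous_mult_R (f g : R -> R) (s : R) :
  continuous f s -> continuous g s -> continuous (fun t => f t * g t) s.
Proof. apply (continuous_mult f g). Qed.

Lemma continuous_plus_R (f g : R -> R) (s : R) :
  continuous f s -> continuous g s -> continuous (fun t => f t + g t) s.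
Proof. apply (continuous_plus f g). Qed.

Lemma continuous_minus_R (f g : R -> R) (s : R) :
  continuous f s -> continuous g s -> continuous (fun t => f t - g t) s.
Proof. apply (continuous_minus f g). Qed.

Lemma Rabs_cosw (nu s : R) : Rabs (cosw nu s) <= 1.
Proof. apply Rabs_le, COS_bound. Qed.

Lemma Rabs_cosw_cos (nu s : R) : Rabs (cosw nu s * cos s) <= 1.
Proof.
  rewrite Rabs_mult. pose proof (Rabs_cosw nu s).
  assert (Rabs (cos s) <= 1) by apply Rabs_le, COS_bound.
  pose proof (Rabs_pos (cosw nu s)). pose proof (Rabs_pos (cos s)). nra.
Qed.

Lemma continuous_cosw_cos (nu s : R) : continuous (fun s => cosw nu s * cos s) s.
Proof. apply continuous_mult_R; [apply continuous_cos_lin | apply continuous_cos]. Qed.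

(** The equation [x^2 f'' + x f' + (x^2 - nu^2) f = r] as a first-order system. *)
Definition bessel_inh (nu : R) (r f g : R -> R) : Prop :=
  forall x, 0 < x ->
    is_derive f x (g x) /\
    is_derive g x (- g x / x - (1 - nu ^ 2 / x ^ 2) * f x + r x / x ^ 2).

(** The second-order operator in [x] applied to [k (x cos s)], where
    [k'' = - k], equals minus its second derivative in [s]; integrating by
    parts against [cos (nu s)] leaves only boundary terms. *)
Lemma osc_bessel (nu x : R) (k k1 : R -> R) : 0 < x ->
  (forall y, is_derive k y (k1 y)) -> (forall y, is_derive k1 y (- k y)) ->
  x * osc (fun s => cosw nu s * cos s) k1 x
  - x ^ 2 * osc (fun s => cosw nu s * cos s * cos s) k x
  + (x ^ 2 - nu ^ 2) * osc (cosw nu) k x =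
  x * cos (nu * PI / 2) * k1 0 - nu * sin (nu * PI / 2) * k 0.
Proof.
  intros Hx Hk Hk1.
  assert (Ck : forall s, continuous k s)
    by (intros s; apply (ex_derive_continuous k); eexists; apply Hk).
  assert (Ck1 : forall s, continuous k1 s)
    by (intros s; apply (ex_derive_continuous k1); eexists; apply Hk1).
  assert (C1 := fun s => continuous_osc_integrand _ k1 x s (continuous_cosw_cos nu) Ck1).
  assert (C2 := fun s => continuous_osc_integrand _ k x s
     (fun s => continuous_mult_R _ _ s (continuous_cosw_cos nu s) (continuous_cos s)) Ck).
  assert (C3 := fun s => continuous_osc_integrand _ k x s (continuous_cos_lin nu) Ck).
  unfold osc.
  set (F1 := fun s => cosw nu s * cos s * k1 (x * cos s)) in *.
  set (F2 := fun s => cosw nu s * cos s * cos s * k (x * cos s)) in *.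
  set (F3 := fun s => cosw nu s * k (x * cos s)) in *.
  set (B := fun s => - (cos (nu * s) * (- x * sin s * k1 (x * cos s))
                        + nu * sin (nu * s) * k (x * cos s))).
  set (G := fun s => x * F1 s + 1 * (- x ^ 2 * F2 s + (x ^ 2 - nu ^ 2) * F3 s)).
  assert (CG : forall s, continuous (fun s => - x ^ 2 * F2 s + (x ^ 2 - nu ^ 2) * F3 s) s).
  { intros s. apply continuous_plus_R.
    - apply (continuous_scal_r (- x ^ 2) F2), C2.
    - apply (continuous_scal_r (x ^ 2 - nu ^ 2) F3), C3. }
  assert (I : is_RInt G 0 (PI / 2) (B (PI / 2) - B 0)).
  { apply (is_RInt_derive B G).
    - intros s _. unfold B, G, F1, F2, F3, cosw.
      assert (Dk : is_derive (fun s => k (x * cos s)) s (k1 (x * cos s) * (- x * sin s))).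
      { apply derive_comp; [apply Hk|]. auto_derive; [exact I|ring]. }
      assert (Dk1 : is_derive (fun s => k1 (x * cos s)) s (- k (x * cos s) * (- x * sin s))).
      { apply derive_comp; [apply Hk1|]. auto_derive; [exact I|ring]. }
      eapply derive_eq.
      + apply (is_derive_opp (fun s => cos (nu * s) * (- x * sin s * k1 (x * cos s))
                        + nu * sin (nu * s) * k (x * cos s))).
        apply derive_plus; apply derive_mult.
        * instantiate (1 := - nu * sin (nu * s)). auto_derive; [exact I|ring].
        * apply derive_mult; [|exact Dk1].
          instantiate (1 := - x * cos s). auto_derive; [exact I|ring].
        * instantiate (1 := nu ^ 2 * cos (nu * s)). auto_derive; [exact I|ring].
        * exact Dk.
      + unfold opp; simpl.
        pose proof (sin2_cos2 s) as E. unfold Rsqr in E.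
        assert (E2 : sin s * sin s = 1 - cos s * cos s) by lra.
        transitivity (x * (cos (nu * s) * cos s * k1 (x * cos s)) +
          (x ^ 2 * (sin s * sin s) - nu ^ 2) * (cos (nu * s) * k (x * cos s))); [ring|].
        rewrite E2; ring.
    - intros s _. apply continuous_plus_R.
      + apply (continuous_scal_r x F1), C1.
      + apply (continuous_scal_r 1 (fun s => - x ^ 2 * F2 s + (x ^ 2 - nu ^ 2) * F3 s)), CG. }
  apply RInt_eq in I. unfold G in I.
  replace (RInt (fun s => x * F1 s + 1 * (- x ^ 2 * F2 s + (x ^ 2 - nu ^ 2) * F3 s)) 0 (PI / 2))
    with (x * RInt F1 0 (PI / 2) + 1 * (- x ^ 2 * RInt F2 0 (PI / 2)
                                  + (x ^ 2 - nu ^ 2) * RInt F3 0 (PI / 2))) in I.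
  2:{ rewrite <- (RInt_lin F2 F3) by assumption.
      symmetry; apply RInt_lin; assumption. }
  transitivity (B (PI / 2) - B 0); [rewrite <- I; ring|].
  unfold B. rewrite cos_PI2, sin_PI2, sin_0, !Rmult_0_r, sin_0.
  replace (nu * (PI / 2)) with (nu * PI / 2) by field. ring.
Qed.

Lemma Rabs_sin (y : R) : Rabs (sin y) <= 1.
Proof. apply Rabs_le, SIN_bound. Qed.

Lemma Rabs_cos (y : R) : Rabs (cos y) <= 1.
Proof. apply Rabs_le, COS_bound. Qed.

Lemma osc_scal (w k : R -> R) (a x : R) :
  (forall s, continuous w s) -> (forall s, continuous k s) ->
  osc w (fun y => a * k y) x = a * osc w k x.
Proof.
  intros Hw Hk. unfold osc.
  pose proof (fun s => continuous_osc_integrand w k x s Hw Hk) as C.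
  set (F := fun s => w s * k (x * cos s)) in *.
  transitivity (RInt (fun s => a * F s + 0 * F s) 0 (PI / 2)).
  - apply RInt_ext. intros s _. unfold F. Rring.
  - transitivity (a * RInt F 0 (PI / 2) + 0 * RInt F 0 (PI / 2)); [|Rring].
    apply RInt_lin; exact C.
Qed.

Lemma bessel_inh_Ec (nu : R) :
  bessel_inh nu (fun _ => - nu * sin (nu * PI / 2)) (Ec nu) (Ec1 nu).
Proof.
  intros x Hx. unfold Ec, Ec1.
  assert (O : forall w, (forall s, continuous w s) ->
     osc w (fun y => - sin y) x = - osc w sin x).
  { intros w Hw.
    replace (- osc w sin x) with (-1 * osc w sin x) by ring.
    rewrite <- osc_scal; [|exact Hw|exact continuous_sin].
    unfold osc; apply RInt_ext; intros; Rring. }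
  split.
  - eapply derive_eq.
    + apply (is_derive_osc _ cos (fun y => - sin y) (fun y => - cos y)).
      * apply continuous_cos_lin.
      * apply Rabs_cosw.
      * apply is_derive_cos.
      * intros y; apply (is_derive_opp sin), is_derive_sin.
      * intros y; rewrite Rabs_Ropp; apply Rabs_cos.
    + apply O. apply continuous_cosw_cos.
  - eapply derive_eq.
    + apply (is_derive_opp (osc (fun s => cosw nu s * cos s) sin)).
      apply (is_derive_osc _ sin cos (fun y => - sin y)).
      * apply continuous_cosw_cos.
      * apply Rabs_cosw_cos.
      * apply is_derive_sin.
      * apply is_derive_cos.
      * intros y; rewrite Rabs_Ropp; apply Rabs_sin.
    + unfold opp; simpl.
      pose proof (osc_bessel nu x cos (fun y => - sin y) Hx is_derive_cos
        (fun y => is_derive_opp sin y _ (is_derive_sin y))) as E.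
      rewrite O in E by apply continuous_cosw_cos.
      rewrite sin_0, cos_0 in E.
      apply Rmult_eq_reg_l with (x ^ 2); [|apply pow_nonzero; lra].
      field_simplify; [lra|lra].
Qed.

Lemma bessel_inh_Es (nu : R) :
  bessel_inh nu (fun x => x * cos (nu * PI / 2)) (Es nu) (Es1 nu).
Proof.
  intros x Hx. unfold Es, Es1. split.
  - apply (is_derive_osc _ sin cos (fun y => - sin y)).
    + apply continuous_cos_lin.
    + apply Rabs_cosw.
    + apply is_derive_sin.
    + apply is_derive_cos.
    + intros y; rewrite Rabs_Ropp; apply Rabs_sin.
  - eapply derive_eq.
    + apply (is_derive_osc _ cos (fun y => - sin y) (fun y => - cos y)).
      * apply continuous_cosw_cos.
      * apply Rabs_cosw_cos.
      * apply is_derive_cos.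
      * intros y; apply (is_derive_opp sin), is_derive_sin.
      * intros y; rewrite Rabs_Ropp; apply Rabs_cos.
    + pose proof (osc_bessel nu x sin cos Hx is_derive_sin is_derive_cos) as E.
      rewrite sin_0, cos_0 in E.
      assert (C : forall s, continuous (fun s => cosw nu s * cos s * cos s) s)
        by (intros s; apply continuous_mult_R; [apply continuous_cosw_cos | apply continuous_cos]).
      assert (O : osc (fun s => cosw nu s * cos s * cos s) (fun y => - sin y) x
                  = -1 * osc (fun s => cosw nu s * cos s * cos s) sin x).
      { rewrite <- osc_scal; [|exact C|exact continuous_sin].
        unfold osc; apply RInt_ext; intros; Rring. }
      cbv beta in *. rewrite O.
      apply Rmult_eq_reg_l with (x ^ 2); [|apply pow_nonzero; lra].
      field_simplify; [lra|lra].
Qed.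

(** * Exponentially decaying Schlafli integrals *)

(** [dint nu x] is the integral of [exp (nu a - x sinh a)] over [(0, +oo)], the
    decaying part of Schlafli's representation.  At the origin it behaves like
    [Gamma nu (x / 2)^(- nu)] when [nu > 0]. *)
Definition sh (a : R) : R := (exp a - exp (- a)) / 2.
Definition ker (nu x a : R) : R := exp (nu * a - x * sh a).

Definition improper (g : R -> R) (l : R) : Prop :=
  is_lim_seq (fun N => RInt g 0 (INR N)) l.

Definition dint (nu x : R) : R := real (Lim_seq (fun N => RInt (ker nu x) 0 (INR N))).

Lemma continuous_ker (nu x a : R) : continuous (ker nu x) a.
Proof.
  apply (ex_derive_continuous (ker nu x)). unfold ker, sh. auto_derive. exact I.
Qed.

Lemma ker_pos (nu x a : R) : 0 < ker nu x a.
Proof. apply exp_pos. Qed.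

Lemma exp_ge_quadratic (a : R) : 0 <= a -> 1 + a + a ^ 2 / 4 <= exp a.
Proof.
  intros Ha. replace a with (a / 2 + a / 2) at 3 by field. rewrite exp_plus.
  pose proof (exp_ineq1_le (a / 2)). nra.
Qed.

Lemma exp_neg_le_1 (a : R) : 0 <= a -> exp (- a) <= 1.
Proof. intros Ha. rewrite <- exp_0. apply exp_le; lra. Qed.

Lemma sh_lower (a : R) : 0 <= a -> a ^ 2 / 8 <= sh a.
Proof.
  intros Ha. unfold sh. pose proof (exp_ge_quadratic a Ha). pose proof (exp_neg_le_1 a Ha). lra.
Qed.

Lemma ker_bound (nu x a : R) : 0 < x -> 0 <= a ->
  ker nu x a <= exp (2 * (nu + 1) ^ 2 / x) * exp (- a).
Proof.
  intros Hx Ha. unfold ker. rewrite <- exp_plus. apply exp_le.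
  pose proof (sh_lower a Ha) as H.
  assert (x * (a ^ 2 / 8) <= x * sh a) by (apply Rmult_le_compat_l; lra).
  assert (0 <= / x * (2 * (nu + 1) - x * a / 2) ^ 2 / 2).
  { apply Rdiv_le_0_compat; [|lra]. apply Rmult_le_pos; [|apply pow2_ge_0].
    left; apply Rinv_0_lt_compat, Hx. }
  replace (/ x * (2 * (nu + 1) - x * a / 2) ^ 2 / 2)
    with (2 * (nu + 1) ^ 2 / x - (nu + 1) * a + x * (a ^ 2 / 8)) in H1 by (field; lra).
  lra.
Qed.

Lemma RInt_exp_neg (N : nat) : is_RInt (fun a => exp (- a)) 0 (INR N) (1 - exp (- INR N)).
Proof.
  replace (1 - exp (- INR N)) with (minus (- exp (- INR N)) (- exp (- 0)))
    by (unfold minus, plus, opp; simpl; rewrite Ropp_0, exp_0; ring).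
  apply (is_RInt_derive (fun a => - exp (- a)) (fun a => exp (- a))).
  - intros s _. auto_derive; [exact I|ring].
  - intros s _. apply (ex_derive_continuous (fun a => exp (- a))). auto_derive. exact I.
Qed.

Lemma improper_ker (nu x : R) : 0 < x -> improper (ker nu x) (dint nu x).
Proof.
  intros Hx. unfold improper, dint. apply Lim_seq_correct'.
  set (C := exp (2 * (nu + 1) ^ 2 / x)).
  assert (HC : 0 < C) by apply exp_pos.
  apply ex_finite_lim_seq_incr with (M := C).
  - intros N.
    assert (Ch : RInt (ker nu x) 0 (INR (S N)) =
              RInt (ker nu x) 0 (INR N) + RInt (ker nu x) (INR N) (INR (S N))).
    { symmetry. apply (RInt_Chasles (ker nu x)); apply RInt_cont_ex, continuous_ker. }
    rewrite Ch.
    assert (0 <= RInt (ker nu x) (INR N) (INR (S N))); [|lra].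
    apply RInt_ge_0.
    + rewrite S_INR; lra.
    + apply RInt_cont_ex, continuous_ker.
    + intros a _. left; apply ker_pos.
  - intros N.
    apply Rle_trans with (RInt (fun a => C * exp (- a)) 0 (INR N)).
    + apply RInt_le.
      * apply pos_INR.
      * apply RInt_cont_ex, continuous_ker.
      * apply RInt_cont_ex. intros s. apply (ex_derive_continuous (fun a => C * exp (- a))).
        auto_derive. exact I.
      * intros a Ha. apply ker_bound; lra.
    + rewrite (RInt_eq _ _ _ _ (is_RInt_scal_R _ _ _ C _ (RInt_exp_neg N))).
      pose proof (exp_pos (- INR N)). nra.
Qed.

Lemma improper_lin (f g : R -> R) (u v lf lg : R) :
  (forall s, continuous f s) -> (forall s, continuous g s) ->
  improper f lf -> improper g lg ->
  improper (fun a => u * f a + v * g a) (u * lf + v * lg).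
Proof.
  intros Cf Cg Hf Hg. unfold improper.
  apply is_lim_seq_ext with (u := fun N => u * RInt f 0 (INR N) + v * RInt g 0 (INR N)).
  - intros N. symmetry. apply RInt_lin; assumption.
  - apply is_lim_seq_plus'.
    + apply (is_lim_seq_scal_l _ u (Finite lf)), Hf.
    + apply (is_lim_seq_scal_l _ v (Finite lg)), Hg.
Qed.

Lemma improper_le (f g : R -> R) (lf lg : R) :
  (forall s, continuous f s) -> (forall s, continuous g s) ->
  (forall a, 0 <= a -> f a <= g a) -> improper f lf -> improper g lg -> lf <= lg.
Proof.
  intros Cf Cg H Hf Hg.
  apply (is_lim_seq_le (fun N => RInt f 0 (INR N)) (fun N => RInt g 0 (INR N)) lf lg);
    [|exact Hf|exact Hg].
  intros N. apply RInt_le.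
  - apply pos_INR.
  - apply RInt_cont_ex, Cf.
  - apply RInt_cont_ex, Cg.
  - intros a Ha. apply H; lra.
Qed.

Lemma continuous_lin2 (f g : R -> R) (u v s : R) :
  continuous f s -> continuous g s -> continuous (fun a => u * f a + v * g a) s.
Proof.
  intros Cf Cg. apply continuous_plus_R.
  - apply (continuous_scal_r u f), Cf.
  - apply (continuous_scal_r v g), Cg.
Qed.

Lemma improper_ker_lin (u v m n x y : R) : 0 < x -> 0 < y ->
  improper (fun a => u * ker m x a + v * ker n y a) (u * dint m x + v * dint n y).
Proof.
  intros Hx Hy.
  apply (improper_lin (ker m x) (ker n y) u v);
    auto using continuous_ker, improper_ker.
Qed.

Lemma ker_shift (nu x a b : R) : ker (nu + b) x a = ker nu x a * exp (b * a).
Proof. unfold ker. rewrite <- exp_plus. f_equal; ring. Qed.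

Lemma ker_zero (nu x : R) : ker nu x 0 = 1.
Proof.
  unfold ker, sh. rewrite Ropp_0, Rminus_diag, !Rmult_0_r.
  replace (0 - x * (0 / 2)) with 0 by field. apply exp_0.
Qed.

Lemma is_lim_seq_exp_neg : is_lim_seq (fun N => exp (- INR N)) 0.
Proof.
  apply (is_lim_seq_le_le (fun _ => 0) _ (fun N => / (1 + INR N))).
  - intros N. split; [left; apply exp_pos|].
    rewrite exp_Ropp. pose proof (pos_INR N).
    apply Rinv_le_contravar; [lra|]. apply exp_ineq1_le.
  - apply is_lim_seq_const.
  - replace (Finite 0) with (Rbar_inv p_infty) by reflexivity.
    apply is_lim_seq_inv; [|discriminate].
    eapply is_lim_seq_plus; [apply is_lim_seq_const | apply is_lim_seq_INR | reflexivity].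
Qed.

(** The integrand on the left minus that on the right is the derivative of
    [- ker nu x]. *)
Lemma dint_rec (nu x : R) : 0 < x ->
  x / 2 * (dint (nu + 1) x + dint (nu - 1) x) = 1 + nu * dint nu x.
Proof.
  intros Hx.
  set (G := fun a => x / 2 * (1 * ker (nu + 1) x a + 1 * ker (nu - 1) x a) + - nu * ker nu x a).
  assert (C := fun m => continuous_ker m x).
  assert (CG1 := fun s => continuous_lin2 _ _ 1 1 s (C (nu + 1) s) (C (nu - 1) s)).
  assert (H1 : improper G (x / 2 * (1 * dint (nu + 1) x + 1 * dint (nu - 1) x) + - nu * dint nu x)).
  { apply (improper_lin (fun a => 1 * ker (nu + 1) x a + 1 * ker (nu - 1) x a) (ker nu x));
      [exact CG1 | apply C | | apply improper_ker, Hx].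
    apply improper_ker_lin; exact Hx. }
  assert (H2 : improper G 1).
  { unfold improper.
    apply is_lim_seq_ext with (u := fun N => 1 - ker nu x (INR N)).
    - intros N. symmetry. apply RInt_eq.
      replace (1 - ker nu x (INR N)) with (minus (- ker nu x (INR N)) (- ker nu x 0))
        by (unfold minus, plus, opp; simpl; rewrite ker_zero; ring).
      apply (is_RInt_derive (fun a => - ker nu x a) G).
      + intros s _. unfold G.
        replace (nu - 1) with (nu + -1) by ring. rewrite !ker_shift.
        unfold ker, sh. auto_derive; [exact I|].
        replace (1 * s) with s by ring. replace (-1 * s) with (- s) by ring.
        unfold Rdiv, Rminus. field.
      + intros s _. apply (continuous_lin2 (fun a => 1 * ker (nu + 1) x a + 1 * ker (nu - 1) x a)
                        (ker nu x)); [apply CG1|apply C].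
    - replace (Finite 1) with (Finite (1 - 0)) by (f_equal; ring).
      apply is_lim_seq_minus'; [apply is_lim_seq_const|].
      apply (is_lim_seq_le_le (fun _ => 0) _
               (fun N => exp (2 * (nu + 1) ^ 2 / x) * exp (- INR N))).
      + intros N; split; [left; apply ker_pos|]. apply ker_bound; [exact Hx|apply pos_INR].
      + apply is_lim_seq_const.
      + replace (Finite 0) with (Rbar_mult (exp (2 * (nu + 1) ^ 2 / x)) 0)
          by (simpl; f_equal; ring).
        apply is_lim_seq_scal_l, is_lim_seq_exp_neg. }
  unfold improper in H1, H2.
  apply is_lim_seq_unique in H1. apply is_lim_seq_unique in H2.
  rewrite H2 in H1. injection H1; intros E. lra.
Qed.

Lemma dint_nonneg (nu x : R) : 0 < x -> 0 <= dint nu x.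
Proof.
  intros Hx.
  assert (H : improper (fun a => 0 * ker nu x a + 0 * ker nu x a) (0 * dint nu x + 0 * dint nu x)).
  { apply improper_ker_lin; exact Hx. }
  apply Rle_trans with (0 * dint nu x + 0 * dint nu x); [lra|].
  eapply improper_le; [| | |exact H|apply improper_ker, Hx].
  - intros s. apply continuous_lin2; apply continuous_ker.
  - apply continuous_ker.
  - intros a _. pose proof (ker_pos nu x a). simpl; lra.
Qed.

Lemma dint_mono (nu mu x : R) : 0 < x -> nu <= mu -> dint nu x <= dint mu x.
Proof.
  intros Hx H. eapply improper_le; [| | |apply improper_ker, Hx|apply improper_ker, Hx].
  - apply continuous_ker.
  - apply continuous_ker.
  - intros a Ha. unfold ker. apply exp_le. nra.
Qed.

Lemma sh_nonneg (a : R) : 0 <= a -> 0 <= sh a.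
Proof. intros Ha. pose proof (sh_lower a Ha). nra. Qed.

Definition dint1 (nu x : R) : R := - (dint (nu + 1) x - dint (nu - 1) x) / 2.

Lemma is_derive_dint (nu x : R) : 0 < x -> is_derive (dint nu) x (dint1 nu x).
Proof.
  intros Hx.
  apply derive_of_quadratic with (M := dint (nu + 2) (x / 2)) (eta := x / 2); [lra|].
  intros h Hh. apply Rabs_lt_between in Hh.
  assert (Hxh : 0 < x + h) by lra.
  set (G := fun a => 1 * (1 * ker nu (x + h) a + -1 * ker nu x a) +
                     h / 2 * (1 * ker (nu + 1) x a + -1 * ker (nu - 1) x a)).
  assert (CG : forall s, continuous G s).
  { intros s. apply (continuous_lin2 (fun a => 1 * ker nu (x + h) a + -1 * ker nu x a)
      (fun a => 1 * ker (nu + 1) x a + -1 * ker (nu - 1) x a)); apply continuous_lin2;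
      apply continuous_ker. }
  assert (HG : improper G (1 * (1 * dint nu (x + h) + -1 * dint nu x) +
                     h / 2 * (1 * dint (nu + 1) x + -1 * dint (nu - 1) x))).
  { apply (improper_lin (fun a => 1 * ker nu (x + h) a + -1 * ker nu x a)
      (fun a => 1 * ker (nu + 1) x a + -1 * ker (nu - 1) x a)).
    - intros s; apply continuous_lin2; apply continuous_ker.
    - intros s; apply continuous_lin2; apply continuous_ker.
    - apply improper_ker_lin; lra.
    - apply improper_ker_lin; lra. }
  replace (dint nu (x + h) - dint nu x - h * dint1 nu x)
    with (1 * (1 * dint nu (x + h) + -1 * dint nu x) +
                     h / 2 * (1 * dint (nu + 1) x + -1 * dint (nu - 1) x))
    by (unfold dint1; field).
  assert (B : forall a, 0 <= a -> Rabs (G a) <= h ^ 2 * ker (nu + 2) (x / 2) a).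
  { intros a Ha.
    replace (G a) with (ker nu (x + h) a - ker nu x a - h * (- sh a * ker nu x a)).
    2:{ unfold G. replace (nu - 1) with (nu + -1) by ring.
        rewrite !ker_shift. unfold sh.
        replace (1 * a) with a by ring. replace (-1 * a) with (- a) by ring. field. }
    rewrite (Rmult_comm (h ^ 2)).
    apply (taylor2_bound (fun y => ker nu y a) (fun y => - sh a * ker nu y a)
             (fun y => sh a ^ 2 * ker nu y a)).
    intros t Ht. split; [|split].
    - unfold ker. auto_derive; [exact I|]. unfold Rminus. ring.
    - unfold ker. auto_derive; [exact I|]. unfold Rminus. ring.
    - assert (Ht2 : x / 2 <= t).
      { eapply Rle_trans; [|apply Ht]. apply Rmin_glb; lra. }
      pose proof (sh_nonneg a Ha) as Hs.
      rewrite Rabs_right.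
      2:{ apply Rle_ge, Rmult_le_pos; [apply pow2_ge_0|left; apply ker_pos]. }
      rewrite ker_shift, (Rmult_comm (sh a ^ 2)).
      apply Rmult_le_compat.
      + left; apply ker_pos.
      + apply pow2_ge_0.
      + unfold ker. apply exp_le. nra.
      + replace (2 * a) with (a + a) by ring. rewrite exp_plus.
        assert (sh a <= exp a) by (unfold sh; pose proof (exp_pos a); pose proof (exp_pos (- a)); lra).
        nra. }
  assert (HK : improper (fun a => h ^ 2 * ker (nu + 2) (x / 2) a + 0 * ker (nu + 2) (x / 2) a)
     (h ^ 2 * dint (nu + 2) (x / 2) + 0 * dint (nu + 2) (x / 2))).
  { apply improper_ker_lin; lra. }
  assert (HK' : improper (fun a => - h ^ 2 * ker (nu + 2) (x / 2) a + 0 * ker (nu + 2) (x / 2) a)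
     (- h ^ 2 * dint (nu + 2) (x / 2) + 0 * dint (nu + 2) (x / 2))).
  { apply improper_ker_lin; lra. }
  apply Rabs_le; split.
  - apply Rle_trans with (- h ^ 2 * dint (nu + 2) (x / 2) + 0 * dint (nu + 2) (x / 2)); [lra|].
    eapply improper_le; [| | |exact HK'|exact HG].
    + intros s; apply continuous_lin2; apply continuous_ker.
    + exact CG.
    + intros a Ha. pose proof (B a Ha) as Hb. apply Rabs_le_between in Hb. simpl in *; lra.
  - apply Rle_trans with (h ^ 2 * dint (nu + 2) (x / 2) + 0 * dint (nu + 2) (x / 2)); [|lra].
    eapply improper_le; [| | |exact HG|exact HK].
    + exact CG.
    + intros s; apply continuous_lin2; apply continuous_ker.
    + intros a Ha. pose proof (B a Ha) as Hb. apply Rabs_le_between in Hb. simpl in *; lra.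
Qed.

(** Since [dint1] is a combination of neighbouring orders, the second-order
    equation follows from the recurrence alone. *)
Lemma bessel_inh_dint (nu : R) : bessel_inh nu (fun x => x + nu) (dint nu) (dint1 nu).
Proof.
  intros x Hx. split; [apply is_derive_dint, Hx|].
  eapply derive_eq.
  - apply (derive_ext (fun y => - / 2 * (dint (nu + 1) y - dint (nu - 1) y))).
    + intros y. unfold dint1. field.
    + apply is_derive_scal, derive_minus; apply is_derive_dint, Hx.
  - pose proof (dint_rec nu x Hx) as E0.
    pose proof (dint_rec (nu + 1) x Hx) as E1.
    pose proof (dint_rec (nu - 1) x Hx) as E2.
    unfold dint1.
    replace (nu + 1 - 1) with nu in * by ring. replace (nu - 1 + 1) with nu in * by ring.
    set (d0 := dint nu x) in *. set (d1 := dint (nu + 1) x) in *.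
    set (e1 := dint (nu - 1) x) in *. set (d2 := dint (nu + 1 + 1) x) in *.
    set (e2 := dint (nu - 1 - 1) x) in *.
    assert (F1 : d2 = 2 / x * (1 + (nu + 1) * d1) - d0) by (rewrite <- E1; field; lra).
    assert (F2 : e2 = 2 / x * (1 + (nu - 1) * e1) - d0) by (rewrite <- E2; field; lra).
    rewrite F1, F2.
    assert (F3 : e1 = 2 / x * (1 + nu * d0) - d1) by (rewrite <- E0; field; lra).
    rewrite F3. field. lra.
Qed.

(** [cosh >= 1] turns the recurrence into an upper bound. *)
Lemma dint_large (nu x : R) : 0 < x -> 2 * Rabs nu <= x -> dint nu x <= 2 / x.
Proof.
  intros Hx Hn.
  assert (H : dint nu x <= / 2 * dint (nu + 1) x + / 2 * dint (nu - 1) x).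
  { assert (H1 : improper (fun a => / 2 * ker (nu + 1) x a + / 2 * ker (nu - 1) x a)
                   (/ 2 * dint (nu + 1) x + / 2 * dint (nu - 1) x)).
    { apply improper_ker_lin; lra. }
    eapply improper_le; [| | |apply improper_ker, Hx|exact H1].
    - apply continuous_ker.
    - intros s; apply continuous_lin2; apply continuous_ker.
    - intros a _. replace (nu - 1) with (nu + -1) by ring. rewrite !ker_shift.
      replace (1 * a) with a by ring. replace (-1 * a) with (- a) by ring.
      pose proof (ker_pos nu x a).
      pose proof (exp_ineq1_le a). pose proof (exp_ineq1_le (- a)). nra. }
  pose proof (dint_rec nu x Hx) as E.
  pose proof (dint_nonneg nu x Hx) as P.
  assert (nu * dint nu x <= x / 2 * dint nu x).
  { apply Rmult_le_compat_r; [exact P|]. pose proof (Rle_abs nu). lra. }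
  apply Rle_div_r; [exact Hx|]. nra.
Qed.

(** The left-hand side of the recurrence at order [- nu] is nonnegative. *)
Lemma dint_neg_bound (nu x : R) : 0 < x -> 0 < nu -> dint (- nu) x <= / nu.
Proof.
  intros Hx Hn. pose proof (dint_rec (- nu) x Hx) as E.
  pose proof (dint_nonneg (- nu + 1) x Hx). pose proof (dint_nonneg (- nu - 1) x Hx).
  apply Rmult_le_reg_l with nu; [exact Hn|]. rewrite Rinv_r by lra. nra.
Qed.

(** Young's inequality under the integral; the free parameter [l] is later tuned
    to [x]. *)
Lemma dint_young (nu s l x : R) : 0 < x -> 0 <= s <= 1 -> 0 < l ->
  dint (nu + s) x <= Rpower l s * ((1 - s) * dint nu x + s / l * dint (nu + 1) x).
Proof.
  intros Hx Hs Hl.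
  replace (Rpower l s * ((1 - s) * dint nu x + s / l * dint (nu + 1) x))
    with (Rpower l s * (1 - s) * dint nu x + Rpower l s * (s / l) * dint (nu + 1) x) by ring.
  assert (H : improper (fun a => Rpower l s * (1 - s) * ker nu x a
                           + Rpower l s * (s / l) * ker (nu + 1) x a)
     (Rpower l s * (1 - s) * dint nu x + Rpower l s * (s / l) * dint (nu + 1) x)).
  { apply improper_ker_lin; lra. }
  eapply improper_le; [| | |apply improper_ker, Hx|exact H].
  - apply continuous_ker.
  - intros t; apply continuous_lin2; apply continuous_ker.
  - intros a _. rewrite !ker_shift, Rmult_1_l.
    pose proof (young_exp s (a - ln l) Hs) as Y.
    assert (E1 : exp (s * a) = Rpower l s * exp (s * (a - ln l)))
      by (unfold Rpower; rewrite <- exp_plus; f_equal; ring).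
    assert (E2 : exp (a - ln l) = exp a / l).
    { unfold Rminus, Rdiv. rewrite exp_plus, exp_Ropp, exp_ln by exact Hl. reflexivity. }
    rewrite E2 in Y. rewrite E1.
    pose proof (Rpower_pos l s) as P1. pose proof (ker_pos nu x a) as P2.
    replace (Rpower l s * (1 - s) * ker nu x a + Rpower l s * (s / l) * (ker nu x a * exp a))
      with (ker nu x a * (Rpower l s * ((1 - s) + s * (exp a / l)))) by (field; lra).
    apply Rmult_le_compat_l; [lra|]. apply Rmult_le_compat_l; lra.
Qed.

Lemma Rabs_exp_minus_1 (y : R) : Rabs (exp y - 1) <= Rabs y * exp (Rabs y).
Proof.
  pose proof (exp_ineq1_le y). pose proof (exp_ineq1_le (- y)).
  destruct (Rle_dec 0 y) as [P|P].
  - assert (E : exp y * exp (- y) = 1) by (rewrite <- exp_plus, Rplus_opp_r, exp_0; reflexivity).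
    pose proof (exp_pos y).
    rewrite !Rabs_right by lra. nra.
  - assert (exp y < 1) by (rewrite <- exp_0; apply exp_increasing; lra).
    rewrite !Rabs_left by lra.
    assert (1 <= exp (- y)) by lra. nra.
Qed.

Lemma dint_lipschitz (nu mu x : R) : 0 < x -> Rabs (mu - nu) <= 1 ->
  Rabs (dint mu x - dint nu x) <= Rabs (mu - nu) * dint (nu + 2) x.
Proof.
  intros Hx Hm. set (h := mu - nu) in *.
  assert (HG : improper (fun a => 1 * ker mu x a + -1 * ker nu x a) (1 * dint mu x + -1 * dint nu x)).
  { apply improper_ker_lin; lra. }
  assert (HK : forall c, improper (fun a => c * ker (nu + 2) x a + 0 * ker (nu + 2) x a)
     (c * dint (nu + 2) x + 0 * dint (nu + 2) x)).
  { intros c. apply improper_ker_lin; lra. }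
  assert (B : forall a, 0 <= a ->
     Rabs (1 * ker mu x a + -1 * ker nu x a) <= Rabs h * ker (nu + 2) x a).
  { intros a Ha. replace mu with (nu + h) by (unfold h; ring). rewrite !ker_shift.
    pose proof (ker_pos nu x a) as P.
    replace (1 * (ker nu x a * exp (h * a)) + -1 * ker nu x a)
      with (ker nu x a * (exp (h * a) - 1)) by ring.
    rewrite Rabs_mult, (Rabs_right (ker nu x a)) by lra.
    replace (Rabs h * (ker nu x a * exp (2 * a))) with (ker nu x a * (Rabs h * exp (2 * a))) by ring.
    apply Rmult_le_compat_l; [lra|].
    eapply Rle_trans; [apply Rabs_exp_minus_1|].
    rewrite Rabs_mult, (Rabs_right a) by lra. rewrite Rmult_assoc.
    apply Rmult_le_compat_l; [apply Rabs_pos|].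
    replace (2 * a) with (a + a) by ring. rewrite exp_plus.
    apply Rmult_le_compat; [lra|left; apply exp_pos| |].
    - pose proof (exp_ineq1_le a); lra.
    - apply exp_le. pose proof (Rabs_pos h). nra. }
  apply Rabs_le; split.
  - apply Rplus_le_reg_r with 0.
    apply Rle_trans with (- Rabs h * dint (nu + 2) x + 0 * dint (nu + 2) x); [lra|].
    apply Rle_trans with (1 * dint mu x + -1 * dint nu x); [|lra].
    eapply improper_le; [| | |exact (HK _)|exact HG].
    + intros s; apply continuous_lin2; apply continuous_ker.
    + intros s; apply continuous_lin2; apply continuous_ker.
    + intros a Ha. pose proof (B a Ha) as Hb. apply Rabs_le_between in Hb. simpl in *; lra.
  - apply Rle_trans with (1 * dint mu x + -1 * dint nu x); [lra|].
    apply Rle_trans with (Rabs h * dint (nu + 2) x + 0 * dint (nu + 2) x); [|lra].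
    eapply improper_le; [| | |exact HG|exact (HK _)].
    + intros s; apply continuous_lin2; apply continuous_ker.
    + intros s; apply continuous_lin2; apply continuous_ker.
    + intros a Ha. pose proof (B a Ha) as Hb. apply Rabs_le_between in Hb. simpl in *; lra.
Qed.

(** * Decay at infinity *)

Definition bigO_inv (f : R -> R) : Prop :=
  exists C X, forall x, X < x -> 0 < x -> Rabs (f x) <= C / x.

Definition vanish (f : R -> R) : Prop := is_lim f p_infty 0.

Definition ebounded (f : R -> R) : Prop := exists M X, forall x, X < x -> Rabs (f x) <= M.

Lemma bigO_inv_lin (f g : R -> R) (u v : R) :
  bigO_inv f -> bigO_inv g -> bigO_inv (fun x => u * f x + v * g x).
Proof.
  intros [C [X H]] [D [Y K]].
  exists (Rabs u * C + Rabs v * D), (Rmax X Y); intros x Hx Hp.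
  pose proof (Rmax_l X Y). pose proof (Rmax_r X Y).
  eapply Rle_trans; [apply Rabs_triang|]. rewrite !Rabs_mult.
  replace ((Rabs u * C + Rabs v * D) / x) with (Rabs u * (C / x) + Rabs v * (D / x)) by (field; lra).
  apply Rplus_le_compat; apply Rmult_le_compat_l; try apply Rabs_pos.
  - apply H; lra.
  - apply K; lra.
Qed.

Lemma bigO_inv_ext (f g : R -> R) :
  (forall x, 0 < x -> f x = g x) -> bigO_inv f -> bigO_inv g.
Proof.
  intros E [C [X H]]. exists C, X; intros x Hx Hp. rewrite <- E by assumption. auto.
Qed.

Lemma vanish_spec (f : R -> R) :
  vanish f <-> (forall eps, 0 < eps -> exists X, forall x, X < x -> Rabs (f x) < eps).
Proof.
  unfold vanish. rewrite <- is_lim_spec. unfold is_lim'. split.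
  - intros H eps He. destruct (H (mkposreal eps He)) as [X HX]. exists X.
    intros x Hx. specialize (HX x Hx). simpl in HX. rewrite Rminus_0_r in HX. exact HX.
  - intros H eps. destruct (H eps (cond_pos eps)) as [X HX]. exists X.
    intros x Hx. rewrite Rminus_0_r. apply HX, Hx.
Qed.

Lemma vanish_ext (f g : R -> R) (X : R) :
  (forall x, X < x -> f x = g x) -> vanish f -> vanish g.
Proof.
  intros E H. eapply is_lim_ext_loc; [|exact H]. exists X. exact E.
Qed.

Lemma vanish_lin (f g : R -> R) (u v : R) :
  vanish f -> vanish g -> vanish (fun x => u * f x + v * g x).
Proof.
  intros Hf Hg. unfold vanish. replace (Finite 0) with (Finite (u * 0 + v * 0)) by (f_equal; ring).
  apply is_lim_plus'.
  - apply (is_lim_scal_l f u p_infty 0), Hf.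
  - apply (is_lim_scal_l g v p_infty 0), Hg.
Qed.

Lemma vanish_mult (f g : R -> R) : ebounded f -> vanish g -> vanish (fun x => f x * g x).
Proof.
  intros [M [X H]] Hg. rewrite vanish_spec in *. intros eps He.
  set (M' := Rmax M 0 + 1).
  assert (HM : 0 < M') by (unfold M'; pose proof (Rmax_r M 0); lra).
  destruct (Hg (eps / M')) as [Y K]; [apply Rdiv_lt_0_compat; assumption|].
  exists (Rmax X Y); intros x Hx.
  pose proof (Rmax_l X Y). pose proof (Rmax_r X Y).
  rewrite Rabs_mult.
  assert (A : Rabs (f x) <= M') by (unfold M'; pose proof (Rmax_l M 0); pose proof (H x); lra).
  assert (B : Rabs (g x) < eps / M') by (apply K; lra).
  apply Rle_lt_trans with (M' * Rabs (g x)).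
  - apply Rmult_le_compat_r; [apply Rabs_pos|exact A].
  - apply Rlt_div_r in B; [|exact HM]. lra.
Qed.

Lemma vanish_le (f g : R -> R) (X : R) :
  (forall x, X < x -> Rabs (f x) <= Rabs (g x)) -> vanish g -> vanish f.
Proof.
  intros H Hg. rewrite vanish_spec in *. intros eps He.
  destruct (Hg eps He) as [Y K]. exists (Rmax X Y); intros x Hx.
  pose proof (Rmax_l X Y). pose proof (Rmax_r X Y).
  eapply Rle_lt_trans; [apply H; lra|apply K; lra].
Qed.

Lemma ebounded_const (c : R) : ebounded (fun _ => c).
Proof. exists (Rabs c), 0; intros; apply Rle_refl. Qed.

Lemma ebounded_le1 (f : R -> R) : (forall x, Rabs (f x) <= 1) -> ebounded f.
Proof. intros H; exists 1, 0; intros; apply H. Qed.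

Lemma ebounded_plus (f g : R -> R) : ebounded f -> ebounded g -> ebounded (fun x => f x + g x).
Proof.
  intros [M [X H]] [N [Y K]]. exists (M + N), (Rmax X Y). intros x Hx.
  pose proof (Rmax_l X Y). pose proof (Rmax_r X Y).
  eapply Rle_trans; [apply Rabs_triang|].
  apply Rplus_le_compat; [apply H|apply K]; lra.
Qed.

Lemma ebounded_mult (f g : R -> R) : ebounded f -> ebounded g -> ebounded (fun x => f x * g x).
Proof.
  intros [M [X H]] [N [Y K]]. exists (M * N), (Rmax X Y). intros x Hx.
  pose proof (Rmax_l X Y). pose proof (Rmax_r X Y).
  rewrite Rabs_mult. apply Rmult_le_compat; try apply Rabs_pos; [apply H|apply K]; lra.
Qed.

Lemma vanish_ebounded (f : R -> R) : vanish f -> ebounded f.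
Proof.
  intros H. rewrite vanish_spec in H. destruct (H 1 Rlt_0_1) as [X HX].
  exists 1, X. intros x Hx. left; apply HX, Hx.
Qed.

Lemma ebounded_close (f g : R -> R) : ebounded f -> vanish (fun x => g x - f x) -> ebounded g.
Proof.
  intros Hf Hd. apply vanish_ebounded in Hd.
  destruct (ebounded_plus _ _ Hf Hd) as [M [X H]].
  exists M, X. intros x Hx. replace (g x) with (f x + (g x - f x)) by ring. apply H, Hx.
Qed.

Lemma vanish_inv : vanish (fun x => / x).
Proof.
  unfold vanish. replace (Finite 0) with (Rbar_inv p_infty) by reflexivity.
  apply (is_lim_inv (fun x => x)); [apply is_lim_id | discriminate].
Qed.

Lemma vanish_inv_sqrt : vanish (fun x => / sqrt x).
Proof.
  unfold vanish. replace (Finite 0) with (Rbar_inv p_infty) by reflexivity.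
  apply (is_lim_inv sqrt); [|discriminate].
  apply is_lim_sqrt_p, is_lim_id.
Qed.

Lemma vanish_sqrt_bigO (f : R -> R) : bigO_inv f -> vanish (fun x => sqrt x * f x).
Proof.
  intros [C [X H]].
  apply vanish_le with (g := fun x => C * / sqrt x) (X := Rmax X 0).
  - intros x Hx. pose proof (Rmax_l X 0). pose proof (Rmax_r X 0).
    assert (Hs : 0 < sqrt x) by (apply sqrt_lt_R0; lra).
    rewrite Rabs_mult, (Rabs_right (sqrt x)) by lra.
    apply Rle_trans with (C * / sqrt x); [|apply Rle_abs].
    replace (C * / sqrt x) with (sqrt x * (C / x)).
    + apply Rmult_le_compat_l; [lra|]. apply H; lra.
    + rewrite <- (sqrt_sqrt x) at 2 by lra. field. lra.
  - apply vanish_mult; [apply ebounded_const | apply vanish_inv_sqrt].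
Qed.

Lemma bigO_inv_vanish (f : R -> R) : bigO_inv f -> vanish f.
Proof.
  intros [C [X H]]. apply vanish_le with (g := fun x => C * / x) (X := Rmax X 0).
  - intros x Hx. pose proof (Rmax_l X 0). pose proof (Rmax_r X 0).
    eapply Rle_trans; [apply H; lra|apply Rle_abs].
  - apply vanish_mult; [apply ebounded_const | apply vanish_inv].
Qed.

(** * Stationary-phase estimates *)

Lemma sin_lower (s : R) : 0 <= s <= PI / 2 -> s / 3 <= sin s.
Proof.
  intros [H0 H1].
  pose proof PI_4.
  destruct (pre_sin_bound s 0) as [L _]; [lra|lra|].
  unfold sin_approx, sin_term in L. simpl in L. nra.
Qed.

Lemma Rabs_sin_le (y : R) : Rabs (sin y) <= Rabs y.
Proof.
  destruct (MVT_gen sin 0 y cos) as [c [_ E]].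
  - intros; apply is_derive_sin.
  - intros; apply (derive_cont_pt sin x (cos x)), is_derive_sin.
  - rewrite sin_0, !Rminus_0_r in E. rewrite E, Rabs_mult.
    pose proof (Rabs_cos c). pose proof (Rabs_pos y). nra.
Qed.

Lemma Rabs_cos_minus_1 (y : R) : Rabs (cos y - 1) <= y ^ 2.
Proof.
  pose proof (taylor2_bound cos (fun t => - sin t) (fun t => - cos t) 0 y 1) as T.
  rewrite Rplus_0_l, cos_0, sin_0, Ropp_0, Rmult_0_r, Rminus_0_r, Rmult_1_l in T.
  apply T. intros t _. split; [apply is_derive_cos|split].
  - apply (is_derive_opp sin), is_derive_sin.
  - rewrite Rabs_Ropp; apply Rabs_cos.
Qed.

(** The phase [x cos s] is stationary on [0, PI/2] only at [s = 0]; an amplitude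
    vanishing there to second order can be divided by [sin s] and integrated by
    parts, which gains a factor [1/x]. *)
Lemma osc_decay (g g1 k K : R -> R) (C : R) :
  0 <= C ->
  (forall s, is_derive g s (g1 s)) -> (forall s, continuous g1 s) ->
  (forall s, 0 <= s <= PI / 2 -> Rabs (g s) <= C * s ^ 2 /\ Rabs (g1 s) <= C * s) ->
  (forall y, is_derive K y (k y)) -> (forall y, continuous k y) ->
  (forall y, Rabs (K y) <= 1) -> (forall y, Rabs (k y) <= 1) ->
  bigO_inv (osc g k).
Proof.
  intros HC Dg Cg1 Hg DK Ck BK Bk.
  assert (HPI : 2 < PI <= 4) by (pose proof PI_4; pose proof PI2_1; lra).
  assert (Cg : forall s, continuous g s)
    by (intros s; apply (ex_derive_continuous g); eexists; apply Dg).
  assert (CK : forall s, continuous K s)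
    by (intros s; apply (ex_derive_continuous K); eexists; apply DK).
  exists (43 * C), 1. intros x Hx _.
  set (e := / x).
  assert (He : 0 < e < 1).
  { unfold e. split; [apply Rinv_0_lt_compat; lra|]. rewrite <- Rinv_1.
    apply Rinv_lt_contravar; lra. }
  set (F := fun s => g s * k (x * cos s)).
  assert (CF : forall s, continuous F s) by (intros s; apply continuous_osc_integrand; assumption).
  set (h1 := fun s => (g1 s * sin s - g s * cos s) / sin s ^ 2 * K (x * cos s)).
  set (B := fun s => g s / sin s * K (x * cos s)).
  assert (Hsin : forall s, e <= s <= PI / 2 -> 0 < sin s)
    by (intros s Hs; apply sin_gt_0; lra).
  assert (Bh : forall s, e <= s <= PI / 2 ->
             Rabs (g s / sin s) <= 9 * C /\ Rabs (h1 s) <= 12 * C).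
  { intros s Hs. pose proof (Hsin s Hs) as P. pose proof (sin_lower s) as L.
    assert (L' : s / 3 <= sin s) by (apply L; lra).
    destruct (Hg s) as [G0 G1]; [lra|].
    assert (P2 : 0 < sin s ^ 2) by (apply pow_lt, P).
    split.
    - rewrite Rabs_div, (Rabs_right (sin s)) by lra.
      apply Rle_div_l; [exact P|].
      eapply Rle_trans; [exact G0|].
      assert (s ^ 2 <= 9 * sin s) by (pose proof (SIN_bound s); nra). nra.
    - unfold h1. rewrite Rabs_mult, Rabs_div, (Rabs_right (sin s ^ 2)) by lra.
      rewrite <- (Rmult_1_r (12 * C)).
      apply Rmult_le_compat; [|apply Rabs_pos| |apply BK].
      { apply Rdiv_le_0_compat; [apply Rabs_pos|exact P2]. }
      apply Rle_div_l; [exact P2|].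
      eapply Rle_trans; [apply Rabs_triang|].
      rewrite Rabs_Ropp, !Rabs_mult, (Rabs_right (sin s)) by lra.
      pose proof (Rabs_cos s). pose proof (Rabs_pos (cos s)). pose proof (Rabs_pos (g s)).
      assert (A1 : Rabs (g1 s) * sin s <= 3 * C * sin s ^ 2).
      { apply Rle_trans with (C * s * sin s); [apply Rmult_le_compat_r; lra|].
        replace (3 * C * sin s ^ 2) with (C * (3 * sin s) * sin s) by ring.
        apply Rmult_le_compat_r; [lra|]. apply Rmult_le_compat_l; lra. }
      assert (A2 : Rabs (g s) * Rabs (cos s) <= 9 * C * sin s ^ 2).
      { apply Rle_trans with (C * s ^ 2).
        - rewrite <- (Rmult_1_r (C * s ^ 2)). apply Rmult_le_compat; lra.
        - replace (9 * C * sin s ^ 2) with (C * (3 * sin s) ^ 2) by ring.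
          apply Rmult_le_compat_l; [lra|]. apply pow_incr; lra. }
      lra. }
  assert (Ch1 : forall s, e <= s <= PI / 2 -> continuous h1 s).
  { intros s Hs. pose proof (Hsin s Hs) as P. unfold h1.
    apply continuous_mult_R.
    - apply continuous_mult_R.
      + apply continuous_minus_R; apply continuous_mult_R; auto using continuous_sin, continuous_cos.
      + apply (ex_derive_continuous (fun s => / sin s ^ 2)). auto_derive.
        rewrite Rmult_1_r. nra.
    - apply (continuous_comp (fun s => x * cos s) K); [|apply CK].
      apply (ex_derive_continuous (fun s => x * cos s)). auto_derive. exact I. }
  (* Integration by parts away from the stationary point. *)
  assert (P1 : is_RInt (fun s => h1 s - x * F s) e (PI / 2) (B (PI / 2) - B e)).
  { apply (is_RInt_derive B (fun s => h1 s - x * F s)).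
    - intros s Hs. rewrite Rmin_left, Rmax_right in Hs by lra.
      pose proof (Hsin s Hs) as P. unfold B. eapply derive_eq.
      + apply derive_mult.
        * apply derive_div; [lra|apply Dg|apply is_derive_sin].
        * apply (derive_comp K (fun s => x * cos s)); [apply DK|].
          instantiate (1 := - x * sin s). auto_derive; [exact I|ring].
      + unfold h1, F. field. lra.
    - intros s Hs. rewrite Rmin_left, Rmax_right in Hs by lra.
      apply continuous_minus_R; [apply Ch1, Hs|].
      apply (continuous_scal_r x F), CF. }
  assert (I1 : is_RInt h1 e (PI / 2) (RInt h1 e (PI / 2))).
  { apply (RInt_correct h1), (ex_RInt_continuous h1). intros z Hz.
    rewrite Rmin_left, Rmax_right in Hz by lra. apply Ch1, Hz. }
  assert (E1 : x * RInt F e (PI / 2) = RInt h1 e (PI / 2) - (B (PI / 2) - B e)).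
  { assert (Q : is_RInt (fun s => h1 s - x * F s) e (PI / 2)
                  (RInt h1 e (PI / 2) - x * RInt F e (PI / 2))).
    { apply (is_RInt_minus h1 (fun s => x * F s)); [exact I1|].
      apply is_RInt_scal_R. apply (RInt_correct F), RInt_cont_ex, CF. }
    apply RInt_eq in Q. apply RInt_eq in P1. rewrite P1 in Q. lra. }
  assert (N1 : Rabs (RInt h1 e (PI / 2)) <= 12 * C * (PI / 2 - e)).
  { eapply Rle_trans.
    - apply (norm_RInt_le h1 (fun _ => 12 * C) e (PI / 2) (RInt h1 e (PI / 2)) (scal (PI / 2 - e) (12 * C))).
      + lra.
      + intros s Hs. apply (Bh s Hs).
      + exact I1.
      + apply (is_RInt_const e (PI / 2) (12 * C)).
    - unfold scal; simpl; unfold mult; simpl. lra. }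
  assert (NB : forall s, e <= s <= PI / 2 -> Rabs (B s) <= 9 * C).
  { intros s Hs. unfold B. rewrite Rabs_mult. rewrite <- (Rmult_1_r (9 * C)).
    apply Rmult_le_compat; try apply Rabs_pos; [apply (Bh s Hs)|apply BK]. }
  assert (N2 : Rabs (RInt F 0 e) <= C * (e - 0)).
  { apply RInt_abs_le; [lra|exact CF|].
    intros s Hs. unfold F. rewrite Rabs_mult.
    destruct (Hg s) as [G0 _]; [lra|]. pose proof (Bk (x * cos s)).
    pose proof (Rabs_pos (g s)). pose proof (Rabs_pos (k (x * cos s))).
    assert (C * s ^ 2 <= C) by (rewrite <- (Rmult_1_r C) at 2; apply Rmult_le_compat_l; nra).
    nra. }
  assert (E2 : osc g k x = RInt F 0 e + RInt F e (PI / 2)).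
  { symmetry. apply (RInt_Chasles F); apply RInt_cont_ex, CF. }
  rewrite E2. eapply Rle_trans; [apply Rabs_triang|].
  assert (N3 : Rabs (x * RInt F e (PI / 2)) <= 42 * C).
  { rewrite E1. eapply Rle_trans; [apply Rabs_triang|]. rewrite Rabs_Ropp.
    assert (Rabs (B (PI / 2) - B e) <= 18 * C).
    { eapply Rle_trans; [apply Rabs_triang|]. rewrite Rabs_Ropp.
      pose proof (NB (PI / 2)). pose proof (NB e). lra. }
    nra. }
  rewrite Rabs_mult, (Rabs_right x) in N3 by lra.
  assert (N4 : Rabs (RInt F e (PI / 2)) <= 42 * C / x).
  { apply Rle_div_r; [lra|]. lra. }
  replace (43 * C / x) with (C * (e - 0) + 42 * C / x) by (unfold e; field; lra).
  lra.
Qed.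

Lemma osc_minus (w1 w2 k : R -> R) (x : R) :
  (forall s, continuous w1 s) -> (forall s, continuous w2 s) -> (forall s, continuous k s) ->
  osc (fun s => w1 s - w2 s) k x = osc w1 k x - osc w2 k x.
Proof.
  intros C1 C2 Ck. unfold osc.
  pose proof (fun s => continuous_osc_integrand w1 k x s C1 Ck) as D1.
  pose proof (fun s => continuous_osc_integrand w2 k x s C2 Ck) as D2.
  set (F1 := fun s => w1 s * k (x * cos s)) in *.
  set (F2 := fun s => w2 s * k (x * cos s)) in *.
  transitivity (RInt (fun s => 1 * F1 s + -1 * F2 s) 0 (PI / 2)).
  - apply RInt_ext. intros s _. unfold F1, F2. Rring.
  - transitivity (1 * RInt F1 0 (PI / 2) + -1 * RInt F2 0 (PI / 2)); [|Rring].
    apply RInt_lin; assumption.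
Qed.

Lemma osc_cosw_const (nu : R) (k K : R -> R) :
  (forall y, is_derive K y (k y)) -> (forall y, continuous k y) ->
  (forall y, Rabs (K y) <= 1) -> (forall y, Rabs (k y) <= 1) ->
  bigO_inv (fun x => osc (cosw nu) k x - osc (cosw 0) k x).
Proof.
  intros DK Ck BK Bk.
  apply bigO_inv_ext with (f := osc (fun s => cosw nu s - cosw 0 s) k).
  { intros x _. apply osc_minus; try apply continuous_cos_lin; exact Ck. }
  apply osc_decay with (g1 := fun s => - nu * sin (nu * s)) (K := K) (C := nu ^ 2);
    try assumption.
  - apply pow2_ge_0.
  - intros s. unfold cosw. auto_derive; [exact I|ring].
  - intros s. apply (ex_derive_continuous (fun s => - nu * sin (nu * s))). auto_derive. exact I.
  - intros s Hs. unfold cosw. rewrite Rmult_0_l, cos_0. split.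
    + rewrite <- Rpow_mult_distr. apply Rabs_cos_minus_1.
    + rewrite Rabs_mult, Rabs_Ropp.
      apply Rle_trans with (Rabs nu * Rabs (nu * s)).
      * apply Rmult_le_compat_l; [apply Rabs_pos|apply Rabs_sin_le].
      * rewrite Rabs_mult, (Rabs_right s), <- Rmult_assoc by lra.
        rewrite <- (pow2_abs nu). simpl. lra.
Qed.

Lemma osc_cosw_cos_const (nu : R) (k K : R -> R) :
  (forall y, is_derive K y (k y)) -> (forall y, continuous k y) ->
  (forall y, Rabs (K y) <= 1) -> (forall y, Rabs (k y) <= 1) ->
   bigO_inv (fun x => osc (fun s => cosw nu s * cos s) k x - osc (cosw nu) k x).
Proof.
  intros DK Ck BK Bk.
  apply bigO_inv_ext with (f := osc (fun s => cosw nu s * cos s - cosw nu s) k).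
  { intros x _. apply osc_minus; [apply continuous_cosw_cos|apply continuous_cos_lin|exact Ck]. }
  apply osc_decay with (K := K) (C := 2 * nu ^ 2 + 1)
    (g1 := fun s => - nu * sin (nu * s) * (cos s - 1) - cos (nu * s) * sin s);
    try assumption.
  - pose proof (pow2_ge_0 nu); lra.
  - intros s. unfold cosw. auto_derive; [exact I|ring].
  - intros s. apply (ex_derive_continuous
      (fun s => - nu * sin (nu * s) * (cos s - 1) - cos (nu * s) * sin s)). auto_derive. exact I.
  - intros s Hs. unfold cosw. pose proof (pow2_ge_0 nu). split.
    + replace (cos (nu * s) * cos s - cos (nu * s)) with (cos (nu * s) * (cos s - 1)) by ring.
      rewrite Rabs_mult. pose proof (Rabs_cos (nu * s)). pose proof (Rabs_cos_minus_1 s).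
      pose proof (Rabs_pos (cos (nu * s))). pose proof (Rabs_pos (cos s - 1)).
      pose proof (pow2_ge_0 s). nra.
    + eapply Rle_trans; [apply Rabs_triang|]. rewrite Rabs_Ropp, !Rabs_mult, Rabs_Ropp.
      assert (A1 : Rabs (cos s - 1) <= 2).
      { eapply Rle_trans; [apply Rabs_triang|]. rewrite Rabs_Ropp, Rabs_R1.
        pose proof (Rabs_cos s). lra. }
      assert (A2 : Rabs nu * Rabs (sin (nu * s)) <= nu ^ 2 * s).
      { apply Rle_trans with (Rabs nu * Rabs (nu * s)).
        - apply Rmult_le_compat_l; [apply Rabs_pos|apply Rabs_sin_le].
        - rewrite Rabs_mult, (Rabs_right s), <- Rmult_assoc by lra.
          rewrite <- (pow2_abs nu). simpl. lra. }
      assert (A3 : Rabs (cos (nu * s)) * Rabs (sin s) <= s).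
      { rewrite <- (Rmult_1_l s) at 3.
        apply Rmult_le_compat; try apply Rabs_pos; [apply Rabs_cos|].
        eapply Rle_trans; [apply Rabs_sin_le|]. rewrite Rabs_right; lra. }
      assert (A4 : Rabs nu * Rabs (sin (nu * s)) * Rabs (cos s - 1) <= nu ^ 2 * s * 2).
      { apply Rmult_le_compat; try assumption; [|apply Rabs_pos].
        apply Rmult_le_pos; apply Rabs_pos. }
      lra.
Qed.

(** * The Hankel pair *)

Definition halfang (nu : R) : R := nu * PI / 2.

(** Up to the constant factor [kamp^2], these are [J] and [Y] in Schlafli's form;
    this is a consequence of what follows, not a definition. *)
Definition Hr (nu x : R) : R :=
  cos (halfang nu) * Ec nu x + sin (halfang nu) * Es nu x
  - / 2 * sin (nu * PI) * dint (- nu) x.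
Definition Hr1 (nu x : R) : R :=
  cos (halfang nu) * Ec1 nu x + sin (halfang nu) * Es1 nu x
  - / 2 * sin (nu * PI) * dint1 (- nu) x.
Definition Hi (nu x : R) : R :=
  - sin (halfang nu) * Ec nu x + cos (halfang nu) * Es nu x
  - / 2 * cos (nu * PI) * dint (- nu) x - / 2 * dint nu x.
Definition Hi1 (nu x : R) : R :=
  - sin (halfang nu) * Ec1 nu x + cos (halfang nu) * Es1 nu x
  - / 2 * cos (nu * PI) * dint1 (- nu) x - / 2 * dint1 nu x.

Lemma sin_double_half (nu : R) : sin (nu * PI) = 2 * sin (halfang nu) * cos (halfang nu).
Proof.
  replace (nu * PI) with (2 * halfang nu) by (unfold halfang; field). apply sin_2a.
Qed.

Lemma cos_double_half (nu : R) :
  cos (nu * PI) = cos (halfang nu) ^ 2 - sin (halfang nu) ^ 2.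
Proof.
  replace (nu * PI) with (2 * halfang nu) by (unfold halfang; field).
  rewrite cos_2a. ring.
Qed.

Lemma sin_cos_sqr (a : R) : sin a ^ 2 = 1 - cos a ^ 2.
Proof. pose proof (sin2_cos2 a). unfold Rsqr in *. lra. Qed.

(** The coefficients of the four inhomogeneous solutions are chosen so that the
    right-hand sides cancel. *)
Lemma bessel_sol_Hr (nu : R) : bessel_sol nu (Hr nu) (Hr1 nu).
Proof.
  intros x Hx.
  destruct (bessel_inh_Ec nu x Hx) as [A A1]. destruct (bessel_inh_Es nu x Hx) as [B B1].
  destruct (bessel_inh_dint (- nu) x Hx) as [D D1].
  unfold Hr, Hr1. split.
  - apply derive_minus; [apply derive_plus|]; apply is_derive_scal; [exact A|exact B|exact D].
  - eapply derive_eq.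
    + apply derive_minus; [apply derive_plus|]; apply is_derive_scal;
        [exact A1|exact B1|exact D1].
    + fold (halfang nu). rewrite sin_double_half. field. lra.
Qed.

Lemma bessel_sol_Hi (nu : R) : bessel_sol nu (Hi nu) (Hi1 nu).
Proof.
  intros x Hx.
  destruct (bessel_inh_Ec nu x Hx) as [A A1]. destruct (bessel_inh_Es nu x Hx) as [B B1].
  destruct (bessel_inh_dint (- nu) x Hx) as [D D1].
  destruct (bessel_inh_dint nu x Hx) as [F F1].
  unfold Hi, Hi1. split.
  - apply derive_minus; [apply derive_minus; [apply derive_plus|]|]; apply is_derive_scal;
      [exact A|exact B|exact D|exact F].
  - eapply derive_eq.
    + apply derive_minus; [apply derive_minus; [apply derive_plus|]|]; apply is_derive_scal;
        [exact A1|exact B1|exact D1|exact F1].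
    + fold (halfang nu). rewrite cos_double_half.
      pose proof (sin_cos_sqr (halfang nu)) as E.
      field_simplify; [|lra|lra]. rewrite E. field. lra.
Qed.

Lemma bigO_dint (nu : R) : bigO_inv (dint nu).
Proof.
  exists 2, (2 * Rabs nu). intros x Hx Hp.
  rewrite Rabs_right by (apply Rle_ge, dint_nonneg, Hp).
  apply dint_large; [exact Hp|lra].
Qed.

Lemma bigO_dint1 (nu : R) : bigO_inv (dint1 nu).
Proof.
  apply bigO_inv_ext with (f := fun x => - / 2 * dint (nu + 1) x + / 2 * dint (nu - 1) x).
  - intros x _. unfold dint1. field.
  - apply bigO_inv_lin; apply bigO_dint.
Qed.

Lemma is_derive_neg_cos (y : R) : is_derive (fun t => - cos t) y (sin y).
Proof. auto_derive; [exact I|ring]. Qed.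

Lemma bigO_Ec (nu : R) : bigO_inv (fun x => Ec nu x - Ec 0 x).
Proof.
  apply (osc_cosw_const nu cos sin); [apply is_derive_sin|apply continuous_cos|apply Rabs_sin|apply Rabs_cos].
Qed.

Lemma bigO_Es (nu : R) : bigO_inv (fun x => Es nu x - Es 0 x).
Proof.
  apply (osc_cosw_const nu sin (fun t => - cos t));
    [apply is_derive_neg_cos|apply continuous_sin| |apply Rabs_sin].
  intros y; rewrite Rabs_Ropp; apply Rabs_cos.
Qed.

Lemma bigO_Ec1 (nu : R) : bigO_inv (fun x => Ec1 nu x + Es 0 x).
Proof.
  apply bigO_inv_ext with
    (f := fun x => -1 * (osc (fun s => cosw nu s * cos s) sin x - osc (cosw nu) sin x)
             + -1 * (Es nu x - Es 0 x)).
  - intros x _. unfold Ec1, Es. ring.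
  - apply bigO_inv_lin; [|apply bigO_Es].
    apply (osc_cosw_cos_const nu sin (fun t => - cos t));
      [apply is_derive_neg_cos|apply continuous_sin| |apply Rabs_sin].
    intros y; rewrite Rabs_Ropp; apply Rabs_cos.
Qed.

Lemma bigO_Es1 (nu : R) : bigO_inv (fun x => Es1 nu x - Ec 0 x).
Proof.
  apply bigO_inv_ext with
    (f := fun x => 1 * (osc (fun s => cosw nu s * cos s) cos x - osc (cosw nu) cos x)
             + 1 * (Ec nu x - Ec 0 x)).
  - intros x _. unfold Es1, Ec. ring.
  - apply bigO_inv_lin; [|apply bigO_Ec].
    apply (osc_cosw_cos_const nu cos sin);
      [apply is_derive_sin|apply continuous_cos|apply Rabs_sin|apply Rabs_cos].
Qed.

(** By the estimates above the order enters the asymptotics of the Hankel pair only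
    through the rotation by [halfang nu]; these amplitudes are common to all orders. *)
Definition Xc (x : R) : R := sqrt x * Ec 0 x.
Definition Xs (x : R) : R := sqrt x * Es 0 x.

Lemma Hr_infty (nu : R) :
  vanish (fun x => sqrt x * Hr nu x - (cos (halfang nu) * Xc x + sin (halfang nu) * Xs x)).
Proof.
  apply vanish_ext with (X := 0) (f := fun x => sqrt x *
    (1 * (cos (halfang nu) * (Ec nu x - Ec 0 x) + sin (halfang nu) * (Es nu x - Es 0 x))
     + (- / 2 * sin (nu * PI)) * dint (- nu) x)).
  - intros x _. unfold Hr, Xc, Xs. ring.
  - apply vanish_sqrt_bigO, bigO_inv_lin; [apply bigO_inv_lin|].
    + apply bigO_Ec. + apply bigO_Es. + apply bigO_dint.
Qed.

Lemma Hr1_infty (nu : R) :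
  vanish (fun x => sqrt x * Hr1 nu x - (sin (halfang nu) * Xc x + - cos (halfang nu) * Xs x)).
Proof.
  apply vanish_ext with (X := 0) (f := fun x => sqrt x *
    (1 * (cos (halfang nu) * (Ec1 nu x + Es 0 x) + sin (halfang nu) * (Es1 nu x - Ec 0 x))
     + (- / 2 * sin (nu * PI)) * dint1 (- nu) x)).
  - intros x _. unfold Hr1, Xc, Xs. ring.
  - apply vanish_sqrt_bigO, bigO_inv_lin; [apply bigO_inv_lin|].
    + apply bigO_Ec1. + apply bigO_Es1. + apply bigO_dint1.
Qed.

Lemma Hi_infty (nu : R) :
  vanish (fun x => sqrt x * Hi nu x - (- sin (halfang nu) * Xc x + cos (halfang nu) * Xs x)).
Proof.
  apply vanish_ext with (X := 0) (f := fun x => sqrt x *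
    (1 * (- sin (halfang nu) * (Ec nu x - Ec 0 x) + cos (halfang nu) * (Es nu x - Es 0 x))
     + 1 * ((- / 2 * cos (nu * PI)) * dint (- nu) x + - / 2 * dint nu x))).
  - intros x _. unfold Hi, Xc, Xs. ring.
  - apply vanish_sqrt_bigO, bigO_inv_lin; apply bigO_inv_lin.
    + apply bigO_Ec. + apply bigO_Es. + apply bigO_dint. + apply bigO_dint.
Qed.

Lemma Hi1_infty (nu : R) :
  vanish (fun x => sqrt x * Hi1 nu x - (cos (halfang nu) * Xc x + sin (halfang nu) * Xs x)).
Proof.
  apply vanish_ext with (X := 0) (f := fun x => sqrt x *
    (1 * (- sin (halfang nu) * (Ec1 nu x + Es 0 x) + cos (halfang nu) * (Es1 nu x - Ec 0 x))
     + 1 * ((- / 2 * cos (nu * PI)) * dint1 (- nu) x + - / 2 * dint1 nu x))).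
  - intros x _. unfold Hi1, Xc, Xs. ring.
  - apply vanish_sqrt_bigO, bigO_inv_lin; apply bigO_inv_lin.
    + apply bigO_Ec1. + apply bigO_Es1. + apply bigO_dint1. + apply bigO_dint1.
Qed.

Lemma osc_bounded (w k : R -> R) (x : R) :
  (forall s, continuous w s) -> (forall s, continuous k s) ->
  (forall s, Rabs (w s) <= 1) -> (forall s, Rabs (k s) <= 1) -> Rabs (osc w k x) <= 2.
Proof.
  intros Cw Ck Bw Bk. pose proof PI_RGT_0. pose proof PI_4.
  apply Rle_trans with (1 * (PI / 2 - 0)); [|lra].
  apply RInt_abs_le; [lra| |].
  - intros s; apply continuous_osc_integrand; assumption.
  - intros s _. rewrite Rabs_mult, <- (Rmult_1_r 1).
    apply Rmult_le_compat; try apply Rabs_pos; auto.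
Qed.

Lemma Ec_bounded (nu x : R) : Rabs (Ec nu x) <= 2.
Proof.
  apply (osc_bounded (cosw nu) cos); [apply continuous_cos_lin|apply continuous_cos|apply Rabs_cosw|apply Rabs_cos].
Qed.

Lemma Es_bounded (nu x : R) : Rabs (Es nu x) <= 2.
Proof.
  apply (osc_bounded (cosw nu) sin); [apply continuous_cos_lin|apply continuous_sin|apply Rabs_cosw|apply Rabs_sin].
Qed.

Lemma Ec1_bounded (nu x : R) : Rabs (Ec1 nu x) <= 2.
Proof.
  unfold Ec1. rewrite Rabs_Ropp.
  apply (osc_bounded (fun s => cosw nu s * cos s) sin); [apply continuous_cosw_cos|apply continuous_sin|apply Rabs_cosw_cos|apply Rabs_sin].
Qed.

Lemma Es1_bounded (nu x : R) : Rabs (Es1 nu x) <= 2.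
Proof.
  apply (osc_bounded (fun s => cosw nu s * cos s) cos); [apply continuous_cosw_cos|apply continuous_cos|apply Rabs_cosw_cos|apply Rabs_cos].
Qed.

(** * Behaviour at the origin *)

(** Since Wronskians are constant, limits along one sequence suffice. *)
Definition zs (n : nat) : R := / INR (S n).

Lemma zs_pos (n : nat) : 0 < zs n.
Proof. apply Rinv_0_lt_compat, lt_0_INR. lia. Qed.

Lemma zs_le_1 (n : nat) : zs n <= 1.
Proof.
  unfold zs. rewrite <- Rinv_1. apply Rinv_le_contravar; [lra|].
  rewrite S_INR. pose proof (pos_INR n). lra.
Qed.

Lemma zs_lim : is_lim_seq zs 0.
Proof.
  unfold zs. apply (is_lim_seq_incr_1 (fun n => / INR n)).
  replace (Finite 0) with (Rbar_inv p_infty) by reflexivity.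
  apply is_lim_seq_inv; [apply is_lim_seq_INR|discriminate].
Qed.

Lemma Rpower_zs_lim (nu : R) : 0 < nu -> is_lim_seq (fun n => Rpower (zs n / 2) nu) 0.
Proof.
  intros Hn. apply is_lim_seq_spec. intros eps.
  pose proof zs_lim as Z. apply is_lim_seq_spec in Z.
  destruct (Z (mkposreal _ (Rpower_pos eps (/ nu)))) as [N HN].
  exists N. intros n Hle. specialize (HN n Hle). simpl in HN.
  pose proof (zs_pos n) as P.
  rewrite Rminus_0_r in *. rewrite Rabs_right in HN by lra.
  rewrite Rabs_right by (left; apply Rpower_pos).
  replace (pos eps) with (Rpower (Rpower eps (/ nu)) nu).
  - apply Rlt_Rpower_l; [exact Hn|]. lra.
  - rewrite Rpower_mult, Rinv_l by lra. apply Rpower_1, cond_pos.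
Qed.

Lemma Phi_zs_lim (nu : R) : is_lim_seq (fun n => Phi nu ((zs n / 2) ^ 2)) (rGamma (nu + 1)).
Proof.
  rewrite <- (Phi_0 nu).
  apply (is_lim_seq_continuous (Phi nu) (fun n => (zs n / 2) ^ 2) 0).
  - apply (derive_cont_pt _ _ _ (is_derive_Phi nu 0)).
  - replace (Finite 0) with (Finite (0 * / 2 * (0 * / 2 * 1))) by (f_equal; ring).
    apply (is_lim_seq_mult' (fun n => zs n * / 2) (fun n => zs n * / 2 * 1)).
    + apply (is_lim_seq_scal_r zs (/ 2) 0 zs_lim).
    + apply (is_lim_seq_mult' (fun n => zs n * / 2) (fun _ => 1)).
      * apply (is_lim_seq_scal_r zs (/ 2) 0 zs_lim).
      * apply is_lim_seq_const.
Qed.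

Lemma is_lim_seq_bounded_mult (u v : nat -> R) (M : R) :
  (forall n, Rabs (u n) <= M) -> is_lim_seq v 0 -> is_lim_seq (fun n => u n * v n) 0.
Proof.
  intros H Hv. apply is_lim_seq_abs_0.
  apply is_lim_seq_le_le with (u := fun _ => 0) (w := fun n => M * Rabs (v n)).
  - intros n. split; [apply Rabs_pos|]. rewrite Rabs_mult.
    apply Rmult_le_compat_r; [apply Rabs_pos|apply H].
  - apply is_lim_seq_const.
  - replace (Finite 0) with (Rbar_mult M 0) by (simpl; f_equal; ring).
    apply is_lim_seq_scal_l. apply is_lim_seq_abs_0 in Hv. exact Hv.
Qed.

Lemma is_lim_seq_plus_0 (u v : nat -> R) (l : R) :
  is_lim_seq u l -> is_lim_seq v 0 -> is_lim_seq (fun n => u n + v n) l.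
Proof.
  intros Hu Hv. replace (Finite l) with (Finite (l + 0)) by (f_equal; ring).
  apply is_lim_seq_plus'; assumption.
Qed.

Lemma J_zs_lim (nu : R) : 0 < nu -> is_lim_seq (fun n => bessel_J nu (zs n)) 0.
Proof.
  intros Hn. replace (Finite 0) with (Finite (0 * rGamma (nu + 1))) by (f_equal; ring).
  apply (is_lim_seq_mult' (fun n => Rpower (zs n / 2) nu) (fun n => Phi nu ((zs n / 2) ^ 2))).
  - apply Rpower_zs_lim, Hn.
  - apply Phi_zs_lim.
Qed.

Lemma xJ'_zs_lim (nu : R) : 0 < nu -> is_lim_seq (fun n => zs n * bessel_J' nu (zs n)) 0.
Proof.
  intros Hn.
  apply is_lim_seq_ext with (u := fun n => nu * bessel_J nu (zs n) + (- zs n) * bessel_J (nu + 1) (zs n)).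
  - intros n. unfold bessel_J'. pose proof (zs_pos n). field. lra.
  - apply is_lim_seq_plus_0.
    + replace (Finite 0) with (Rbar_mult nu 0) by (simpl; f_equal; ring).
      apply is_lim_seq_scal_l, J_zs_lim, Hn.
    + apply is_lim_seq_bounded_mult with (M := 1).
      * intros n. rewrite Rabs_Ropp, Rabs_right by (left; apply zs_pos). apply zs_le_1.
      * apply J_zs_lim. lra.
Qed.

Lemma Rabs_lin2_le (a b x y A B : R) :
  Rabs a <= 1 -> Rabs b <= 1 -> Rabs x <= A -> Rabs y <= B -> Rabs (a * x + b * y) <= A + B.
Proof.
  intros Ha Hb Hx Hy. eapply Rle_trans; [apply Rabs_triang|]. rewrite !Rabs_mult.
  pose proof (Rabs_pos a). pose proof (Rabs_pos b). pose proof (Rabs_pos x). pose proof (Rabs_pos y).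
  apply Rplus_le_compat; nra.
Qed.

Lemma x_dint1_neg_bound (nu x : R) : 0 < x -> 0 < nu -> Rabs (x * dint1 (- nu) x) <= 1.
Proof.
  intros Hx Hn. unfold dint1.
  pose proof (dint_rec (- nu) x Hx) as E.
  pose proof (dint_nonneg (- nu + 1) x Hx). pose proof (dint_nonneg (- nu - 1) x Hx).
  pose proof (dint_nonneg (- nu) x Hx).
  replace (x * (- (dint (- nu + 1) x - dint (- nu - 1) x) / 2))
    with (x / 2 * dint (- nu - 1) x - x / 2 * dint (- nu + 1) x) by field.
  assert (0 <= x / 2 * dint (- nu - 1) x) by (apply Rmult_le_pos; lra).
  assert (0 <= x / 2 * dint (- nu + 1) x) by (apply Rmult_le_pos; lra).
  assert (0 <= nu * dint (- nu) x) by (apply Rmult_le_pos; lra).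
  apply Rabs_le. lra.
Qed.

(** The Hankel pair without [dint nu], its only term that is unbounded at the origin
    for [nu > 0]; general coefficients serve both [Hr] and [Hi]. *)
Definition reg (a b c nu x : R) : R := (a * Ec nu x + b * Es nu x) + c * dint (- nu) x.
Definition reg1 (a b c nu x : R) : R := (a * Ec1 nu x + b * Es1 nu x) + c * dint1 (- nu) x.

Lemma wronskian_reg_lim (a b c nu : R) : 0 < nu ->
  Rabs a <= 1 -> Rabs b <= 1 -> Rabs c <= 1 ->
  is_lim_seq (fun n => wronskian (bessel_J nu) (bessel_J' nu) (reg a b c nu) (reg1 a b c nu) (zs n)) 0.
Proof.
  intros Hn Ha Hb Hc.
  apply is_lim_seq_ext with (u := fun n =>
     (zs n * reg1 a b c nu (zs n)) * bessel_J nu (zs n)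
     + (- reg a b c nu (zs n)) * (zs n * bessel_J' nu (zs n))).
  - intros n. unfold wronskian. ring.
  - apply is_lim_seq_plus_0.
    + apply is_lim_seq_bounded_mult with (M := 5); [|apply J_zs_lim, Hn].
      intros n. pose proof (zs_pos n) as P. pose proof (zs_le_1 n) as Q.
      unfold reg1.
      replace (zs n * (a * Ec1 nu (zs n) + b * Es1 nu (zs n) + c * dint1 (- nu) (zs n)))
        with (zs n * (a * Ec1 nu (zs n) + b * Es1 nu (zs n)) + c * (zs n * dint1 (- nu) (zs n))) by ring.
      replace 5 with (2 + 2 + 1) by ring.
      apply Rabs_lin2_le; [rewrite Rabs_right; lra|exact Hc| |apply x_dint1_neg_bound; assumption].
      apply Rabs_lin2_le; try assumption; [apply Ec1_bounded|apply Es1_bounded].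
    + apply is_lim_seq_bounded_mult with (M := 2 + 2 + / nu); [|apply xJ'_zs_lim, Hn].
      intros n. pose proof (zs_pos n) as P. rewrite Rabs_Ropp. unfold reg.
      replace (a * Ec nu (zs n) + b * Es nu (zs n))
        with (1 * (a * Ec nu (zs n) + b * Es nu (zs n))) by ring.
      apply Rabs_lin2_le; [rewrite Rabs_R1; lra|exact Hc| |].
      * apply Rabs_lin2_le; try assumption; [apply Ec_bounded|apply Es_bounded].
      * rewrite Rabs_right by (apply Rle_ge, dint_nonneg, P). apply dint_neg_bound; assumption.
Qed.

Lemma Rabs_half_le (y : R) : Rabs y <= 1 -> Rabs (- / 2 * y) <= 1.
Proof.
  intros H. rewrite Rabs_mult, Rabs_Ropp, (Rabs_right (/ 2)) by lra. pose proof (Rabs_pos y). lra.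
Qed.

(** Both solutions are regular at the origin, where the Wronskian tends to 0. *)
Lemma wronskian_J_Hr (nu x : R) : 0 < nu -> 0 < x ->
  wronskian (bessel_J nu) (bessel_J' nu) (Hr nu) (Hr1 nu) x = 0.
Proof.
  intros Hn Hx.
  assert (L : is_lim_seq (fun n => wronskian (bessel_J nu) (bessel_J' nu) (Hr nu) (Hr1 nu) (zs n)) 0).
  { eapply is_lim_seq_ext; [|apply (wronskian_reg_lim (cos (halfang nu)) (sin (halfang nu))
       (- / 2 * sin (nu * PI)) nu Hn)].
    - intros n. unfold wronskian, reg, reg1, Hr, Hr1. ring.
    - apply Rabs_cos.
    - apply Rabs_sin.
    - apply Rabs_half_le, Rabs_sin. }
  apply is_lim_seq_ext with
    (v := fun _ => wronskian (bessel_J nu) (bessel_J' nu) (Hr nu) (Hr1 nu) x) in L.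
  - apply is_lim_seq_unique in L. rewrite Lim_seq_const in L. injection L; auto.
  - intros n. apply (wronskian_const nu); auto using bessel_sol_J, bessel_sol_Hr, zs_pos.
Qed.

(** Evaluated at an arbitrary point, the Wronskian being constant. *)
Definition kappa (nu : R) : R := wronskian (bessel_J nu) (bessel_J' nu) (Hi nu) (Hi1 nu) 1.

Definition qseq (nu : R) (n : nat) : R := Rpower (zs n / 2) nu * dint nu (zs n).

Lemma qseq_nonneg (nu : R) (n : nat) : 0 <= qseq nu n.
Proof.
  apply Rmult_le_pos; [left; apply Rpower_pos|apply dint_nonneg, zs_pos].
Qed.

(** Solving the constant Wronskian for the singular factor [d(nu, x)] shows that
    [(x/2)^nu d(nu, x)] converges. *)
Lemma qseq_lim (nu : R) : 0 < nu -> is_lim_seq (qseq nu) (kappa nu / rGamma nu).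
Proof.
  intros Hn.
  set (t := fun n => Rpower (zs n / 2) nu * dint (nu - 1) (zs n)).
  set (rho := fun n => t n / qseq nu n).
  assert (Ht : forall n, 0 <= t n <= qseq nu n).
  { intros n. split.
    - apply Rmult_le_pos; [left; apply Rpower_pos|apply dint_nonneg, zs_pos].
    - apply Rmult_le_compat_l; [left; apply Rpower_pos|]. apply dint_mono; [apply zs_pos|lra]. }
  assert (Hrho : forall n, 0 <= rho n <= 1 /\ t n = rho n * qseq nu n).
  { intros n. pose proof (Ht n) as [T1 T2]. unfold rho.
    destruct (Req_dec (qseq nu n) 0) as [E|E].
    - rewrite E in *. unfold Rdiv. rewrite Rinv_0, Rmult_0_r. split; lra.
    - assert (P : 0 < qseq nu n) by (pose proof (qseq_nonneg nu n); lra).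
      split; [split|].
      + apply Rdiv_le_0_compat; assumption.
      + apply Rle_div_l; lra.
      + field; exact E. }
  set (a := - sin (halfang nu)). set (b := cos (halfang nu)). set (c := - / 2 * cos (nu * PI)).
  set (w := fun n => wronskian (bessel_J nu) (bessel_J' nu) (reg a b c nu) (reg1 a b c nu) (zs n)).
  assert (Lw : is_lim_seq w 0).
  { apply wronskian_reg_lim; [exact Hn| | |].
    - unfold a; rewrite Rabs_Ropp; apply Rabs_sin.
    - apply Rabs_cos.
    - apply Rabs_half_le, Rabs_cos. }
  set (den := fun n => nu * Phi nu ((zs n / 2) ^ 2)
      + (- / 2 * (rho n * Phi nu ((zs n / 2) ^ 2)) - zs n / 4 * Phi (nu + 1) ((zs n / 2) ^ 2)) * zs n).
  assert (E : forall n, kappa nu - w n - / 2 * bessel_J nu (zs n) = qseq nu n * den n).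
  { intros n. pose proof (zs_pos n) as P.
    unfold kappa. rewrite (wronskian_const nu _ _ _ _ 1 (zs n)
       (bessel_sol_J nu) (bessel_sol_Hi nu) Rlt_0_1 P).
    unfold w, den.
    replace (qseq nu n * (nu * Phi nu ((zs n / 2) ^ 2)
      + (- / 2 * (rho n * Phi nu ((zs n / 2) ^ 2)) - zs n / 4 * Phi (nu + 1) ((zs n / 2) ^ 2)) * zs n))
      with (qseq nu n * nu * Phi nu ((zs n / 2) ^ 2) - / 2 * zs n * (rho n * qseq nu n) * Phi nu ((zs n / 2) ^ 2)
         - zs n * zs n / 4 * Phi (nu + 1) ((zs n / 2) ^ 2) * qseq nu n) by field.
    rewrite <- (proj2 (Hrho n)). unfold t, qseq, wronskian, reg, reg1, Hi, Hi1, bessel_J', a, b, c.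
    rewrite (bessel_J_Phi (nu + 1)), Rpower_plus, Rpower_1 by lra.
    rewrite bessel_J_Phi. fold (halfang nu).
    assert (D : dint1 nu (zs n) = - (1 + nu * dint nu (zs n)) / zs n + dint (nu - 1) (zs n)).
    { rewrite <- dint_rec by exact P. unfold dint1. field. lra. }
    rewrite D. field. lra. }
  assert (Bz : is_lim_seq (fun n => (- / 2 * (rho n * Phi nu ((zs n / 2) ^ 2))
       - zs n / 4 * Phi (nu + 1) ((zs n / 2) ^ 2)) * zs n) 0).
  { apply is_lim_seq_ext with (u := fun n =>
      (- / 2 * rho n) * (Phi nu ((zs n / 2) ^ 2) * zs n)
      + (- zs n / 4) * (Phi (nu + 1) ((zs n / 2) ^ 2) * zs n)).
    { intros n. field. }
    assert (L : forall m, is_lim_seq (fun n => Phi m ((zs n / 2) ^ 2) * zs n) 0).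
    { intros m. replace (Finite 0) with (Finite (rGamma (m + 1) * 0)) by (f_equal; ring).
      apply is_lim_seq_mult'; [apply Phi_zs_lim|apply zs_lim]. }
    apply is_lim_seq_plus_0; apply is_lim_seq_bounded_mult with (M := 1); try apply L.
    - intros n. destruct (Hrho n) as [H _]. apply Rabs_half_le. rewrite Rabs_right; lra.
    - intros n. pose proof (zs_pos n). pose proof (zs_le_1 n). apply Rabs_le. lra. }
  assert (Lden : is_lim_seq den (nu * rGamma (nu + 1))).
  { apply is_lim_seq_plus_0; [|exact Bz].
    apply (is_lim_seq_scal_l _ nu (rGamma (nu + 1))), Phi_zs_lim. }
  assert (G : 0 < nu * rGamma (nu + 1)) by (apply Rmult_lt_0_compat; [exact Hn|apply rGamma_pos; lra]).
  assert (Hden : eventually (fun n => den n <> 0)).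
  { apply is_lim_seq_spec in Lden. destruct (Lden (mkposreal _ G)) as [N HN].
    exists N. intros n Hle. specialize (HN n Hle). simpl in HN.
    intros Z. rewrite Z in HN. apply Rabs_lt_between in HN. lra. }
  rewrite (rGamma_rec nu).
  apply is_lim_seq_ext_loc with
    (u := fun n => (kappa nu - w n - / 2 * bessel_J nu (zs n)) / den n).
  - eapply filter_imp; [|exact Hden]. intros n Hd. rewrite E. field. exact Hd.
  - apply is_lim_seq_div'; [|exact Lden|lra].
    replace (Finite (kappa nu)) with (Finite (kappa nu - 0 - / 2 * 0)) by (f_equal; ring).
    apply is_lim_seq_minus'; [apply is_lim_seq_minus'; [apply is_lim_seq_const|exact Lw]|].
    apply (is_lim_seq_scal_l _ (/ 2) 0), J_zs_lim, Hn.
Qed.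

(** The limit of [(x/2)^nu dint nu x] at the origin; it turns out to be the Gamma
    function. *)
Definition delta (nu : R) : R := kappa nu / rGamma nu.

Lemma delta_rec (nu : R) : 0 < nu -> delta (nu + 1) = nu * delta nu.
Proof.
  intros Hn.
  assert (L1 : is_lim_seq (qseq (nu + 1)) (delta (nu + 1))) by (apply qseq_lim; lra).
  assert (L0 : is_lim_seq (qseq nu) (delta nu)) by (apply qseq_lim; lra).
  assert (L2 : is_lim_seq (qseq (nu + 1)) (nu * delta nu)).
  { apply is_lim_seq_ext with (u := fun n => (nu * qseq nu n + Rpower (zs n / 2) nu)
       + (- zs n / 2) * (Rpower (zs n / 2) nu * dint (nu - 1) (zs n))).
    - intros n. pose proof (zs_pos n) as P. unfold qseq. rewrite Rpower_plus, Rpower_1 by lra.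
      replace (nu * (Rpower (zs n / 2) nu * dint nu (zs n)) + Rpower (zs n / 2) nu)
        with (Rpower (zs n / 2) nu * (1 + nu * dint nu (zs n))) by ring.
      rewrite <- dint_rec by exact P. field.
    - apply is_lim_seq_plus_0.
      + apply is_lim_seq_plus_0.
        * apply (is_lim_seq_scal_l _ nu (delta nu) L0).
        * apply Rpower_zs_lim, Hn.
      + apply is_lim_seq_abs_0.
        apply is_lim_seq_le_le with (u := fun _ => 0) (w := fun n => zs n * qseq nu n).
        * intros n. pose proof (zs_pos n) as P. split; [apply Rabs_pos|].
          assert (T : 0 <= Rpower (zs n / 2) nu * dint (nu - 1) (zs n) <= qseq nu n).
          { split.
            - apply Rmult_le_pos; [left; apply Rpower_pos|apply dint_nonneg, P].
            - apply Rmult_le_compat_l; [left; apply Rpower_pos|]. apply dint_mono; lra. }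
          rewrite Rabs_mult, (Rabs_right (Rpower _ _ * _)) by lra.
          replace (- zs n / 2) with (- (zs n / 2)) by field.
          rewrite Rabs_Ropp, Rabs_right by lra.
          apply Rmult_le_compat; lra.
        * apply is_lim_seq_const.
        * replace (Finite 0) with (Finite (0 * delta nu)) by (f_equal; ring).
          apply is_lim_seq_mult'; [apply zs_lim|exact L0]. }
  apply is_lim_seq_unique in L1. apply is_lim_seq_unique in L2.
  rewrite L1 in L2. injection L2; auto.
Qed.

Lemma delta_1 : delta 1 = 1.
Proof.
  assert (L1 : is_lim_seq (qseq 1) (delta 1)) by (apply qseq_lim; lra).
  assert (L2 : is_lim_seq (qseq 1) 1).
  { apply is_lim_seq_ext with (u := fun n => 1 + (- / 2 * dint (- 1) (zs n)) * zs n).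
    - intros n. pose proof (zs_pos n) as P. unfold qseq. rewrite Rpower_1 by lra.
      pose proof (dint_rec 0 (zs n) P) as E.
      replace (0 + 1) with 1 in E by ring. replace (0 - 1) with (- 1) in E by ring. lra.
    - apply is_lim_seq_plus_0; [apply is_lim_seq_const|].
      apply is_lim_seq_bounded_mult with (M := 1); [|apply zs_lim].
      intros n. apply Rabs_half_le.
      rewrite Rabs_right by (apply Rle_ge, dint_nonneg, zs_pos).
      pose proof (dint_neg_bound 1 (zs n) (zs_pos n) Rlt_0_1) as B. rewrite Rinv_1 in B. exact B. }
  apply is_lim_seq_unique in L1. apply is_lim_seq_unique in L2.
  rewrite L1 in L2. injection L2; auto.
Qed.

(** The Young inequality with parameter [2 nu / x] passes to the limit as the
    log-convexity bound that characterizes the Gamma function. *)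
Lemma delta_young (nu s : R) : 0 < nu -> 0 <= s <= 1 ->
  delta (nu + s) <= Rpower nu s * delta nu.
Proof.
  intros Hn Hs.
  assert (L1 : is_lim_seq (qseq (nu + 1)) (delta (nu + 1))) by (apply qseq_lim; lra).
  assert (L0 : is_lim_seq (qseq nu) (delta nu)) by (apply qseq_lim; lra).
  assert (Ls : is_lim_seq (qseq (nu + s)) (delta (nu + s))) by (apply qseq_lim; lra).
  assert (LR : is_lim_seq (fun n => Rpower nu s * ((1 - s) * qseq nu n + s / nu * qseq (nu + 1) n))
                (Rpower nu s * ((1 - s) * delta nu + s / nu * delta (nu + 1)))).
  { apply (is_lim_seq_scal_l _ (Rpower nu s) (Finite _)).
    apply is_lim_seq_plus'.
    - apply (is_lim_seq_scal_l _ (1 - s) (Finite _) L0).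
    - apply (is_lim_seq_scal_l _ (s / nu) (Finite _) L1). }
  rewrite delta_rec in LR by exact Hn.
  replace (Rpower nu s * delta nu)
    with (Rpower nu s * ((1 - s) * delta nu + s / nu * (nu * delta nu))) by (field; lra).
  apply (is_lim_seq_le (qseq (nu + s)) _ (Finite _) (Finite _)) with (2 := Ls) (3 := LR).
  intros n. pose proof (zs_pos n) as P. unfold qseq.
  pose proof (dint_young nu s (2 * nu / zs n) (zs n) P Hs) as Y.
  assert (HL : 0 < 2 * nu / zs n) by (apply Rdiv_lt_0_compat; lra).
  specialize (Y HL).
  rewrite !Rpower_plus, Rpower_1 by lra.
  assert (E : Rpower (zs n / 2) s * Rpower (2 * nu / zs n) s = Rpower nu s).
  { rewrite Rpower_mult_distr by lra. f_equal. field. lra. }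
  pose proof (Rpower_pos (zs n / 2) nu) as P1. pose proof (Rpower_pos (zs n / 2) s) as P2.
  apply Rle_trans with (Rpower (zs n / 2) nu * Rpower (zs n / 2) s *
     (Rpower (2 * nu / zs n) s * ((1 - s) * dint nu (zs n) + s / (2 * nu / zs n) * dint (nu + 1) (zs n)))).
  - apply Rmult_le_compat_l; [left; apply Rmult_lt_0_compat; assumption|exact Y].
  - apply Req_le. rewrite <- E. field. lra.
Qed.

Lemma delta_prod (s : R) (n : nat) : 0 < s ->
  delta (s + INR n + 1) = prod_f_R0 (fun i => s + INR i) n * delta s.
Proof.
  intros Hs. induction n as [|n IH].
  - simpl. rewrite Rplus_0_r. apply delta_rec, Hs.
  - change (prod_f_R0 (fun i => s + INR i) (S n))
      with (prod_f_R0 (fun i => s + INR i) n * (s + INR (S n))).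
    rewrite S_INR. pose proof (pos_INR n).
    replace (s + (INR n + 1)) with (s + INR n + 1) by ring.
    rewrite delta_rec by lra. rewrite IH. ring.
Qed.

Lemma delta_fact (n : nat) : delta (INR n + 1) = INR (fact n).
Proof.
  induction n as [|n IH].
  - simpl. rewrite Rplus_0_l. apply delta_1.
  - rewrite S_INR, delta_rec, IH by (pose proof (pos_INR n); lra).
    rewrite fact_simpl, mult_INR, S_INR. reflexivity.
Qed.

Lemma Rpower_le_self (t a : R) : 1 <= t -> 0 <= a <= 1 -> 1 <= Rpower t a <= t.
Proof.
  intros Ht Ha. assert (0 <= ln t) by (rewrite <- ln_1; apply ln_le; lra).
  split.
  - rewrite <- exp_0 at 1. apply exp_le. nra.
  - rewrite <- (Rpower_1 t) at 2 by lra. unfold Rpower. apply exp_le. nra.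
Qed.

(** The Bohr-Mollerup argument: the recurrence and the log-convexity bound
    squeeze the Gauss sequence. *)
Lemma kappa_01 (s : R) : 0 < s <= 1 -> kappa s = 1.
Proof.
  intros Hs.
  assert (G : is_lim_seq (fun n => gauss s (S n) * delta s) 1).
  { apply is_lim_seq_le_le with (u := fun n => 1 - zs (S n)) (w := fun n => 1 + zs n).
    - intros n. set (m := S n).
      assert (Hm : 1 <= INR m) by (unfold m; rewrite S_INR; pose proof (pos_INR n); lra).
      assert (E : gauss s m * delta s = delta (s + INR m + 1) / (INR (fact m) * Rpower (INR m) s)).
      { rewrite delta_prod by lra. unfold gauss. field. split.
        - pose proof (Rpower_pos (INR m) s); lra.
        - apply INR_fact_neq_0. }
      rewrite E. pose proof (INR_fact_lt_0 m) as F. pose proof (Rpower_pos (INR m) s) as P.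
      assert (FP : 0 < INR (fact m) * Rpower (INR m) s) by (apply Rmult_lt_0_compat; assumption).
      split.
      + apply Rle_div_r; [exact FP|].
        pose proof (delta_young (s + INR m + 1) (1 - s)) as Y.
        replace (s + INR m + 1 + (1 - s)) with (INR m + 1 + 1) in Y by ring.
        rewrite delta_rec, delta_fact in Y by lra.
        specialize (Y ltac:(lra) ltac:(lra)).
        set (B := s + INR m + 1) in *. assert (HB : 0 < B) by (unfold B; lra).
        replace (Rpower B (1 - s)) with (B * / Rpower B s) in Y
          by (unfold Rminus; rewrite Rpower_plus, Rpower_Ropp, Rpower_1 by exact HB; reflexivity).
        pose proof (Rpower_pos B s) as PB.
        assert (PM : Rpower (INR m) s <= Rpower B s) by (apply Rle_Rpower_l; unfold B; lra).
        assert (Hz : 0 <= B * (1 - zs (S n)) <= INR m + 1).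
        { unfold zs. fold m. rewrite S_INR.
          assert (Hi : 0 < / (INR m + 1) <= 1).
          { split; [apply Rinv_0_lt_compat; lra|]. rewrite <- Rinv_1. apply Rinv_le_contravar; lra. }
          assert (Hi2 : (INR m + 1) * / (INR m + 1) = 1) by (apply Rinv_r; lra).
          unfold B. split; nra. }
        assert (Y2 : (INR m + 1) * INR (fact m) * Rpower B s <= B * delta B).
        { replace (B * delta B) with (B * / Rpower B s * delta B * Rpower B s) by (field; lra).
          apply Rmult_le_compat_r; lra. }
        apply Rmult_le_reg_l with B; [exact HB|].
        eapply Rle_trans; [|exact Y2].
        rewrite (Rmult_assoc (INR m + 1)), <- (Rmult_assoc B).
        apply Rmult_le_compat; [apply Hz|left; exact FP|apply Hz|apply Rmult_le_compat_l; lra].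
      + apply Rle_div_l; [exact FP|].
        pose proof (delta_young (INR m + 1) s) as Y. rewrite delta_fact in Y.
        specialize (Y ltac:(lra) ltac:(lra)).
        replace (s + INR m + 1) with (INR m + 1 + s) by ring.
        eapply Rle_trans; [exact Y|].
        assert (E2 : Rpower (INR m + 1) s = Rpower (1 + zs n) s * Rpower (INR m) s).
        { rewrite Rpower_mult_distr; [|pose proof (zs_pos n); lra|lra].
          f_equal. unfold zs. fold m. field. lra. }
        rewrite E2.
        pose proof (Rpower_le_self (1 + zs n) s) as Q. pose proof (zs_pos n).
        specialize (Q ltac:(lra) ltac:(lra)).
        replace (Rpower (1 + zs n) s * Rpower (INR m) s * INR (fact m))
          with (Rpower (1 + zs n) s * (INR (fact m) * Rpower (INR m) s)) by ring.
        apply Rmult_le_compat_r; [left; exact FP|apply Q].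
    - replace (Finite 1) with (Finite (1 - 0)) by (f_equal; ring).
      apply is_lim_seq_minus'; [apply is_lim_seq_const|].
      apply (is_lim_seq_incr_1 zs), zs_lim.
    - apply is_lim_seq_plus_0; [apply is_lim_seq_const|apply zs_lim]. }
  assert (G2 : is_lim_seq (fun n => gauss s (S n) * delta s) (rGamma s * delta s)).
  { apply is_lim_seq_mult'; [|apply is_lim_seq_const].
    apply (is_lim_seq_incr_1 (gauss s)), is_lim_gauss. }
  apply is_lim_seq_unique in G. apply is_lim_seq_unique in G2. rewrite G in G2.
  injection G2; intros E. unfold delta in E.
  pose proof (rGamma_pos s). field_simplify in E; lra.
Qed.

Lemma kappa_1 (nu : R) : 0 < nu -> kappa nu = 1.
Proof.
  intros Hn.
  destruct (nfloor_ex nu) as [N HN]; [lra|].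
  assert (H : nu <= INR (S N)) by (rewrite S_INR; lra).
  revert H; generalize (S N) as m; clear N HN; intros m; revert nu Hn.
  induction m as [|m IH]; intros nu Hn Hm; [simpl in Hm; lra|].
  destruct (Rle_dec nu 1) as [H|H]; [apply kappa_01; lra|].
  rewrite S_INR in Hm.
  pose proof (IH (nu - 1) ltac:(lra) ltac:(lra)) as E.
  pose proof (delta_rec (nu - 1) ltac:(lra)) as D.
  replace (nu - 1 + 1) with nu in D by ring.
  unfold delta in D. rewrite E in D.
  pose proof (rGamma_rec (nu - 1)) as G. replace (nu - 1 + 1) with nu in G by ring.
  pose proof (rGamma_pos nu Hn) as P.
  rewrite G in D.
  replace ((nu - 1) * (1 / ((nu - 1) * rGamma nu))) with (/ rGamma nu) in D by (field; lra).
  apply Rmult_eq_reg_r with (/ rGamma nu); [|apply Rinv_neq_0_compat; lra].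
  unfold Rdiv in D. rewrite D. ring.
Qed.

Lemma wronskian_J_Hi (nu x : R) : 0 < nu -> 0 < x ->
  wronskian (bessel_J nu) (bessel_J' nu) (Hi nu) (Hi1 nu) x = 1.
Proof.
  intros Hn Hx. rewrite <- (kappa_1 nu Hn).
  apply (wronskian_const nu); auto using bessel_sol_J, bessel_sol_Hi, Rlt_0_1.
Qed.

(** * Order one half *)

(** Equal to [sqrt (2 / PI)], the amplitude of [sqrt x * J] at infinity. *)
Definition kamp : R := sqrt 2 * rGamma (1 / 2).

Lemma kamp_pos : 0 < kamp.
Proof. apply Rmult_lt_0_compat; [apply sqrt_lt_R0; lra|apply rGamma_pos; lra]. Qed.

Definition Sh (x : R) : R := sqrt x * bessel_J (1 / 2) x.
Definition Ch (x : R) : R := sqrt x * bessel_J (- (1 / 2)) x.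

Lemma derive_sqrt (x : R) : 0 < x -> is_derive sqrt x (/ (2 * sqrt x)).
Proof.
  intros Hx. auto_derive; [exact Hx|]. pose proof (sqrt_lt_R0 x Hx). field. lra.
Qed.

Lemma J'_half (x : R) : 0 < x ->
  bessel_J' (1 / 2) x = - bessel_J (1 / 2) x / (2 * x) + bessel_J (- (1 / 2)) x.
Proof.
  intros Hx. unfold bessel_J'. pose proof (bessel_J_rec (1 / 2) x Hx) as E.
  replace (1 / 2 - 1) with (- (1 / 2)) in E by field.
  replace (bessel_J (1 / 2 + 1) x)
    with (2 * (1 / 2) / x * bessel_J (1 / 2) x - bessel_J (- (1 / 2)) x) by lra.
  field. lra.
Qed.

Lemma sqrt_mult_derive (f : R -> R) (x l : R) : 0 < x -> is_derive f x l ->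
  is_derive (fun t => sqrt t * f t) x (sqrt x * (l + f x / (2 * x))).
Proof.
  intros Hx H. eapply derive_eq.
  - apply derive_mult; [apply derive_sqrt, Hx|exact H].
  - pose proof (sqrt_lt_R0 x Hx) as P.
    replace (/ (2 * sqrt x)) with (sqrt x / (2 * x)).
    + field. lra.
    + rewrite <- (sqrt_sqrt x) at 2 by lra. field. lra.
Qed.

Lemma is_derive_Sh (x : R) : 0 < x -> is_derive Sh x (Ch x).
Proof.
  intros Hx. eapply derive_eq.
  - apply sqrt_mult_derive; [exact Hx|]. exact (proj1 (bessel_sol_J (1 / 2) x Hx)).
  - rewrite J'_half by exact Hx. unfold Ch. field. lra.
Qed.

Lemma is_derive_Ch (x : R) : 0 < x -> is_derive Ch x (- Sh x).
Proof.
  intros Hx. eapply derive_eq.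
  - apply sqrt_mult_derive; [exact Hx|]. exact (proj1 (bessel_sol_J (- (1 / 2)) x Hx)).
  - unfold bessel_J', Sh. replace (- (1 / 2) + 1) with (1 / 2) by field. field. lra.
Qed.

Lemma Sh_zs_lim : is_lim_seq (fun n => Sh (zs n)) 0.
Proof.
  unfold Sh. apply is_lim_seq_bounded_mult with (M := 1).
  - intros n. rewrite Rabs_right by (apply Rle_ge, sqrt_pos).
    rewrite <- sqrt_1. apply sqrt_le_1_alt, zs_le_1.
  - apply J_zs_lim. lra.
Qed.

Lemma Ch_zs_lim : is_lim_seq (fun n => Ch (zs n)) kamp.
Proof.
  apply is_lim_seq_ext with (u := fun n => sqrt 2 * Phi (- (1 / 2)) ((zs n / 2) ^ 2)).
  - intros n. pose proof (zs_pos n) as P. unfold Ch. rewrite bessel_J_Phi.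
    rewrite Rpower_Ropp. replace (1 / 2) with (/ 2) by field.
    rewrite Rpower_sqrt by lra. rewrite sqrt_div_alt by lra.
    pose proof (sqrt_lt_R0 (zs n) P). pose proof (sqrt_lt_R0 2 ltac:(lra)).
    field. lra.
  - pose proof (Phi_zs_lim (- (1 / 2))) as L.
    replace (- (1 / 2) + 1) with (1 / 2) in L by field.
    exact (is_lim_seq_scal_l _ (sqrt 2) (Finite (rGamma (1 / 2))) L).
Qed.

Lemma sin_zs_lim : is_lim_seq (fun n => sin (zs n)) 0.
Proof.
  rewrite <- sin_0. apply (is_lim_seq_continuous sin zs 0); [|apply zs_lim].
  apply continuity_sin.
Qed.

Lemma cos_zs_lim : is_lim_seq (fun n => cos (zs n)) 1.
Proof.
  rewrite <- cos_0. apply (is_lim_seq_continuous cos zs 0); [|apply zs_lim].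
  apply continuity_cos.
Qed.

Lemma const_of_zs_lim (F : R -> R) (l x : R) : 0 < x ->
  (forall t, 0 < t -> is_derive F t 0) -> is_lim_seq (fun n => F (zs n)) l -> F x = l.
Proof.
  intros Hx HF L.
  apply is_lim_seq_ext with (v := fun _ => F x) in L.
  - apply is_lim_seq_unique in L. rewrite Lim_seq_const in L. injection L; auto.
  - intros n. apply (const_of_derive_0 F 0); auto using zs_pos.
Qed.

(** The pair [(Sh, Ch)] solves the harmonic oscillator with initial value
    [(0, kamp)]. *)
Lemma Sh_Ch_eq (x : R) : 0 < x -> Sh x = kamp * sin x /\ Ch x = kamp * cos x.
Proof.
  intros Hx.
  assert (E1 : Sh x * cos x - Ch x * sin x = 0).
  { apply (const_of_zs_lim (fun x => Sh x * cos x - Ch x * sin x)); [exact Hx| |].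
    - intros t Ht. eapply derive_eq.
      + apply derive_minus; apply derive_mult; eauto using is_derive_Sh, is_derive_Ch,
          is_derive_sin, is_derive_cos.
      + ring.
    - replace (Finite 0) with (Finite (0 * 1 - kamp * 0)) by (f_equal; ring).
      apply is_lim_seq_minus'; apply is_lim_seq_mult';
        auto using Sh_zs_lim, Ch_zs_lim, sin_zs_lim, cos_zs_lim. }
  assert (E2 : Sh x * sin x + Ch x * cos x = kamp).
  { apply (const_of_zs_lim (fun x => Sh x * sin x + Ch x * cos x)); [exact Hx| |].
    - intros t Ht. eapply derive_eq.
      + apply derive_plus; apply derive_mult; eauto using is_derive_Sh, is_derive_Ch,
          is_derive_sin, is_derive_cos.
      + ring.
    - replace (Finite kamp) with (Finite (0 * 0 + kamp * 1)) by (f_equal; ring).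
      apply is_lim_seq_plus'; apply is_lim_seq_mult';
        auto using Sh_zs_lim, Ch_zs_lim, sin_zs_lim, cos_zs_lim. }
  pose proof (sin_cos_sqr x) as T.
  split.
  - replace (Sh x) with ((Sh x * sin x + Ch x * cos x) * sin x + (Sh x * cos x - Ch x * sin x) * cos x).
    + rewrite E1, E2; ring.
    + replace ((Sh x * sin x + Ch x * cos x) * sin x + (Sh x * cos x - Ch x * sin x) * cos x)
        with (Sh x * (sin x ^ 2 + cos x ^ 2)) by ring. rewrite T; ring.
  - replace (Ch x) with ((Sh x * sin x + Ch x * cos x) * cos x - (Sh x * cos x - Ch x * sin x) * sin x).
    + rewrite E1, E2; ring.
    + replace ((Sh x * sin x + Ch x * cos x) * cos x - (Sh x * cos x - Ch x * sin x) * sin x)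
        with (Ch x * (sin x ^ 2 + cos x ^ 2)) by ring. rewrite T; ring.
Qed.

(** * Asymptotics at infinity *)

Definition wave (A a : R) (f f1 : R -> R) : Prop :=
  vanish (fun x => sqrt x * f x - A * cos (x - a)) /\
  vanish (fun x => sqrt x * f1 x + A * sin (x - a)).

Lemma ebounded_sin_shift (a : R) : ebounded (fun x => sin (x - a)).
Proof. apply ebounded_le1. intros; apply Rabs_sin. Qed.

Lemma ebounded_cos_shift (a : R) : ebounded (fun x => cos (x - a)).
Proof. apply ebounded_le1. intros; apply Rabs_cos. Qed.

Lemma ebounded_sin : ebounded sin.
Proof. apply ebounded_le1. intros; apply Rabs_sin. Qed.

Lemma ebounded_cos : ebounded cos.
Proof. apply ebounded_le1. intros; apply Rabs_cos. Qed.

Lemma ebounded_scal (c : R) (f : R -> R) : ebounded f -> ebounded (fun x => c * f x).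
Proof. intros H. apply ebounded_mult; [apply ebounded_const|exact H]. Qed.

Lemma vanish_const_eq (c : R) : vanish (fun _ => c) -> c = 0.
Proof.
  intros H. apply is_lim_unique in H. rewrite Lim_const in H. injection H; auto.
Qed.

Lemma wronskian_sqrt (f f1 g g1 : R -> R) (x : R) : 0 < x ->
  wronskian f f1 g g1 x =
  (sqrt x * f x) * (sqrt x * g1 x) - (sqrt x * f1 x) * (sqrt x * g x).
Proof.
  intros Hx. unfold wronskian.
  transitivity ((sqrt x * sqrt x) * (f x * g1 x - f1 x * g x)); [|ring].
  rewrite sqrt_sqrt by lra. reflexivity.
Qed.

(** Both Wronskians with the explicitly known [J_{1/2}] are constant; they form
    a rotation that is inverted for the common amplitudes. *)
Lemma amplitudes_infty :
  vanish (fun x => Xc x + Xs x - sqrt 2 / kamp * sin x) /\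
  vanish (fun x => Xc x - Xs x - sqrt 2 / kamp * cos x).
Proof.
  set (nu := 1 / 2). set (q := / sqrt 2).
  pose proof kamp_pos as Hk.
  assert (H2 : 0 < sqrt 2) by (apply sqrt_lt_R0; lra).
  assert (Hq : q * sqrt 2 = 1) by (unfold q; field; lra).
  assert (Cq : cos (halfang nu) = q).
  { replace (halfang nu) with (PI / 4) by (unfold halfang, nu; field).
    rewrite cos_PI4. unfold q. field. lra. }
  assert (Sq : sin (halfang nu) = q).
  { replace (halfang nu) with (PI / 4) by (unfold halfang, nu; field).
    rewrite sin_PI4. unfold q. field. lra. }
  pose proof (Hr_infty nu) as A1. pose proof (Hr1_infty nu) as A2.
  pose proof (Hi_infty nu) as A3. pose proof (Hi1_infty nu) as A4.
  rewrite Cq, Sq in A1, A2, A3, A4.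
  set (e1 := fun x => sqrt x * Hr nu x - (q * Xc x + q * Xs x)) in *.
  set (e2 := fun x => sqrt x * Hr1 nu x - (q * Xc x + - q * Xs x)) in *.
  set (e3 := fun x => sqrt x * Hi nu x - (- q * Xc x + q * Xs x)) in *.
  set (e4 := fun x => sqrt x * Hi1 nu x - (q * Xc x + q * Xs x)) in *.
  assert (BHr : ebounded (Hr nu)).
  { unfold Hr. apply ebounded_close with
      (f := fun x => cos (halfang nu) * Ec nu x + sin (halfang nu) * Es nu x).
    - apply ebounded_plus; apply ebounded_scal.
      + exists 2, 0; intros; apply Ec_bounded.
      + exists 2, 0; intros; apply Es_bounded.
    - apply vanish_ext with (X := 0) (f := fun x => - (/ 2 * sin (nu * PI)) * dint (- nu) x).
      { intros; ring. }
      apply vanish_mult; [apply ebounded_const|apply bigO_inv_vanish, bigO_dint]. }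
  assert (BHi : ebounded (Hi nu)).
  { unfold Hi. apply ebounded_close with
      (f := fun x => - sin (halfang nu) * Ec nu x + cos (halfang nu) * Es nu x).
    - apply ebounded_plus; apply ebounded_scal.
      + exists 2, 0; intros; apply Ec_bounded.
      + exists 2, 0; intros; apply Es_bounded.
    - apply vanish_ext with (X := 0)
        (f := fun x => - (/ 2 * cos (nu * PI)) * dint (- nu) x + - / 2 * dint nu x).
      { intros; ring. }
      apply vanish_lin; apply bigO_inv_vanish, bigO_dint. }
  (* The two remainders of the linear system for the sum and the difference. *)
  set (s1 := fun x => - (sin x * e2 x - cos x * e1 x + (sin x * Hr nu x) * (/ 2 * / sqrt x)) / q).
  set (s2 := fun x => - (sin x * e4 x - cos x * e3 x + (sin x * Hi nu x) * (/ 2 * / sqrt x)) / q).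
  assert (V : forall f g H, vanish f -> vanish g -> ebounded H ->
     vanish (fun x => - (sin x * f x - cos x * g x + (sin x * H x) * (/ 2 * / sqrt x)) / q)).
  { intros f g H Vf Vg BH.
    apply vanish_ext with (X := 0) (f := fun x =>
      - / q * (1 * (sin x * f x) + -1 * (cos x * g x)) + (- / q) * ((/ 2 * (sin x * H x)) * / sqrt x)).
    - intros x Hx. assert (0 < sqrt x) by (apply sqrt_lt_R0; exact Hx).
      assert (0 < q) by (unfold q; apply Rinv_0_lt_compat, H2). field. lra.
    - apply vanish_lin; [apply vanish_lin|]; apply vanish_mult; auto using ebounded_sin, ebounded_cos.
      + apply ebounded_scal, ebounded_mult; [apply ebounded_sin|exact BH].
      + apply vanish_inv_sqrt. }
  assert (V1 : vanish s1) by (apply V; assumption).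
  assert (V2 : vanish s2) by (apply V; assumption).
  assert (J1 : forall x, 0 < x -> sqrt x * bessel_J' nu x = kamp * cos x - kamp * sin x / (2 * x)).
  { intros x Hx. destruct (Sh_Ch_eq x Hx) as [ES EC]. unfold nu. rewrite J'_half by exact Hx.
    rewrite <- ES, <- EC. unfold Sh, Ch. field. lra. }
  assert (L1 : forall x, 0 < x -> sin x * (Xc x - Xs x) - cos x * (Xc x + Xs x) = s1 x).
  { intros x Hx. destruct (Sh_Ch_eq x Hx) as [ES EC].
    pose proof (sqrt_lt_R0 x Hx) as Hs.
    pose proof (wronskian_J_Hr nu x ltac:(unfold nu; lra) Hx) as W.
    rewrite wronskian_sqrt, J1 in W by exact Hx. unfold Sh in ES; fold nu in ES. rewrite ES in W.
    assert (W2 : sin x * (sqrt x * Hr1 nu x) - (cos x - sin x / (2 * x)) * (sqrt x * Hr nu x) = 0).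
    { apply Rmult_eq_reg_l with kamp; [|lra]. rewrite Rmult_0_r, <- W. field. lra. }
    unfold s1, e1, e2.
    replace (sin x * Hr nu x * (/ 2 * / sqrt x)) with (sin x / (2 * x) * (sqrt x * Hr nu x))
      by (rewrite <- (sqrt_sqrt x) at 2 by lra; field; lra).
    replace (sin x * (sqrt x * Hr1 nu x - (q * Xc x + - q * Xs x)) -
      cos x * (sqrt x * Hr nu x - (q * Xc x + q * Xs x)) + sin x / (2 * x) * (sqrt x * Hr nu x))
      with ((sin x * (sqrt x * Hr1 nu x) - (cos x - sin x / (2 * x)) * (sqrt x * Hr nu x))
       - q * (sin x * (Xc x - Xs x) - cos x * (Xc x + Xs x))) by ring.
    rewrite W2. field. unfold q; apply Rinv_neq_0_compat; lra. }
  assert (L2 : forall x, 0 < x -> sin x * (Xc x + Xs x) + cos x * (Xc x - Xs x) = sqrt 2 / kamp + s2 x).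
  { intros x Hx. destruct (Sh_Ch_eq x Hx) as [ES EC].
    pose proof (sqrt_lt_R0 x Hx) as Hs.
    pose proof (wronskian_J_Hi nu x ltac:(unfold nu; lra) Hx) as W.
    rewrite wronskian_sqrt, J1 in W by exact Hx. unfold Sh in ES; fold nu in ES. rewrite ES in W.
    assert (W2 : sin x * (sqrt x * Hi1 nu x) - (cos x - sin x / (2 * x)) * (sqrt x * Hi nu x) = / kamp).
    { apply Rmult_eq_reg_l with kamp; [|lra]. rewrite Rinv_r, <- W by lra. field. lra. }
    unfold s2, e3, e4.
    replace (sin x * Hi nu x * (/ 2 * / sqrt x)) with (sin x / (2 * x) * (sqrt x * Hi nu x))
      by (rewrite <- (sqrt_sqrt x) at 2 by lra; field; lra).
    replace (sin x * (sqrt x * Hi1 nu x - (q * Xc x + q * Xs x)) -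
      cos x * (sqrt x * Hi nu x - (- q * Xc x + q * Xs x)) + sin x / (2 * x) * (sqrt x * Hi nu x))
      with ((sin x * (sqrt x * Hi1 nu x) - (cos x - sin x / (2 * x)) * (sqrt x * Hi nu x))
       - q * (sin x * (Xc x + Xs x) + cos x * (Xc x - Xs x))) by ring.
    rewrite W2. unfold q. field. lra. }
  split.
  - apply vanish_ext with (X := 0) (f := fun x => 1 * (sin x * s2 x) + -1 * (cos x * s1 x)).
    + intros x Hx. pose proof (L1 x Hx) as M1. pose proof (L2 x Hx) as M2.
      pose proof (sin_cos_sqr x) as T. rewrite <- M1.
      replace (s2 x) with (sin x * (Xc x + Xs x) + cos x * (Xc x - Xs x) - sqrt 2 / kamp) by lra.
      transitivity ((sin x ^ 2 + cos x ^ 2) * (Xc x + Xs x) - sqrt 2 / kamp * sin x); [ring|].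
      rewrite T; ring.
    + apply vanish_lin; apply vanish_mult; auto using ebounded_sin, ebounded_cos.
  - apply vanish_ext with (X := 0) (f := fun x => 1 * (cos x * s2 x) + 1 * (sin x * s1 x)).
    + intros x Hx. pose proof (L1 x Hx) as M1. pose proof (L2 x Hx) as M2.
      pose proof (sin_cos_sqr x) as T. rewrite <- M1.
      replace (s2 x) with (sin x * (Xc x + Xs x) + cos x * (Xc x - Xs x) - sqrt 2 / kamp) by lra.
      transitivity ((sin x ^ 2 + cos x ^ 2) * (Xc x - Xs x) - sqrt 2 / kamp * cos x); [ring|].
      rewrite T; ring.
    + apply vanish_lin; apply vanish_mult; auto using ebounded_sin, ebounded_cos.
Qed.

Lemma cos_shift_quarter (y : R) : cos (y - PI / 4) = (cos y + sin y) / sqrt 2.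
Proof.
  rewrite cos_minus, cos_PI4, sin_PI4. pose proof (sqrt_lt_R0 2 ltac:(lra)). field. lra.
Qed.

Lemma sin_shift_quarter (y : R) : sin (y - PI / 4) = (sin y - cos y) / sqrt 2.
Proof.
  rewrite sin_minus, cos_PI4, sin_PI4. pose proof (sqrt_lt_R0 2 ltac:(lra)). field. lra.
Qed.

Definition phase (nu : R) : R := halfang nu + PI / 4.

Lemma cos_minus_phase (nu x : R) : cos (x - phase nu) =
  (cos (halfang nu) * (cos x + sin x) + sin (halfang nu) * (sin x - cos x)) / sqrt 2.
Proof.
  unfold phase. replace (x - (halfang nu + PI / 4)) with (x - halfang nu - PI / 4) by ring.
  rewrite cos_shift_quarter, cos_minus, sin_minus. field.
  pose proof (sqrt_lt_R0 2 ltac:(lra)); lra.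
Qed.

Lemma sin_minus_phase (nu x : R) : sin (x - phase nu) =
  (cos (halfang nu) * (sin x - cos x) - sin (halfang nu) * (cos x + sin x)) / sqrt 2.
Proof.
  unfold phase. replace (x - (halfang nu + PI / 4)) with (x - halfang nu - PI / 4) by ring.
  rewrite sin_shift_quarter, cos_minus, sin_minus. field.
  pose proof (sqrt_lt_R0 2 ltac:(lra)); lra.
Qed.

(** Substitutes the limits of [Xc + Xs] and [Xc - Xs] into a combination of the two
    amplitudes. *)
Lemma amplitude_transfer (u v : R) (F : R -> R) :
  vanish (fun x => F x - (u * Xc x + v * Xs x)) ->
  vanish (fun x => F x - / kamp * ((u * (cos x + sin x) + v * (sin x - cos x)) / sqrt 2)).
Proof.
  intros H. destruct amplitudes_infty as [A B].
  pose proof kamp_pos. assert (H2 : 0 < sqrt 2) by (apply sqrt_lt_R0; lra).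
  apply vanish_ext with (X := 0) (f := fun x =>
    1 * (F x - (u * Xc x + v * Xs x)) + 1 *
    ((u + v) / 2 * (Xc x + Xs x - sqrt 2 / kamp * sin x) + (u - v) / 2 * (Xc x - Xs x - sqrt 2 / kamp * cos x))).
  - intros x _.
    replace (/ kamp * ((u * (cos x + sin x) + v * (sin x - cos x)) / sqrt 2))
      with (sqrt 2 / kamp * ((u * (cos x + sin x) + v * (sin x - cos x)) / 2)).
    + field. lra.
    + assert (I2 : / sqrt 2 = sqrt 2 / 2).
      { apply Rmult_eq_reg_l with (sqrt 2); [|lra]. rewrite Rinv_r by lra.
        replace (sqrt 2 * (sqrt 2 / 2)) with (sqrt 2 * sqrt 2 / 2) by field.
        rewrite sqrt_sqrt; lra. }
      unfold Rdiv at 3. rewrite I2. field. lra.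
  - apply vanish_lin; [exact H|]. apply vanish_lin; assumption.
Qed.

Lemma wave_Hr (nu : R) : wave (/ kamp) (phase nu) (Hr nu) (Hr1 nu).
Proof.
  split.
  - eapply vanish_ext; [|apply (amplitude_transfer _ _ _ (Hr_infty nu))].
    intros x _; simpl. rewrite cos_minus_phase. reflexivity.
  - eapply vanish_ext; [|apply (amplitude_transfer _ _ _ (Hr1_infty nu))].
    intros x _; simpl. rewrite sin_minus_phase. field.
    pose proof kamp_pos. pose proof (sqrt_lt_R0 2 ltac:(lra)); lra.
  Unshelve. all: exact 0.
Qed.

Lemma cos_minus_PI2 (y : R) : cos (y - PI / 2) = sin y.
Proof. rewrite cos_minus, cos_PI2, sin_PI2. ring. Qed.

Lemma sin_minus_PI2 (y : R) : sin (y - PI / 2) = - cos y.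
Proof. rewrite sin_minus, cos_PI2, sin_PI2. ring. Qed.

Lemma wave_Hi (nu : R) : wave (/ kamp) (phase nu + PI / 2) (Hi nu) (Hi1 nu).
Proof.
  split.
  - eapply vanish_ext; [|apply (amplitude_transfer _ _ _ (Hi_infty nu))].
    intros x _; simpl.
    replace (x - (phase nu + PI / 2)) with (x - phase nu - PI / 2) by ring.
    rewrite cos_minus_PI2, sin_minus_phase. field.
    pose proof kamp_pos. pose proof (sqrt_lt_R0 2 ltac:(lra)); lra.
  - eapply vanish_ext; [|apply (amplitude_transfer _ _ _ (Hi1_infty nu))].
    intros x _; simpl.
    replace (x - (phase nu + PI / 2)) with (x - phase nu - PI / 2) by ring.
    rewrite sin_minus_PI2, cos_minus_phase. ring.
  Unshelve. all: exact 0.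
Qed.

Lemma wave_wronskian (nu A a B b x : R) (f f1 g g1 : R -> R) : 0 < x ->
  bessel_sol nu f f1 -> bessel_sol nu g g1 ->
  wave A a f f1 -> wave B b g g1 -> wronskian f f1 g g1 x = A * B * sin (b - a).
Proof.
  intros Hx Sf Sg [F F1] [G G1].
  assert (BG : forall C c (h : R -> R), vanish (fun x => sqrt x * h x - C * cos (x - c)) ->
               ebounded (fun x => sqrt x * h x)).
  { intros C c h H. eapply ebounded_close; [|exact H].
    apply ebounded_scal, ebounded_cos_shift. }
  assert (BG1 : forall C c (h : R -> R), vanish (fun x => sqrt x * h x + C * sin (x - c)) ->
               ebounded (fun x => sqrt x * h x)).
  { intros C c h H. eapply ebounded_close with (f := fun x => - C * sin (x - c)).
    - apply ebounded_scal, ebounded_sin_shift.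
    - eapply vanish_ext; [|exact H]. intros; simpl; ring.
    Unshelve. exact 0. }
  assert (V : vanish (fun _ => wronskian f f1 g g1 x - A * B * sin (b - a))).
  { apply vanish_ext with (X := 0) (f := fun t =>
      1 * (1 * ((sqrt t * g1 t) * (sqrt t * f t - A * cos (t - a)))
           + -1 * ((sqrt t * g t) * (sqrt t * f1 t + A * sin (t - a))))
      + 1 * (1 * ((A * cos (t - a)) * (sqrt t * g1 t + B * sin (t - b)))
           + 1 * ((A * sin (t - a)) * (sqrt t * g t - B * cos (t - b))))).
    - intros t Ht.
      rewrite (wronskian_const nu f g f1 g1 x t Sf Sg Hx Ht), wronskian_sqrt by exact Ht.
      replace (b - a) with ((t - a) - (t - b)) by ring. rewrite (sin_minus (t - a)).
      ring.
    - apply vanish_lin; apply vanish_lin; apply vanish_mult; eauto;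
        apply ebounded_scal; auto using ebounded_cos_shift, ebounded_sin_shift. }
  apply vanish_const_eq in V. lra.
Qed.

Lemma wronskian_Hr_Hi (nu x : R) : 0 < x ->
  wronskian (Hr nu) (Hr1 nu) (Hi nu) (Hi1 nu) x = / kamp ^ 2.
Proof.
  intros Hx.
  rewrite (wave_wronskian nu _ _ _ _ x _ _ _ _ Hx (bessel_sol_Hr nu) (bessel_sol_Hi nu)
     (wave_Hr nu) (wave_Hi nu)).
  replace (phase nu + PI / 2 - phase nu) with (PI / 2) by ring.
  rewrite sin_PI2. field. pose proof kamp_pos; lra.
Qed.

(** Cramer's rule for the Hankel pair, whose own Wronskian is [/ kamp ^ 2]. *)
Lemma sol_from_wronskians (nu x : R) (f f1 : R -> R) : 0 < x ->
  f x = kamp ^ 2 * (wronskian f f1 (Hi nu) (Hi1 nu) x * Hr nu x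
                    - wronskian f f1 (Hr nu) (Hr1 nu) x * Hi nu x) /\
  f1 x = kamp ^ 2 * (wronskian f f1 (Hi nu) (Hi1 nu) x * Hr1 nu x
                    - wronskian f f1 (Hr nu) (Hr1 nu) x * Hi1 nu x).
Proof.
  intros Hx. pose proof (wronskian_Hr_Hi nu x Hx) as W. pose proof kamp_pos as K.
  assert (W' : kamp ^ 2 * wronskian (Hr nu) (Hr1 nu) (Hi nu) (Hi1 nu) x = 1)
    by (rewrite W; field; lra).
  split.
  - rewrite <- (Rmult_1_l (f x)), <- W'. unfold wronskian. ring.
  - rewrite <- (Rmult_1_l (f1 x)), <- W'. unfold wronskian. ring.
Qed.

(** Equal asymptotics give equal Wronskians with the Hankel pair. *)
Lemma wave_unique (nu A a x : R) (f f1 g g1 : R -> R) : 0 < x ->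
  bessel_sol nu f f1 -> bessel_sol nu g g1 -> wave A a f f1 -> wave A a g g1 ->
  f x = g x /\ f1 x = g1 x.
Proof.
  intros Hx Sf Sg Wf Wg.
  destruct (sol_from_wronskians nu x f f1 Hx) as [E1 E2].
  destruct (sol_from_wronskians nu x g g1 Hx) as [E3 E4].
  rewrite E1, E2, E3, E4.
  rewrite !(wave_wronskian nu _ _ _ _ x _ _ _ _ Hx Sf (bessel_sol_Hr nu) Wf (wave_Hr nu)),
    !(wave_wronskian nu _ _ _ _ x _ _ _ _ Hx Sf (bessel_sol_Hi nu) Wf (wave_Hi nu)),
    !(wave_wronskian nu _ _ _ _ x _ _ _ _ Hx Sg (bessel_sol_Hr nu) Wg (wave_Hr nu)),
    !(wave_wronskian nu _ _ _ _ x _ _ _ _ Hx Sg (bessel_sol_Hi nu) Wg (wave_Hi nu)).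
  split; reflexivity.
Qed.

Lemma wave_scal (c A a : R) (f f1 g g1 : R -> R) :
  (forall x, 0 < x -> g x = c * f x /\ g1 x = c * f1 x) ->
  wave A a f f1 -> wave (c * A) a g g1.
Proof.
  intros E [F F1]. split.
  - apply vanish_ext with (X := 0) (f := fun x => c * (sqrt x * f x - A * cos (x - a))).
    + intros x Hx. rewrite (proj1 (E x Hx)). ring.
    + apply vanish_mult; [apply ebounded_const|exact F].
  - apply vanish_ext with (X := 0) (f := fun x => c * (sqrt x * f1 x + A * sin (x - a))).
    + intros x Hx. rewrite (proj2 (E x Hx)). ring.
    + apply vanish_mult; [apply ebounded_const|exact F1].
Qed.

(** The Wronskians with [Hr] and [Hi] are 0 and 1, so [J = kamp^2 Hr]. *)
Lemma wave_J_pos (nu : R) : 0 < nu -> wave kamp (phase nu) (bessel_J nu) (bessel_J' nu).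
Proof.
  intros Hn. pose proof kamp_pos as K.
  replace kamp with (kamp ^ 2 * / kamp) at 1 by (field; lra).
  apply wave_scal with (f := Hr nu) (f1 := Hr1 nu); [|apply wave_Hr].
  intros x Hx.
  destruct (sol_from_wronskians nu x (bessel_J nu) (bessel_J' nu) Hx) as [E1 E2].
  rewrite wronskian_J_Hr, wronskian_J_Hi in E1, E2 by assumption.
  rewrite E1, E2. split; ring.
Qed.

(** Up to terms of lower order, lowering the order is a differentiation, that is a
    quarter turn of the phase. *)
Lemma wave_J_down (nu : R) :
  wave kamp (phase nu) (bessel_J nu) (bessel_J' nu) ->
  wave kamp (phase (nu - 1)) (bessel_J (nu - 1)) (bessel_J' (nu - 1)).
Proof.
  intros [F F1].
  assert (Hph : forall x, x - phase (nu - 1) = x - phase nu + PI / 2)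
    by (intros x; unfold phase, halfang; field).
  assert (BF : ebounded (fun x => sqrt x * bessel_J nu x)).
  { eapply ebounded_close; [|exact F]. apply ebounded_scal, ebounded_cos_shift. }
  assert (E0 : forall x, 0 < x -> bessel_J (nu - 1) x = nu / x * bessel_J nu x + bessel_J' nu x).
  { intros x Hx. pose proof (bessel_J_rec nu x Hx) as E. unfold bessel_J'.
    replace (bessel_J (nu + 1) x) with (2 * nu / x * bessel_J nu x - bessel_J (nu - 1) x) by lra.
    field. lra. }
  assert (V : vanish (fun x => sqrt x * bessel_J (nu - 1) x - kamp * cos (x - phase (nu - 1)))).
  { apply vanish_ext with (X := 0) (f := fun x =>
      nu * ((sqrt x * bessel_J nu x) * / x) + 1 * (sqrt x * bessel_J' nu x + kamp * sin (x - phase nu))).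
    - intros x Hx. rewrite E0, Hph by exact Hx. rewrite cos_plus, cos_PI2, sin_PI2. field. lra.
    - apply vanish_lin; [|exact F1]. apply vanish_mult; [exact BF|apply vanish_inv]. }
  split; [exact V|].
  assert (BV : ebounded (fun x => sqrt x * bessel_J (nu - 1) x)).
  { eapply ebounded_close; [|exact V]. apply ebounded_scal, ebounded_cos_shift. }
  apply vanish_ext with (X := 0) (f := fun x =>
      (nu - 1) * ((sqrt x * bessel_J (nu - 1) x) * / x) + -1 * (sqrt x * bessel_J nu x - kamp * cos (x - phase nu))).
  - intros x Hx. rewrite Hph, sin_plus, cos_PI2, sin_PI2. unfold bessel_J'.
    replace (nu - 1 + 1) with nu by ring. field. lra.
  - apply vanish_lin; [|exact F]. apply vanish_mult; [exact BV|apply vanish_inv].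
Qed.

Lemma wave_J (nu : R) : wave kamp (phase nu) (bessel_J nu) (bessel_J' nu).
Proof.
  destruct (nfloor_ex (Rabs nu)) as [N HN]; [apply Rabs_pos|].
  assert (H : 0 < nu + INR (S N)) by (rewrite S_INR; pose proof (Rabs_maj2 nu); lra).
  revert H; generalize (S N) as m; clear N HN; intros m; revert nu.
  induction m as [|m IH]; intros nu Hm.
  - apply wave_J_pos. simpl in Hm; lra.
  - replace nu with (nu + 1 - 1) by ring. apply wave_J_down, IH.
    rewrite S_INR in Hm. lra.
Qed.

(** * The function of the second kind *)

Lemma bessel_sol_opp (nu : R) (f f1 : R -> R) : bessel_sol (- nu) f f1 -> bessel_sol nu f f1.
Proof.
  intros H x Hx. destruct (H x Hx) as [A B]. split; [exact A|].
  replace (nu ^ 2) with ((- nu) ^ 2) by ring. exact B.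
Qed.

(** Both sides solve Bessel's equation and have the same asymptotics: the addition
    formula turns the combination of the phases of [J mu] and [J (- mu)] into a
    quarter turn. *)
Lemma Y_nonint (mu x : R) : sin (mu * PI) <> 0 -> 0 < x ->
  bessel_Y_nonint mu x = kamp ^ 2 * Hi mu x.
Proof.
  intros Hs Hx. pose proof kamp_pos as K.
  set (s := sin (mu * PI)) in *. set (c := cos (mu * PI)).
  set (f := fun x => c / s * bessel_J mu x + - / s * bessel_J (- mu) x).
  set (f1 := fun x => c / s * bessel_J' mu x + - / s * bessel_J' (- mu) x).
  assert (Sf : bessel_sol mu f f1).
  { apply bessel_sol_lin; [apply bessel_sol_J|]. apply bessel_sol_opp, bessel_sol_J. }
  set (g := fun x => kamp ^ 2 * Hi mu x + 0 * Hi mu x).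
  set (g1 := fun x => kamp ^ 2 * Hi1 mu x + 0 * Hi1 mu x).
  assert (Sg : bessel_sol mu g g1).
  { apply bessel_sol_lin; apply bessel_sol_Hi. }
  assert (Wg : wave kamp (phase mu + PI / 2) g g1).
  { replace kamp with (kamp ^ 2 * / kamp) at 1 by (field; lra).
    apply wave_scal with (f := Hi mu) (f1 := Hi1 mu); [|apply wave_Hi].
    intros t _; unfold g, g1; split; ring. }
  assert (Ph : forall t, t - phase (- mu) = t - phase mu + mu * PI)
    by (intros t; unfold phase, halfang; field).
  assert (Wf : wave kamp (phase mu + PI / 2) f f1).
  { destruct (wave_J mu) as [A A1]. destruct (wave_J (- mu)) as [B B1]. split.
    - apply vanish_ext with (X := 0) (f := fun t =>
        c / s * (sqrt t * bessel_J mu t - kamp * cos (t - phase mu))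
        + - / s * (sqrt t * bessel_J (- mu) t - kamp * cos (t - phase (- mu)))).
      + intros t _. unfold f. rewrite Ph, cos_plus. fold s c.
        replace (t - (phase mu + PI / 2)) with (t - phase mu - PI / 2) by ring.
        rewrite cos_minus_PI2. field. exact Hs.
      + apply vanish_lin; assumption.
    - apply vanish_ext with (X := 0) (f := fun t =>
        c / s * (sqrt t * bessel_J' mu t + kamp * sin (t - phase mu))
        + - / s * (sqrt t * bessel_J' (- mu) t + kamp * sin (t - phase (- mu)))).
      + intros t _. unfold f1. rewrite Ph, sin_plus. fold s c.
        replace (t - (phase mu + PI / 2)) with (t - phase mu - PI / 2) by ring.
        rewrite sin_minus_PI2. field. exact Hs.
      + apply vanish_lin; assumption. }
  destruct (wave_unique mu _ _ x f f1 g g1 Hx Sf Sg Wf Wg) as [E _].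
  unfold f, g in E. unfold bessel_Y_nonint. fold s c.
  replace (kamp ^ 2 * Hi mu x) with (kamp ^ 2 * Hi mu x + 0 * Hi mu x) by ring.
  rewrite <- E. field. exact Hs.
Qed.

Lemma continuous_of_lipschitz (f : R -> R) (a M : R) :
  (forall b, Rabs (b - a) <= 1 -> Rabs (f b - f a) <= Rabs (b - a) * M) -> continuity_pt f a.
Proof.
  intros H eps He.
  set (M' := Rmax M 0 + 1).
  assert (HM : 0 < M') by (unfold M'; pose proof (Rmax_r M 0); lra).
  exists (Rmin 1 (eps / M')). split.
  - apply Rmin_glb_lt; [lra|apply Rdiv_lt_0_compat; assumption].
  - intros b [_ Hb]. simpl in *. unfold Rdist in *.
    pose proof (Rlt_le_trans _ _ _ Hb (Rmin_l _ _)) as B1.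
    pose proof (Rlt_le_trans _ _ _ Hb (Rmin_r _ _)) as B2.
    apply Rlt_div_r in B2; [|exact HM].
    eapply Rle_lt_trans; [apply H; lra|].
    assert (M <= M') by (unfold M'; pose proof (Rmax_l M 0); lra).
    pose proof (Rabs_pos (b - a)). nra.
Qed.

Lemma Rabs_cos_diff (a b : R) : Rabs (cos a - cos b) <= Rabs (a - b).
Proof.
  destruct (MVT_gen cos b a (fun t => - sin t)) as [c [_ E]].
  - intros; apply is_derive_cos.
  - intros x _; apply (derive_cont_pt cos x (- sin x)), is_derive_cos.
  - rewrite E, Rabs_mult, Rabs_Ropp. pose proof (Rabs_sin c). pose proof (Rabs_pos (a - b)). nra.
Qed.

Lemma continuity_osc_order (k : R -> R) (x nu : R) :
  (forall y, continuous k y) -> (forall y, Rabs (k y) <= 1) ->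
  continuity_pt (fun mu => osc (cosw mu) k x) nu.
Proof.
  intros Ck Bk. apply continuous_of_lipschitz with (M := 2 * 2).
  intros mu _. rewrite <- osc_minus by (try apply continuous_cos_lin; exact Ck).
  pose proof PI_RGT_0. pose proof PI_4. unfold osc.
  apply Rle_trans with (Rabs (mu - nu) * 2 * (PI / 2 - 0)).
  - apply RInt_abs_le; [lra| |].
    + intros s. apply (continuous_osc_integrand (fun s => cosw mu s - cosw nu s) k); [|exact Ck].
      intros t. apply continuous_minus_R; apply continuous_cos_lin.
    + intros s Hs. rewrite Rabs_mult.
      rewrite <- (Rmult_1_r (Rabs (mu - nu) * 2)).
      apply Rmult_le_compat; try apply Rabs_pos; [|apply Bk].
      unfold cosw. eapply Rle_trans; [apply Rabs_cos_diff|].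
      replace (mu * s - nu * s) with ((mu - nu) * s) by ring.
      rewrite Rabs_mult, (Rabs_right s) by lra.
      apply Rmult_le_compat_l; [apply Rabs_pos|lra].
  - rewrite Rmult_assoc. apply Rmult_le_compat_l; [apply Rabs_pos|lra].
Qed.

Lemma continuity_dint_order (x nu : R) : 0 < x -> continuity_pt (fun mu => dint mu x) nu.
Proof.
  intros Hx. apply continuous_of_lipschitz with (M := dint (nu + 2) x).
  intros mu Hm. apply dint_lipschitz; assumption.
Qed.

Lemma continuity_smooth (f : R -> R) (x : R) : ex_derive f x -> continuity_pt f x.
Proof. intros [l H]. exact (derive_cont_pt f x l H). Qed.

Lemma continuity_Hi_order (x nu : R) : 0 < x -> continuity_pt (fun mu => Hi mu x) nu.
Proof.
  intros Hx. unfold Hi.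
  apply (continuity_pt_minus (fun mu => _ - _) (fun mu => / 2 * dint mu x)).
  - apply (continuity_pt_minus (fun mu => _ + _) (fun mu => / 2 * cos (mu * PI) * dint (- mu) x)).
    + apply (continuity_pt_plus (fun mu => - sin (halfang mu) * Ec mu x)
               (fun mu => cos (halfang mu) * Es mu x)).
      * apply (continuity_pt_mult (fun mu => - sin (halfang mu)) (fun mu => Ec mu x)).
        -- apply continuity_smooth. unfold halfang. auto_derive. exact I.
        -- apply (continuity_osc_order cos); [apply continuous_cos|apply Rabs_cos].
      * apply (continuity_pt_mult (fun mu => cos (halfang mu)) (fun mu => Es mu x)).
        -- apply continuity_smooth. unfold halfang. auto_derive. exact I.
        -- apply (continuity_osc_order sin); [apply continuous_sin|apply Rabs_sin].
    + apply (continuity_pt_mult (fun mu => / 2 * cos (mu * PI)) (fun mu => dint (- mu) x)).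
      * apply continuity_smooth. auto_derive. exact I.
      * apply (continuity_pt_comp (fun mu => - mu) (fun mu => dint mu x)).
        -- apply continuity_smooth. auto_derive. exact I.
        -- apply continuity_dint_order, Hx.
  - apply (continuity_pt_mult (fun _ => / 2) (fun mu => dint mu x)).
    + apply continuity_smooth. auto_derive. exact I.
    + apply continuity_dint_order, Hx.
Qed.

(** At integer orders the defining limit is computed by the continuity of the
    integral representation in the order. *)
Lemma bessel_Y_eq (nu x : R) : 0 < x -> bessel_Y nu x = kamp ^ 2 * Hi nu x.
Proof.
  intros Hx. unfold bessel_Y.
  destruct (Req_EM_T (sin (nu * PI)) 0) as [Z|Z]; [|apply Y_nonint; assumption].
  assert (L : is_lim (fun mu => bessel_Y_nonint mu x) nu (kamp ^ 2 * Hi nu x)).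
  { apply is_lim_ext_loc with (f := fun mu => kamp ^ 2 * Hi mu x).
    - exists (mkposreal 1 Rlt_0_1). intros mu Hb Hne. symmetry. apply Y_nonint; [|exact Hx].
      unfold ball in Hb; simpl in Hb; unfold AbsRing_ball, abs, minus, plus, opp in Hb; simpl in Hb.
      apply Rabs_lt_between in Hb.
      replace (mu * PI) with (nu * PI + (mu - nu) * PI) by ring.
      rewrite sin_plus, Z, Rmult_0_l, Rplus_0_l.
      pose proof PI_RGT_0 as HP.
      apply Rmult_integral_contrapositive_currified.
      + intros C. pose proof (sin2_cos2 (nu * PI)) as T. rewrite Z, C in T. unfold Rsqr in T. lra.
      + intros C. destruct (Rtotal_order (mu - nu) 0) as [H|[H|H]].
        * assert (0 < sin (- ((mu - nu) * PI))) by (apply sin_gt_0; nra).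
          rewrite sin_neg in *. lra.
        * apply Hne. lra.
        * assert (0 < sin ((mu - nu) * PI)) by (apply sin_gt_0; nra). lra.
    - apply (is_lim_continuity (fun mu => kamp ^ 2 * Hi mu x)).
      apply (continuity_pt_mult (fun _ => kamp ^ 2) (fun mu => Hi mu x)).
      + apply continuity_smooth. auto_derive. exact I.
      + apply continuity_Hi_order, Hx. }
  apply is_lim_unique in L. rewrite L. reflexivity.
Qed.

Definition bessel_Y' (nu x : R) : R := kamp ^ 2 * Hi1 nu x.

Lemma bessel_sol_Y (nu : R) : bessel_sol nu (bessel_Y nu) (bessel_Y' nu).
Proof.
  apply bessel_sol_ext with (f := fun x => kamp ^ 2 * Hi nu x + 0 * Hi nu x)
    (g := fun x => kamp ^ 2 * Hi1 nu x + 0 * Hi1 nu x).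
  - intros x Hx. rewrite bessel_Y_eq by exact Hx. ring.
  - intros x Hx. unfold bessel_Y'. ring.
  - apply bessel_sol_lin; apply bessel_sol_Hi.
Qed.

Lemma wave_Y (nu : R) : wave kamp (phase nu + PI / 2) (bessel_Y nu) (bessel_Y' nu).
Proof.
  pose proof kamp_pos as K.
  replace kamp with (kamp ^ 2 * / kamp) at 1 by (field; lra).
  apply wave_scal with (f := Hi nu) (f1 := Hi1 nu); [|apply wave_Hi].
  intros x Hx. split; [apply bessel_Y_eq, Hx|reflexivity].
Qed.

Lemma wronskian_J_Y (nu x : R) : 0 < x ->
  wronskian (bessel_J nu) (bessel_J' nu) (bessel_Y nu) (bessel_Y' nu) x = kamp ^ 2.
Proof.
  intros Hx.
  rewrite (wave_wronskian nu _ _ _ _ x _ _ _ _ Hx (bessel_sol_J nu) (bessel_sol_Y nu)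
     (wave_J nu) (wave_Y nu)).
  replace (phase nu + PI / 2 - phase nu) with (PI / 2) by ring.
  rewrite sin_PI2. ring.
Qed.

(** * Continuous angles *)

Lemma ivt (f : R -> R) (x y c : R) :
  (forall t, Rmin x y <= t <= Rmax x y -> continuity_pt f t) ->
  f x < c < f y -> exists z, Rmin x y <= z <= Rmax x y /\ f z = c.
Proof.
  intros Hf [H1 H2].
  assert (C : forall s t, Rmin x y <= t <= Rmax x y ->
     continuity_pt (fun t => s * (f t - c)) t).
  { intros s t Ht. apply (continuity_pt_mult (fun _ => s) (fun t => f t - c)).
    - apply continuity_smooth. auto_derive. exact I.
    - apply (continuity_pt_minus f (fun _ => c)); [apply Hf, Ht|].
      apply continuity_smooth. auto_derive. exact I. }
  destruct (Rtotal_order x y) as [L|[L|L]].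
  - rewrite Rmin_left, Rmax_right in * by lra.
    destruct (Ranalysis5.IVT_interv (fun t => 1 * (f t - c)) x y) as [z [Hz E]];
      [intros; apply C; assumption|exact L|lra|lra|].
    exists z; split; [exact Hz|lra].
  - subst y. lra.
  - rewrite Rmin_right, Rmax_left in * by lra.
    destruct (Ranalysis5.IVT_interv (fun t => (-1) * (f t - c)) y x) as [z [Hz E]];
      [intros; apply C; assumption|exact L|lra|lra|].
    exists z; split; [exact Hz|lra].
Qed.

Lemma trapped (f : R -> R) (a lo hi x0 x : R) :
  (forall t, a < t -> continuity_pt f t) -> a < x0 -> a < x ->
  (forall t, Rmin x0 x <= t <= Rmax x0 x -> f t <> lo /\ f t <> hi) ->
  lo < f x0 < hi -> lo < f x < hi.
Proof.
  intros C H0 Hx Hne Hf.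
  assert (Hmin : forall t, Rmin x0 x <= t -> a < t).
  { intros t Ht. eapply Rlt_le_trans; [|exact Ht]. apply Rmin_glb_lt; assumption. }
  assert (Hx0 : Rmin x0 x <= x <= Rmax x0 x) by (split; [apply Rmin_r|apply Rmax_r]).
  split.
  - destruct (Rtotal_order lo (f x)) as [L|[L|L]]; [exact L| |].
    + exfalso. apply (proj1 (Hne x Hx0)). auto.
    + exfalso. rewrite Rmin_comm, Rmax_comm in Hne. rewrite Rmin_comm in Hmin.
      destruct (ivt f x x0 lo) as [z [Hz E]].
      * intros t Ht. apply C, Hmin, Ht.
      * lra.
      * apply (proj1 (Hne z Hz)), E.
  - destruct (Rtotal_order (f x) hi) as [L|[L|L]]; [exact L| |].
    + exfalso. apply (proj2 (Hne x Hx0)). auto.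
    + exfalso.
      destruct (ivt f x0 x hi) as [z [Hz E]].
      * intros t Ht. apply C, Hmin, Ht.
      * lra.
      * apply (proj2 (Hne z Hz)), E.
Qed.

(** The angle [z] is the integral of the angular velocity.  In the frame rotated by
    [z] both components of the curve obey the same linear equation as its modulus,
    so their quotients by the modulus are constant. *)
Lemma angle_lift (a x0 t0 : R) (P S P1 S1 : R -> R) : a < x0 ->
  (forall x, a < x -> is_derive P x (P1 x)) -> (forall x, a < x -> is_derive S x (S1 x)) ->
  (forall x, a < x -> continuity_pt P1 x) -> (forall x, a < x -> continuity_pt S1 x) ->
  (forall x, a < x -> 0 < P x ^ 2 + S x ^ 2) ->
  P x0 = sqrt (P x0 ^ 2 + S x0 ^ 2) * cos t0 -> S x0 = sqrt (P x0 ^ 2 + S x0 ^ 2) * sin t0 ->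
  exists z, z x0 = t0 /\ forall x, a < x ->
    is_derive z x ((P x * S1 x - P1 x * S x) / (P x ^ 2 + S x ^ 2)) /\
    P x = sqrt (P x ^ 2 + S x ^ 2) * cos (z x) /\ S x = sqrt (P x ^ 2 + S x ^ 2) * sin (z x).
Proof.
  intros H0 DP DS CP CS HN E1 E2.
  set (N := fun x => P x ^ 2 + S x ^ 2) in *.
  set (w := fun x => (P x * S1 x - P1 x * S x) / N x).
  assert (CP0 : forall x, a < x -> continuity_pt P x)
    by (intros x Hx; exact (derive_cont_pt P x _ (DP x Hx))).
  assert (CS0 : forall x, a < x -> continuity_pt S x)
    by (intros x Hx; exact (derive_cont_pt S x _ (DS x Hx))).
  assert (DN : forall x, a < x -> is_derive N x (2 * (P x * P1 x + S x * S1 x))).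
  { intros x Hx. apply (derive_ext (fun x => P x * P x + S x * S x)); [intros; unfold N; ring|].
    eapply derive_eq; [apply derive_plus; apply derive_mult; auto|ring]. }
  assert (Cw : forall x, a < x -> continuous w x).
  { intros x Hx. apply continuity_pt_filterlim. unfold w.
    apply (continuity_pt_div (fun x => P x * S1 x - P1 x * S x) N).
    - apply (continuity_pt_minus (fun x => P x * S1 x) (fun x => P1 x * S x)).
      + apply (continuity_pt_mult P S1); auto.
      + apply (continuity_pt_mult P1 S); auto.
    - exact (derive_cont_pt N x _ (DN x Hx)).
    - specialize (HN x Hx). unfold N in *; lra. }
  set (z := fun x => t0 + RInt w x0 x).
  assert (Dz : forall x, a < x -> is_derive z x (w x)).
  { intros x Hx. replace (w x) with (0 + w x) by ring.
    apply (derive_plus (fun _ => t0) (RInt w x0)); [apply derive_const|].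
    apply (is_derive_RInt w (RInt w x0) x0 x).
    - assert (L : locally x (fun t => a < t)) by (apply (open_gt a); exact Hx).
      eapply filter_imp; [|exact L]. intros t Ht. apply (RInt_correct w).
      apply (ex_RInt_continuous w). intros s Hs. apply Cw.
      eapply Rlt_le_trans; [|apply Hs]. apply Rmin_glb_lt; assumption.
    - apply Cw, Hx. }
  assert (z0 : z x0 = t0).
  { unfold z. rewrite RInt_point. unfold zero; simpl. Rring. }
  assert (HNx : forall x, a < x -> 0 < N x) by exact HN.
  assert (Dr : forall x, a < x ->
     is_derive (fun x => sqrt (N x)) x ((P x * P1 x + S x * S1 x) / sqrt (N x))).
  { intros x Hx. pose proof (sqrt_lt_R0 _ (HNx x Hx)).
    eapply derive_eq; [apply (derive_comp sqrt N); [apply derive_sqrt, HNx, Hx|apply DN, Hx]|].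
    field. lra. }
  set (A := fun x => (P x * cos (z x) + S x * sin (z x)) / sqrt (N x)).
  set (B := fun x => (P x * sin (z x) - S x * cos (z x)) / sqrt (N x)).
  assert (Dc : forall x, a < x -> is_derive (fun x => cos (z x)) x (- sin (z x) * w x))
    by (intros x Hx; apply derive_comp; [apply is_derive_cos|apply Dz, Hx]).
  assert (Ds : forall x, a < x -> is_derive (fun x => sin (z x)) x (cos (z x) * w x))
    by (intros x Hx; apply derive_comp; [apply is_derive_sin|apply Dz, Hx]).
  assert (Sq : forall x, a < x -> sqrt (N x) ^ 2 = P x ^ 2 + S x ^ 2).
  { intros x Hx. rewrite pow2_sqrt; [reflexivity|left; apply HNx, Hx]. }
  (* Both components satisfy the same linear equation as the modulus. *)
  set (lam := fun x => (P x * P1 x + S x * S1 x) / N x).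
  assert (Dq : forall F x, a < x -> is_derive F x (lam x * F x) ->
     is_derive (fun x => F x / sqrt (N x)) x 0).
  { intros F x Hx HF. pose proof (sqrt_lt_R0 _ (HNx x Hx)) as Hs.
    eapply derive_eq; [apply derive_div; [lra|exact HF|apply Dr, Hx]|].
    unfold lam. replace (N x) with (sqrt (N x) ^ 2) at 1 by (apply Sq, Hx). field. lra. }
  assert (HA : forall x, a < x -> A x = 1).
  { intros x Hx. transitivity (A x0).
    - apply (const_of_derive_0 A a); try assumption. intros t Ht.
      apply (Dq (fun x => P x * cos (z x) + S x * sin (z x)) t Ht).
      eapply derive_eq; [apply derive_plus; apply derive_mult; auto|].
      pose proof (HNx t Ht) as HN0. unfold lam, w, N in *. field. lra.
    - unfold A. rewrite z0. pose proof (sqrt_lt_R0 _ (HNx x0 H0)) as Hs.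
      unfold N in *. rewrite E1 at 1. rewrite E2 at 2.
      replace (sqrt (P x0 ^ 2 + S x0 ^ 2) * cos t0 * cos t0 + sqrt (P x0 ^ 2 + S x0 ^ 2) * sin t0 * sin t0)
        with (sqrt (P x0 ^ 2 + S x0 ^ 2) * (sin t0 ^ 2 + cos t0 ^ 2)) by ring.
      rewrite sin_cos_sqr. field. lra. }
  assert (HB : forall x, a < x -> B x = 0).
  { intros x Hx. transitivity (B x0).
    - apply (const_of_derive_0 B a); try assumption. intros t Ht.
      apply (Dq (fun x => P x * sin (z x) - S x * cos (z x)) t Ht).
      eapply derive_eq; [apply derive_minus; apply derive_mult; auto|].
      pose proof (HNx t Ht) as HN0. unfold lam, w, N in *. field. lra.
    - unfold B. rewrite z0. pose proof (sqrt_lt_R0 _ (HNx x0 H0)) as Hs.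
      unfold N in *. rewrite E1 at 1. rewrite E2 at 2. field. lra. }
  exists z. split; [exact z0|]. intros x Hx.
  pose proof (sqrt_lt_R0 _ (HNx x Hx)) as Hs.
  assert (A1 : P x * cos (z x) + S x * sin (z x) = sqrt (N x)).
  { pose proof (HA x Hx) as E. unfold A in E. apply Rmult_eq_reg_r with (/ sqrt (N x));
      [|apply Rinv_neq_0_compat; lra]. rewrite Rinv_r by lra. exact E. }
  assert (B1 : P x * sin (z x) - S x * cos (z x) = 0).
  { pose proof (HB x Hx) as E. unfold B in E. apply Rmult_eq_reg_r with (/ sqrt (N x));
      [|apply Rinv_neq_0_compat; lra]. rewrite Rmult_0_l. exact E. }
  split; [exact (Dz x Hx)|]. fold (N x). rewrite <- A1.
  pose proof (sin_cos_sqr (z x)) as T. split.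
  - transitivity ((P x * cos (z x) + S x * sin (z x)) * cos (z x)
      + (P x * sin (z x) - S x * cos (z x)) * sin (z x)); [|rewrite B1; ring].
    transitivity (P x * (sin (z x) ^ 2 + cos (z x) ^ 2)); [rewrite T; ring|ring].
  - transitivity ((P x * cos (z x) + S x * sin (z x)) * sin (z x)
      - (P x * sin (z x) - S x * cos (z x)) * cos (z x)); [|rewrite B1; ring].
    transitivity (S x * (sin (z x) ^ 2 + cos (z x) ^ 2)); [rewrite T; ring|ring].
Qed.

(** * Comparison of phases *)

Lemma vanish_sqrt_sub (N : R -> R) (k : R) : 0 < k -> (forall x, 0 < x -> 0 <= N x) ->
  vanish (fun x => N x - k ^ 2) -> vanish (fun x => sqrt (N x) - k).
Proof.
  intros Hk HN V.
  apply vanish_le with (g := fun x => / k * (N x - k ^ 2)) (X := 0).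
  - intros x Hx. specialize (HN x Hx). pose proof (sqrt_pos (N x)) as Hs.
    rewrite Rabs_mult, (Rabs_right (/ k)) by (left; apply Rinv_0_lt_compat, Hk).
    replace (N x - k ^ 2) with ((sqrt (N x) - k) * (sqrt (N x) + k))
      by (rewrite <- (pow2_sqrt (N x)) at 3 by exact HN; ring).
    rewrite Rabs_mult, (Rabs_right (sqrt (N x) + k)) by lra.
    pose proof (Rabs_pos (sqrt (N x) - k)) as Hp.
    assert (1 <= / k * (sqrt (N x) + k)).
    { rewrite Rmult_plus_distr_l, Rinv_l by lra.
      assert (0 <= / k * sqrt (N x)) by (apply Rmult_le_pos; [left; apply Rinv_0_lt_compat, Hk|exact Hs]).
      lra. }
    nra.
  - apply vanish_mult; [apply ebounded_const|exact V].
Qed.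

(** Comparing squared norms shows that both moduli tend to [k]; after division by
    them both unit vectors approach [(cos g, sin g)]. *)
Lemma angles_close (k : R) (A B eta u g : R -> R) : 0 < k ->
  vanish (fun x => A x * cos (eta x) - k * cos (g x)) ->
  vanish (fun x => A x * sin (eta x) - k * sin (g x)) ->
  vanish (fun x => B x * cos (u x) - k * cos (g x)) ->
  vanish (fun x => B x * sin (u x) - k * sin (g x)) ->
  (forall x, 0 <= A x) -> (forall x, 0 <= B x) ->
  vanish (fun x => cos (eta x - u x) - 1).
Proof.
  intros Hk A1 A2 B1 B2 HA HB.
  assert (BC : forall h : R -> R, ebounded (fun x => k * cos (h x)))
    by (intros h; apply ebounded_scal, ebounded_le1; intros; apply Rabs_cos).
  assert (BS : forall h : R -> R, ebounded (fun x => k * sin (h x)))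
    by (intros h; apply ebounded_scal, ebounded_le1; intros; apply Rabs_sin).
  (* The moduli converge to [k]. *)
  assert (M : forall C v, (forall x, 0 <= C x) ->
     vanish (fun x => C x * cos (v x) - k * cos (g x)) ->
     vanish (fun x => C x * sin (v x) - k * sin (g x)) -> vanish (fun x => C x - k)).
  { intros C v HC V1 V2.
    assert (K1 : ebounded (fun x => C x * cos (v x))) by (eapply ebounded_close; [apply (BC g)|exact V1]).
    assert (K2 : ebounded (fun x => C x * sin (v x))) by (eapply ebounded_close; [apply (BS g)|exact V2]).
    apply vanish_ext with (X := 0) (f := fun x => sqrt (C x ^ 2) - k).
    { intros x _. rewrite sqrt_pow2 by apply HC. reflexivity. }
    apply vanish_sqrt_sub; [exact Hk|intros; apply pow2_ge_0|].
    apply vanish_ext with (X := 0) (f := fun x =>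
      1 * ((C x * cos (v x) + k * cos (g x)) * (C x * cos (v x) - k * cos (g x)))
      + 1 * ((C x * sin (v x) + k * sin (g x)) * (C x * sin (v x) - k * sin (g x)))).
    - intros x _. pose proof (sin_cos_sqr (v x)) as T1. pose proof (sin_cos_sqr (g x)) as T2.
      transitivity (C x ^ 2 * (sin (v x) ^ 2 + cos (v x) ^ 2) - k ^ 2 * (sin (g x) ^ 2 + cos (g x) ^ 2));
        [ring|]. rewrite T1, T2; ring.
    - apply vanish_lin; apply vanish_mult; try apply ebounded_plus; auto. }
  assert (VA : vanish (fun x => A x - k)) by (eapply M; eauto).
  assert (VB : vanish (fun x => B x - k)) by (eapply M; eauto).
  (* Hence both unit vectors converge. *)
  assert (U : forall C (t : R -> R) (t0 : R -> R), (forall x, Rabs (t x) <= 1) ->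
     vanish (fun x => C x - k) -> vanish (fun x => C x * t x - k * t0 x) ->
     vanish (fun x => t x - t0 x)).
  { intros C t t0 Ht VC V.
    apply vanish_ext with (X := 0) (f := fun x => / k * (C x * t x - k * t0 x) + - / k * (t x * (C x - k))).
    - intros x _. field. lra.
    - apply vanish_lin; [exact V|]. apply vanish_mult; [apply ebounded_le1, Ht|exact VC]. }
  assert (C1 := U A _ _ (fun x => Rabs_cos (eta x)) VA A1).
  assert (C2 := U A _ _ (fun x => Rabs_sin (eta x)) VA A2).
  assert (C3 := U B _ _ (fun x => Rabs_cos (u x)) VB B1).
  assert (C4 := U B _ _ (fun x => Rabs_sin (u x)) VB B2).
  simpl in C1, C2, C3, C4.
  apply vanish_ext with (X := 0) (f := fun x =>
    1 * (1 * (cos (u x) * (cos (eta x) - cos (g x))) + 1 * (cos (g x) * (cos (u x) - cos (g x))))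
    + 1 * (1 * (sin (u x) * (sin (eta x) - sin (g x))) + 1 * (sin (g x) * (sin (u x) - sin (g x))))).
  - intros x _. rewrite cos_minus. pose proof (sin_cos_sqr (g x)) as T.
    transitivity (cos (eta x) * cos (u x) + sin (eta x) * sin (u x) - (sin (g x) ^ 2 + cos (g x) ^ 2));
      [ring|]. rewrite T; ring.
  - apply vanish_lin; apply vanish_lin; apply vanish_mult; try assumption;
      apply ebounded_le1; intros; auto using Rabs_cos, Rabs_sin.
Qed.

Lemma small_of_cos (f : R -> R) (X : R) :
  (forall x, X < x -> - PI < f x < PI) -> vanish (fun x => cos (f x) - 1) -> vanish f.
Proof.
  intros Hf V. pose proof PI_RGT_0 as HP.
  rewrite vanish_spec in *. intros eps He.
  set (e := Rmin eps (PI / 2)).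
  assert (He1 : 0 < e <= PI / 2) by (split; [apply Rmin_glb_lt; lra|apply Rmin_r]).
  assert (Hc : cos e < 1) by (rewrite <- cos_0; apply cos_decreasing_1; lra).
  destruct (V (1 - cos e)) as [Y HY]; [lra|].
  exists (Rmax X Y). intros x Hx. pose proof (Rmax_l X Y). pose proof (Rmax_r X Y).
  specialize (HY x ltac:(lra)). specialize (Hf x ltac:(lra)).
  apply Rabs_lt_between in HY.
  apply Rlt_le_trans with e; [|apply Rmin_l].
  destruct (Rlt_le_dec (Rabs (f x)) e) as [L|L]; [exact L|].
  exfalso.
  assert (E : cos (f x) = cos (Rabs (f x))).
  { unfold Rabs. destruct (Rcase_abs (f x)); [rewrite cos_neg; reflexivity|reflexivity]. }
  assert (Rabs (f x) <= PI) by (apply Rabs_le; lra).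
  assert (cos (Rabs (f x)) <= cos e) by (apply cos_decr_1; lra).
  lra.
Qed.

(** A monotone function that attains its limit is constant from there on. *)
Lemma monotone_limit (f g : R -> R) (x0 L : R) :
  (forall x, x0 <= x -> is_derive f x (g x)) -> (forall x, x0 <= x -> g x <= 0) ->
  ~ (forall x, x0 < x -> g x = 0) -> vanish (fun x => f x - L) -> L < f x0.
Proof.
  intros D G N V.
  assert (Dec : forall x y, x0 <= x -> x <= y -> f y <= f x).
  { intros x y Hx Hy. apply Ropp_le_cancel.
    apply (increasing_of_derive (fun t => - f t) (fun t => - g t)); [exact Hy| |].
    - intros t Ht. apply (is_derive_opp f). apply D; lra.
    - intros t Ht. specialize (G t ltac:(lra)). lra. }
  assert (Low : forall x, x0 <= x -> L <= f x).
  { intros x Hx. apply Rnot_lt_le; intros Hlt. rewrite vanish_spec in V.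
    destruct (V (L - f x)) as [X HX]; [lra|].
    set (y := Rmax x X + 1). pose proof (Rmax_l x X). pose proof (Rmax_r x X).
    specialize (HX y ltac:(unfold y; lra)). apply Rabs_lt_between in HX.
    specialize (Dec x y Hx ltac:(unfold y; lra)). lra. }
  destruct (Rle_lt_or_eq_dec L (f x0) (Low x0 (Rle_refl _))) as [H|H]; [exact H|].
  exfalso. apply N. intros x Hx.
  assert (E : forall t, x0 <= t -> f t = L).
  { intros t Ht. apply Rle_antisym; [|apply Low, Ht]. rewrite H. apply Dec; lra. }
  assert (D0 : is_derive f x 0).
  { eapply is_derive_ext_loc; [|apply (is_derive_const L x)].
    eapply filter_imp; [|apply (open_gt x0 x Hx)]. intros t Ht. symmetry. apply E. simpl in Ht; lra. }
  pose proof (is_derive_unique f x _ D0) as U1.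
  pose proof (is_derive_unique f x _ (D x ltac:(lra))) as U2. lra.
Qed.

(** Sturm comparison anchored at infinity.  The pair [(psi, ka)] encodes the
    equation [w'' + (psi^2 + ka1 - ka^2) w = 0], whose solutions are
    [psi^(-1/2) cos (th2 - al)].  A solution [z] of the first equation vanishing
    at [x0] is written in polar coordinates adapted to the second one; the
    resulting angle minus [th2] is monotone, agrees with [th - th2] at [x0] and,
    since both angles cross the multiples of [PI] shifted by [PI/2] together, has
    the same limit. *)
Lemma phase_shift (a k ph K L : R) (q1 u u1 y y1 rho th th2 psi ka ka1 : R -> R) (x0 : R) :
  0 <= a -> 0 < k -> 0 < K -> a < x0 ->
  (forall x, a < x -> is_derive u x (u1 x) /\ is_derive u1 x (- (q1 x * u x))) ->
  (forall x, a < x -> is_derive y x (y1 x) /\ is_derive y1 x (- (q1 x * y x))) ->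
  (forall x, a < x -> u x * y1 x - u1 x * y x = K) ->
  (forall x, a < x -> 0 < rho x /\ u x = rho x * cos (th x) /\ y x = rho x * sin (th x)) ->
  (forall x, a < x -> continuity_pt th x) ->
  (forall x, a < x -> continuity_pt q1 x) ->
  vanish (fun x => u x - k * cos (x - ph)) -> vanish (fun x => u1 x + k * sin (x - ph)) ->
  vanish (fun x => y x - k * sin (x - ph)) -> vanish (fun x => y1 x - k * cos (x - ph)) ->
  (forall x, a < x -> is_derive th2 x (psi x) /\ is_derive psi x (2 * ka x * psi x) /\
     is_derive ka x (ka1 x) /\ continuity_pt ka1 x /\ 0 < psi x) ->
  vanish (fun x => psi x - 1) -> vanish ka ->
  vanish (fun x => th x - th2 x - L) ->
  exists z w, z x0 = th x0 - th2 x0 /\ vanish (fun x => z x - L) /\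
    (forall x, a < x -> 0 <= w x /\ is_derive z x ((q1 x - (psi x ^ 2 + ka1 x - ka x ^ 2)) * w x)) /\
    ~ (forall x, x0 < x -> w x = 0).
Proof.
  intros Ha Hk HK H0 Du Dy HW Hth Cth Cq Vu Vu1 Vy Vy1 D2 Vpsi Vka VL.
  set (al := th x0 - PI / 2).
  set (z := fun x => cos al * u x + sin al * y x).
  set (z1 := fun x => cos al * u1 x + sin al * y1 x).
  set (zp := fun x => - sin al * u x + cos al * y x).
  set (zp1 := fun x => - sin al * u1 x + cos al * y1 x).
  set (s := fun x => - (z1 x + ka x * z x) / psi x).
  assert (Dz : forall x, a < x -> is_derive z x (z1 x)).
  { intros x Hx. apply derive_plus; apply is_derive_scal; [apply Du|apply Dy]; exact Hx. }
  assert (Dz1 : forall x, a < x -> is_derive z1 x (- (q1 x * z x))).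
  { intros x Hx. eapply derive_eq.
    - apply derive_plus; apply is_derive_scal; [apply Du|apply Dy]; exact Hx.
    - unfold z. ring. }
  assert (Hz : forall x, a < x -> z x = rho x * cos (th x - al) /\ zp x = rho x * sin (th x - al)).
  { intros x Hx. destruct (Hth x Hx) as [_ [Eu Ey]]. unfold z, zp. rewrite Eu, Ey, cos_minus, sin_minus.
    split; ring. }
  assert (HWz : forall x, a < x -> z x * zp1 x - z1 x * zp x = K).
  { intros x Hx. rewrite <- (HW x Hx). unfold z, zp, z1, zp1. pose proof (sin_cos_sqr al) as T.
    transitivity ((sin al ^ 2 + cos al ^ 2) * (u x * y1 x - u1 x * y x)); [ring|]. rewrite T; ring. }
  set (s1 := fun x => (q1 x - ka1 x + ka x ^ 2) * z x / psi x - ka x * s x).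
  assert (Ds : forall x, a < x -> is_derive s x (s1 x)).
  { intros x Hx. destruct (D2 x Hx) as [_ [Dpsi [Dka [_ Hpsi]]]]. eapply derive_eq.
    - apply derive_div; [lra| |exact Dpsi].
      apply (is_derive_opp (fun x => z1 x + ka x * z x)).
      apply derive_plus; [apply Dz1, Hx|]. apply derive_mult; [exact Dka|apply Dz, Hx].
    - unfold s1, s, opp; simpl. field. lra. }
  assert (HN : forall x, a < x -> 0 < z x ^ 2 + s x ^ 2).
  { intros x Hx. destruct (D2 x Hx) as [_ [_ [_ [_ Hpsi]]]].
    destruct (Req_dec (z x) 0) as [E|E].
    - assert (Es : s x <> 0).
      { intros Es. unfold s in Es. rewrite E, Rmult_0_r, Rplus_0_r in Es.
        assert (z1 x = 0).
        { apply Rmult_eq_reg_r with (- / psi x).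
          - rewrite Rmult_0_l, <- Es. field. lra.
          - apply Ropp_neq_0_compat, Rinv_neq_0_compat. lra. }
        pose proof (HWz x Hx) as W. rewrite E, H in W. lra. }
      pose proof (pow2_gt_0 (s x) Es). pose proof (pow2_ge_0 (z x)). lra.
    - pose proof (pow2_gt_0 (z x) E). pose proof (pow2_ge_0 (s x)). lra. }
  assert (C : forall f l x, is_derive f x l -> continuity_pt f x)
    by (intros f l x Hf; exact (derive_cont_pt f x l Hf)).
  assert (Cs1 : forall x, a < x -> continuity_pt s1 x).
  { intros x Hx. destruct (D2 x Hx) as [_ [Dpsi [Dka [Cka1 Hpsi]]]].
    assert (Cka : continuity_pt ka x) by (eapply C, Dka).
    apply (continuity_pt_minus (fun x => (q1 x - ka1 x + ka x ^ 2) * z x / psi x) (fun x => ka x * s x)).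
    - apply (continuity_pt_div (fun x => (q1 x - ka1 x + ka x ^ 2) * z x) psi);
        [|eapply C, Dpsi|lra].
      apply (continuity_pt_mult (fun x => q1 x - ka1 x + ka x ^ 2) z); [|eapply C, Dz, Hx].
      apply (continuity_pt_plus (fun x => q1 x - ka1 x) (fun x => ka x ^ 2)).
      + apply (continuity_pt_minus q1 ka1); [apply Cq, Hx|exact Cka1].
      + apply (continuity_pt_mult ka (fun x => ka x * 1)); [exact Cka|].
        apply (continuity_pt_mult ka (fun _ => 1)); [exact Cka|].
        apply continuity_smooth. auto_derive. exact I.
    - apply (continuity_pt_mult ka s); [exact Cka|eapply C, Ds, Hx]. }
  assert (u0 : th x0 - al = PI / 2) by (unfold al; ring).
  assert (z0 : z x0 = 0) by (rewrite (proj1 (Hz x0 H0)), u0, cos_PI2; ring).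
  assert (s0 : 0 < s x0).
  { destruct (D2 x0 H0) as [_ [_ [_ [_ Hpsi]]]].
    pose proof (HWz x0 H0) as W. rewrite z0, (proj2 (Hz x0 H0)), u0, sin_PI2 in W.
    destruct (Hth x0 H0) as [Hr _].
    unfold s. rewrite z0, Rmult_0_r, Rplus_0_r. apply Rdiv_lt_0_compat; [nra|exact Hpsi]. }
  destruct (angle_lift a x0 (PI / 2) z s z1 s1) as [eta [eta0 Heta]];
    [exact H0|exact Dz|exact Ds| |exact Cs1|exact HN| | |].
  { intros x Hx. eapply C, Dz1, Hx. }
  { rewrite z0, cos_PI2; ring. }
  { rewrite z0, sin_PI2. replace (0 ^ 2 + s x0 ^ 2) with (s x0 ^ 2) by ring.
    rewrite sqrt_pow2 by lra. ring. }
  assert (Ceta : forall x, a < x -> continuity_pt eta x).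
  { intros x Hx. eapply C. apply Heta, Hx. }
  set (f := fun x => eta x - (th x - al)).
  assert (f0 : f x0 = 0) by (unfold f; rewrite eta0, u0; ring).
  assert (Hf : forall x, a < x -> - PI < f x < PI).
  { intros x Hx. pose proof PI_RGT_0 as HP.
    apply (trapped f a (- PI) PI x0 x); [|exact H0|exact Hx| |rewrite f0; lra].
    - intros t Ht. apply (continuity_pt_minus eta (fun x => th x - al)); [apply Ceta, Ht|].
      apply (continuity_pt_minus th (fun _ => al)); [apply Cth, Ht|].
      apply continuity_smooth. auto_derive. exact I.
    - intros t Ht.
      assert (Hat : a < t) by (eapply Rlt_le_trans; [|apply Ht]; apply Rmin_glb_lt; assumption).
      destruct (Heta t Hat) as [_ [Ec Es]].
      set (r := sqrt (z t ^ 2 + s t ^ 2)) in *.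
      assert (Hr : 0 < r) by apply sqrt_lt_R0, HN, Hat.
      destruct (Hth t Hat) as [Hrho _]. destruct (Hz t Hat) as [Ez Ezp].
      (* Opposite unit vectors would have opposite first coordinates. *)
      assert (Op : cos (eta t) = - cos (th t - al) -> sin (eta t) = - sin (th t - al) -> False).
      { intros O1 O2.
        assert (cz : cos (th t - al) = 0).
        { rewrite O1 in Ec. rewrite Ez in Ec. 
          assert ((rho t + r) * cos (th t - al) = 0) by lra.
          apply Rmult_integral in H. destruct H; [lra|assumption]. }
        assert (zt : z t = 0) by (rewrite Ez, cz; ring).
        pose proof (HWz t Hat) as W. rewrite zt, Ezp in W.
        destruct (D2 t Hat) as [_ [_ [_ [_ Hpsi]]]].
        assert (Et : s t * psi t = - z1 t) by (unfold s; rewrite zt; field; lra).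
        rewrite Es, O2 in Et.
        assert (W2 : K = - (rho t * r * psi t * sin (th t - al) ^ 2)).
        { replace K with (- z1 t * (rho t * sin (th t - al))) by lra. rewrite <- Et. ring. }
        pose proof (pow2_ge_0 (sin (th t - al))).
        assert (0 <= rho t * r * psi t * sin (th t - al) ^ 2)
          by (apply Rmult_le_pos; [left; repeat apply Rmult_lt_0_compat|]; assumption).
        lra. }
      split; intros E; apply Op; unfold f in E.
      + replace (eta t) with (th t - al - PI) by lra. rewrite cos_minus, cos_PI, sin_PI; ring.
      + replace (eta t) with (th t - al - PI) by lra. rewrite sin_minus, cos_PI, sin_PI; ring.
      + replace (eta t) with (th t - al + PI) by lra. rewrite neg_cos; ring.
      + replace (eta t) with (th t - al + PI) by lra. rewrite neg_sin; ring. }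
  set (g := fun x => x - ph - al).
  assert (Vz : vanish (fun x => z x - k * cos (g x))).
  { apply vanish_ext with (X := 0)
      (f := fun x => cos al * (u x - k * cos (x - ph)) + sin al * (y x - k * sin (x - ph))).
    - intros x _. unfold z, g. rewrite (cos_minus (x - ph)). ring.
    - apply vanish_lin; assumption. }
  assert (Vzp : vanish (fun x => zp x - k * sin (g x))).
  { apply vanish_ext with (X := 0)
      (f := fun x => - sin al * (u x - k * cos (x - ph)) + cos al * (y x - k * sin (x - ph))).
    - intros x _. unfold zp, g. rewrite (sin_minus (x - ph)). ring.
    - apply vanish_lin; assumption. }
  assert (Vz1 : vanish (fun x => z1 x + k * sin (g x))).
  { apply vanish_ext with (X := 0)
      (f := fun x => cos al * (u1 x + k * sin (x - ph)) + sin al * (y1 x - k * cos (x - ph))).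
    - intros x _. unfold z1, g. rewrite (sin_minus (x - ph)). ring.
    - apply vanish_lin; assumption. }
  assert (Bz : ebounded z).
  { eapply ebounded_close; [|exact Vz]. apply ebounded_scal, ebounded_le1. intros; apply Rabs_cos. }
  assert (Bpsi : ebounded (fun x => / psi x)).
  { rewrite vanish_spec in Vpsi. destruct (Vpsi (1 / 2)) as [X HX]; [lra|].
    exists 2, X. intros x Hx. specialize (HX x Hx). apply Rabs_lt_between in HX.
    rewrite Rabs_right.
    - replace 2 with (/ (1 / 2)) by field. apply Rinv_le_contravar; lra.
    - left; apply Rinv_0_lt_compat; lra. }
  assert (Vs : vanish (fun x => s x - k * sin (g x))).
  { apply vanish_ext with (X := a) (f := fun x =>
      1 * (/ psi x * (-1 * (z1 x + k * sin (g x)) + -1 * (z x * ka x)))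
      + 1 * ((/ psi x * (- k * sin (g x))) * (psi x - 1))).
    - intros x Hx. destruct (D2 x Hx) as [_ [_ [_ [_ Hpsi]]]]. unfold s. field. lra.
    - apply vanish_lin; apply vanish_mult.
      + exact Bpsi.
      + apply vanish_lin; [exact Vz1|]. apply vanish_mult; assumption.
      + apply ebounded_mult; [exact Bpsi|]. apply ebounded_scal, ebounded_le1. intros; apply Rabs_sin.
      + exact Vpsi. }
  assert (Vf : vanish f).
  { apply (small_of_cos f a Hf).
    apply (angles_close k (fun x => sqrt (z x ^ 2 + s x ^ 2)) (fun x => Rabs (rho x)) eta
             (fun x => th x - al) g Hk).
    - eapply vanish_ext; [|exact Vz]. intros x Hx; simpl.
      f_equal. apply (Heta x). exact Hx.
    - eapply vanish_ext; [|exact Vs]. intros x Hx; simpl.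
      f_equal. apply (Heta x). exact Hx.
    - eapply vanish_ext; [|exact Vz]. intros x Hx; simpl.
      destruct (Hth x Hx) as [Hr _]. rewrite Rabs_right by lra.
      f_equal. apply (Hz x). exact Hx.
    - eapply vanish_ext; [|exact Vzp]. intros x Hx; simpl.
      destruct (Hth x Hx) as [Hr _]. rewrite Rabs_right by lra.
      f_equal. apply (Hz x). exact Hx.
    - intros; apply sqrt_pos.
    - intros; apply Rabs_pos. }
  exists (fun x => eta x - th2 x + al), (fun x => z x ^ 2 / (psi x * (z x ^ 2 + s x ^ 2))).
  split; [|split; [|split]].
  - rewrite eta0. unfold al. ring.
  - apply vanish_ext with (X := 0) (f := fun x => 1 * f x + 1 * (th x - th2 x - L)).
    + intros x _. unfold f. ring.
    + apply vanish_lin; assumption.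
  - intros x Hx. destruct (D2 x Hx) as [Dth2 [_ [_ [_ Hpsi]]]]. pose proof (HN x Hx) as HNx. split.
    + apply Rdiv_le_0_compat; [apply pow2_ge_0|apply Rmult_lt_0_compat; assumption].
    + eapply derive_eq.
      * apply (derive_plus (fun x => eta x - th2 x) (fun _ => al)).
        -- apply derive_minus; [apply Heta, Hx|exact Dth2].
        -- apply derive_const.
      * unfold s1.
        replace (z1 x) with (- (psi x * s x) - ka x * z x) by (unfold s; field; lra).
        field. split; lra.
  - intros Hall.
    (* A solution vanishing on a half-line would violate the Wronskian identity. *)
    assert (Hz0 : forall x, x0 < x -> z x = 0).
    { intros x Hx. specialize (Hall x Hx). simpl in Hall.
      assert (Hax : a < x) by lra.
      destruct (D2 x Hax) as [_ [_ [_ [_ Hpsi]]]]. pose proof (HN x Hax) as HNx.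
      assert (P : 0 < psi x * (z x ^ 2 + s x ^ 2)) by (apply Rmult_lt_0_compat; assumption).
      assert (z x ^ 2 = 0).
      { apply Rmult_eq_reg_r with (/ (psi x * (z x ^ 2 + s x ^ 2))).
        - rewrite Rmult_0_l. exact Hall.
        - apply Rinv_neq_0_compat. lra. }
      nra. }
    assert (Hx1 : a < x0 + 1) by lra.
    assert (D0 : is_derive z (x0 + 1) 0).
    { eapply is_derive_ext_loc; [|apply (is_derive_const 0 (x0 + 1))].
      eapply filter_imp; [|apply (open_gt x0 (x0 + 1)); simpl; lra].
      intros t Ht. symmetry. apply Hz0. exact Ht. }
    pose proof (is_derive_unique z _ _ D0) as U1.
    pose proof (is_derive_unique z _ _ (Dz _ Hx1)) as U2.
    pose proof (HWz _ Hx1) as W. rewrite Hz0 in W by lra.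
    rewrite <- U2, U1 in W. lra.
Qed.

(** * The comparison phases *)

Lemma derive_acos (t : R) : -1 < t < 1 -> is_derive acos t (- / sqrt (1 - t ^ 2)).
Proof.
  intros Ht. apply is_derive_Reals.
  replace (- / sqrt (1 - t ^ 2)) with (-1 / sqrt (1 - t²)) by (unfold Rsqr; simpl; rewrite Rmult_1_r; unfold Rdiv; ring).
  apply (derive_pt_eq_1 acos t _ (derivable_pt_acos t Ht)). apply derive_pt_acos.
Qed.

Definition gap (nu x : R) : R := x ^ 2 - nu ^ 2.

Lemma gap_pos (nu x : R) : 0 <= nu < x -> 0 < gap nu x.
Proof. intros H. unfold gap. nra. Qed.

Lemma derive_gap (nu x : R) : is_derive (gap nu) x (2 * x).
Proof. unfold gap. auto_derive; [exact I|ring]. Qed.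

Lemma derive_sqrt_gap (nu x : R) : 0 <= nu < x ->
  is_derive (fun x => sqrt (gap nu x)) x (x / sqrt (gap nu x)).
Proof.
  intros H. pose proof (gap_pos nu x H) as P. pose proof (sqrt_lt_R0 _ P).
  eapply derive_eq; [apply (derive_comp sqrt (gap nu)); [apply derive_sqrt, P|apply derive_gap]|].
  field. lra.
Qed.

Definition psi_t (nu x : R) : R := sqrt (gap nu x) / x.

Lemma derive_theta_tilde (nu x : R) : 0 <= nu < x ->
  is_derive (theta_tilde nu) x (psi_t nu x).
Proof.
  intros H. pose proof (gap_pos nu x H) as P. pose proof (sqrt_lt_R0 _ P) as Hs.
  assert (Hx : 0 < x) by lra.
  assert (Hr : -1 < nu / x < 1).
  { split.
    - apply Rlt_le_trans with 0; [lra|]. apply Rdiv_le_0_compat; lra.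
    - apply Rlt_div_l; lra. }
  assert (Es : sqrt (1 - (nu / x) ^ 2) = sqrt (gap nu x) / x).
  { replace (1 - (nu / x) ^ 2) with (gap nu x / x ^ 2) by (unfold gap; field; lra).
    rewrite sqrt_div_alt by nra. rewrite sqrt_pow2 by lra. reflexivity. }
  unfold theta_tilde. fold (gap nu).
  eapply derive_eq.
  - apply derive_minus; [|apply derive_const].
    apply derive_minus; [apply (derive_sqrt_gap nu x H)|].
    apply is_derive_scal.
    apply (derive_comp acos (fun x => nu / x)); [apply derive_acos, Hr|].
    instantiate (1 := - nu / x ^ 2). auto_derive; [lra|field; lra].
  - rewrite Es. unfold psi_t. set (r := sqrt (gap nu x)) in *.
    assert (Er : r ^ 2 = x ^ 2 - nu ^ 2) by (unfold r; rewrite pow2_sqrt; [reflexivity|lra]).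
    field_simplify; [|lra|lra].
    replace (nu ^ 2) with (x ^ 2 - r ^ 2) by lra. field. lra.
Qed.

Definition corr (nu x : R) : R := (3 * x ^ 2 + 2 * nu ^ 2) / (24 * (gap nu x * sqrt (gap nu x))).

Lemma theta_low_eq (nu x : R) : 0 <= nu < x -> theta_low nu x = theta_tilde nu x - corr nu x.
Proof.
  intros H. pose proof (gap_pos nu x H) as P. unfold theta_low, corr. fold (gap nu x).
  do 3 f_equal. replace (3 / 2) with (1 + / 2) by field.
  rewrite Rpower_plus, Rpower_1, Rpower_sqrt by exact P. reflexivity.
Qed.

(** In the variable [t = theta_tilde nu x] the Liouville-Green transformation turns
    Bessel's equation into [w'' + (1 + 2 hh) w = 0]; the correction [corr] is the
    integral of [hh] in [t] up to infinity. *)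
Definition hh (nu x : R) : R := x ^ 2 * (x ^ 2 + 4 * nu ^ 2) / (8 * gap nu x ^ 3).
Definition psi_l (nu x : R) : R := psi_t nu x * (1 + hh nu x).

Lemma derive_corr (nu x : R) : 0 <= nu < x ->
  is_derive (corr nu) x (- (psi_t nu x * hh nu x)).
Proof.
  intros H. pose proof (gap_pos nu x H) as P. pose proof (sqrt_lt_R0 _ P) as Hs.
  assert (Hx : 0 < x) by lra.
  unfold corr. eapply derive_eq.
  - apply derive_div.
    + apply Rgt_not_eq. repeat apply Rmult_lt_0_compat; try lra.
    + instantiate (1 := 6 * x). auto_derive; [exact I|ring].
    + apply is_derive_scal. apply derive_mult; [apply derive_gap|apply (derive_sqrt_gap nu x H)].
  - unfold psi_t, hh. set (r := sqrt (gap nu x)) in *.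
    assert (Er : gap nu x = r ^ 2) by (unfold r; rewrite pow2_sqrt; lra).
    assert (En : nu ^ 2 = x ^ 2 - r ^ 2) by (rewrite <- Er; unfold gap; ring).
    rewrite Er, En. field. lra.
Qed.

Lemma derive_theta_low (nu x : R) : 0 <= nu < x ->
  is_derive (theta_low nu) x (psi_l nu x).
Proof.
  intros H.
  apply (is_derive_ext_loc (fun x => theta_tilde nu x - corr nu x)).
  - eapply filter_imp; [|apply (open_gt nu x); apply H].
    intros t Ht. symmetry. apply theta_low_eq. simpl in Ht; lra.
  - eapply derive_eq; [apply derive_minus; [apply derive_theta_tilde, H|apply derive_corr, H]|].
    unfold psi_l. ring.
Qed.

(** Half the logarithmic derivative of [psi_t], and its derivative. *)
Definition ka_t (nu x : R) : R := nu ^ 2 / (2 * x * gap nu x).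
Definition ka1_t (nu x : R) : R := - nu ^ 2 * (3 * x ^ 2 - nu ^ 2) / (2 * x ^ 2 * gap nu x ^ 2).

Lemma derive_psi_t (nu x : R) : 0 <= nu < x ->
  is_derive (psi_t nu) x (2 * ka_t nu x * psi_t nu x).
Proof.
  intros H. pose proof (gap_pos nu x H) as P. pose proof (sqrt_lt_R0 _ P) as Hs.
  unfold psi_t. eapply derive_eq.
  - apply derive_div; [lra|apply (derive_sqrt_gap nu x H)|apply derive_id].
  - unfold ka_t. set (r := sqrt (gap nu x)) in *.
    assert (Er : gap nu x = r ^ 2) by (unfold r; rewrite pow2_sqrt; lra).
    assert (En : nu ^ 2 = x ^ 2 - r ^ 2) by (rewrite <- Er; unfold gap; ring).
    rewrite En, Er. field. lra.
Qed.

Lemma derive_ka_t (nu x : R) : 0 <= nu < x -> is_derive (ka_t nu) x (ka1_t nu x).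
Proof.
  intros H. pose proof (gap_pos nu x H) as P.
  unfold ka_t, ka1_t, gap in *. auto_derive.
  - apply Rgt_not_eq. repeat apply Rmult_lt_0_compat; simpl in *; try lra.
  - field. split; [simpl in *; lra|lra].
Qed.

Definition potential (nu x : R) : R := 1 + (1 / 4 - nu ^ 2) / x ^ 2.

(** The difference is the sum of [1 / (4 x^2)], [- ka1_t] and [ka_t ^ 2]. *)
Lemma tilde_below (nu x : R) : 0 <= nu < x ->
  psi_t nu x ^ 2 + ka1_t nu x - ka_t nu x ^ 2 < potential nu x.
Proof.
  intros H. pose proof (gap_pos nu x H) as P. assert (Hx : 0 < x ^ 2) by nra.
  assert (E : psi_t nu x ^ 2 = 1 - nu ^ 2 / x ^ 2).
  { unfold psi_t, Rdiv. rewrite Rpow_mult_distr, pow2_sqrt by lra. unfold gap. field. lra. }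
  rewrite E. unfold potential.
  assert (ka1_t nu x <= 0).
  { unfold ka1_t.
    replace (- nu ^ 2 * (3 * x ^ 2 - nu ^ 2) / (2 * x ^ 2 * gap nu x ^ 2))
      with (- (nu ^ 2 * (3 * x ^ 2 - nu ^ 2) / (2 * x ^ 2 * gap nu x ^ 2)))
      by (field; split; lra).
    assert (0 <= nu ^ 2 * (3 * x ^ 2 - nu ^ 2) / (2 * x ^ 2 * gap nu x ^ 2)); [|lra].
    apply Rdiv_le_0_compat.
    - apply Rmult_le_pos; [apply pow2_ge_0|unfold gap in P; lra].
    - apply Rmult_lt_0_compat; [lra|apply pow_lt, P]. }
  pose proof (pow2_ge_0 (ka_t nu x)).
  assert (0 < 1 / 4 / x ^ 2) by (apply Rdiv_lt_0_compat; lra).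
  replace ((1 / 4 - nu ^ 2) / x ^ 2) with (1 / 4 / x ^ 2 - nu ^ 2 / x ^ 2) by (field; lra).
  lra.
Qed.

(** First two derivatives of [hh], as functions of [x], [P = x^2 - nu^2], [n = nu^2]. *)
Definition hp (P n : R) : R := - (/ P ^ 2 + 12 * n / P ^ 3 + 15 * n ^ 2 / P ^ 4) / 8.
Definition hpp (P n : R) : R := (2 / P ^ 3 + 36 * n / P ^ 4 + 60 * n ^ 2 / P ^ 5) / 8.
Definition hh1 (nu x : R) : R := 2 * x * hp (gap nu x) (nu ^ 2).
Definition hh2 (nu x : R) : R := 2 * hp (gap nu x) (nu ^ 2) + 4 * x ^ 2 * hpp (gap nu x) (nu ^ 2).

Lemma hh_gap (nu x : R) : 0 < gap nu x ->
  hh nu x = (/ gap nu x + 6 * nu ^ 2 / gap nu x ^ 2 + 5 * (nu ^ 2) ^ 2 / gap nu x ^ 3) / 8.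
Proof.
  intros P. unfold hh. replace (x ^ 2) with (gap nu x + nu ^ 2) by (unfold gap; ring).
  field. lra.
Qed.

Lemma derive_hh (nu x : R) : 0 <= nu < x -> is_derive (hh nu) x (hh1 nu x).
Proof.
  intros H. pose proof (gap_pos nu x H) as P.
  eapply derive_eq.
  - apply derive_div.
    + apply Rgt_not_eq. apply Rmult_lt_0_compat; [lra|apply pow_lt, P].
    + instantiate (1 := 4 * x ^ 3 + 8 * nu ^ 2 * x). auto_derive; [exact I|ring].
    + apply is_derive_scal. apply (derive_comp (fun t => t ^ 3) (gap nu)); [|apply derive_gap].
      instantiate (1 := 3 * gap nu x ^ 2). auto_derive; [exact I|ring].
  - unfold hh1, hp. replace (x ^ 3) with (x * (gap nu x + nu ^ 2)) by (unfold gap; ring).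
    replace (x ^ 2) with (gap nu x + nu ^ 2) by (unfold gap; ring).
    field. lra.
Qed.

Lemma derive_hh1 (nu x : R) : 0 <= nu < x -> is_derive (hh1 nu) x (hh2 nu x).
Proof.
  intros H. pose proof (gap_pos nu x H) as P. unfold hh1. eapply derive_eq.
  - apply derive_mult.
    + instantiate (1 := 2). auto_derive; [exact I|ring].
    + apply (derive_comp (fun t => hp t (nu ^ 2)) (gap nu)); [|apply derive_gap].
      instantiate (1 := hpp (gap nu x) (nu ^ 2)). unfold hp. auto_derive.
      * repeat split; [apply (pow_nonzero _ 2)|apply (pow_nonzero _ 3)|apply (pow_nonzero _ 4)]; lra.
      * unfold hpp. field. lra.
  - unfold hh2. ring.
Qed.

(** Half the logarithmic derivative of [psi_l], and its derivative. *)
Definition ka_l (nu x : R) : R := ka_t nu x + hh1 nu x / (2 * (1 + hh nu x)).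
Definition ka1_l (nu x : R) : R :=
  ka1_t nu x + (hh2 nu x * (1 + hh nu x) - hh1 nu x ^ 2) / (2 * (1 + hh nu x) ^ 2).

Lemma hh_nonneg (nu x : R) : 0 <= nu < x -> 0 <= hh nu x.
Proof.
  intros H. pose proof (gap_pos nu x H) as P. unfold hh.
  apply Rdiv_le_0_compat; [|apply Rmult_lt_0_compat; [lra|apply pow_lt, P]].
  pose proof (pow2_ge_0 x). pose proof (pow2_ge_0 nu). nra.
Qed.

Lemma derive_psi_l (nu x : R) : 0 <= nu < x ->
  is_derive (psi_l nu) x (2 * ka_l nu x * psi_l nu x).
Proof.
  intros H. pose proof (hh_nonneg nu x H). unfold psi_l. eapply derive_eq.
  - apply derive_mult; [apply derive_psi_t, H|].
    apply (derive_plus (fun _ => 1)); [apply derive_const|apply derive_hh, H].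
  - unfold ka_l. field. lra.
Qed.

Lemma derive_ka_l (nu x : R) : 0 <= nu < x -> is_derive (ka_l nu) x (ka1_l nu x).
Proof.
  intros H. pose proof (hh_nonneg nu x H). unfold ka_l. eapply derive_eq.
  - apply derive_plus; [apply derive_ka_t, H|]. apply derive_div; [lra|apply derive_hh1, H|].
    apply is_derive_scal. apply (derive_plus (fun _ => 1)); [apply derive_const|apply derive_hh, H].
  - unfold ka1_l. field. lra.
Qed.

(** What remains of the difference of coefficients for [theta_low] after clearing
    denominators, in [P = x^2 - nu^2] and [n = nu^2]. *)
Definition defect_num (P n : R) : R :=
  P^8 + 24*P^7*n + 236*P^6*n^2 + 16*P^9 + 1224*P^5*n^3 + 800*P^8*n + 3606*P^4*n^4
  + 2480*P^7*n^2 + 1600*P^10 + 6120*P^3*n^5 + 5824*P^6*n^3 + 35584*P^9*n + 5900*P^2*n^6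
  + 9328*P^5*n^4 + 132992*P^8*n^2 + 3000*P*n^7 + 7200*P^4*n^5 + 169728*P^7*n^3
  + 625*n^8 + 2000*P^3*n^6 + 70720*P^6*n^4.

Lemma defect_num_pos (P n : R) : 0 < P -> 0 <= n -> 0 < defect_num P n.
Proof.
  intros HP Hn.
  assert (M : forall c i j, 0 <= c -> 0 <= c * P ^ i * n ^ j).
  { intros c i j Hc. repeat apply Rmult_le_pos; [exact Hc|apply pow_le; lra|apply pow_le, Hn]. }
  pose proof (pow_lt P 8 HP) as H8.
  pose proof (M 24 7%nat 1%nat ltac:(lra)). pose proof (M 236 6%nat 2%nat ltac:(lra)).
  pose proof (M 16 9%nat 0%nat ltac:(lra)). pose proof (M 1224 5%nat 3%nat ltac:(lra)).
  pose proof (M 800 8%nat 1%nat ltac:(lra)). pose proof (M 3606 4%nat 4%nat ltac:(lra)).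
  pose proof (M 2480 7%nat 2%nat ltac:(lra)). pose proof (M 1600 10%nat 0%nat ltac:(lra)).
  pose proof (M 6120 3%nat 5%nat ltac:(lra)). pose proof (M 5824 6%nat 3%nat ltac:(lra)).
  pose proof (M 35584 9%nat 1%nat ltac:(lra)). pose proof (M 5900 2%nat 6%nat ltac:(lra)).
  pose proof (M 9328 5%nat 4%nat ltac:(lra)). pose proof (M 132992 8%nat 2%nat ltac:(lra)).
  pose proof (M 3000 1%nat 7%nat ltac:(lra)). pose proof (M 7200 4%nat 5%nat ltac:(lra)).
  pose proof (M 169728 7%nat 3%nat ltac:(lra)). pose proof (M 625 0%nat 8%nat ltac:(lra)).
  pose proof (M 2000 3%nat 6%nat ltac:(lra)). pose proof (M 70720 6%nat 4%nat ltac:(lra)).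
  rewrite ?pow_1, ?pow_O, ?Rmult_1_r in *. unfold defect_num. lra.
Qed.

(** With [P] and [n] as variables the difference is a rational function whose
    numerator has positive coefficients only. *)
Lemma low_above (nu x : R) : 0 <= nu < x ->
  potential nu x < psi_l nu x ^ 2 + ka1_l nu x - ka_l nu x ^ 2.
Proof.
  intros H. pose proof (gap_pos nu x H) as HP. pose proof (hh_nonneg nu x H) as Hh.
  assert (Hx : 0 < x) by lra.
  set (P := gap nu x) in *. set (n := nu ^ 2).
  assert (Hn : 0 <= n) by apply pow2_ge_0.
  assert (EX : x ^ 2 = P + n) by (unfold P, n, gap; ring).
  set (h := (P ^ 2 + 6 * n * P + 5 * n ^ 2) / (8 * P ^ 3)).
  assert (Eh : hh nu x = h).
  { rewrite hh_gap by exact HP. fold P n. unfold h. field. lra. }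
  rewrite Eh in Hh.
  assert (E : psi_l nu x ^ 2 + ka1_l nu x - ka_l nu x ^ 2 - potential nu x
     = defect_num P n / (4096 * (P + n) * P ^ 11 * (1 + h) ^ 2)).
  { unfold psi_l, ka1_l, ka_l. rewrite Eh.
    assert (Ep : psi_t nu x ^ 2 = P / (P + n)).
    { unfold psi_t, Rdiv. rewrite Rpow_mult_distr, pow2_sqrt by (left; exact HP).
      rewrite pow_inv, EX. reflexivity. }
    rewrite Rpow_mult_distr, Ep.
    assert (Ek1 : ka1_t nu x = - n * (3 * P + 2 * n) / (2 * (P + n) * P ^ 2)).
    { unfold ka1_t. fold P n. rewrite EX. field. lra. }
    assert (Ek2 : ka_t nu x ^ 2 = n ^ 2 / (4 * (P + n) * P ^ 2)).
    { unfold ka_t. fold P n. rewrite <- EX. field. lra. }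
    assert (Ek3 : ka_t nu x * hh1 nu x = n / P * hp P n).
    { unfold ka_t, hh1. fold P n. field. lra. }
    assert (Ek4 : hh1 nu x ^ 2 = 4 * (P + n) * hp P n ^ 2).
    { unfold hh1. fold P n. rewrite <- EX. ring. }
    assert (Ek5 : hh2 nu x = 2 * hp P n + 4 * (P + n) * hpp P n).
    { unfold hh2. fold P n. rewrite <- EX. ring. }
    assert (Epot : potential nu x = 1 + (1 / 4 - n) / (P + n)).
    { unfold potential. fold n. rewrite EX. reflexivity. }
    rewrite Epot, Ek1, Ek5.
    replace ((ka_t nu x + hh1 nu x / (2 * (1 + h))) ^ 2)
      with (ka_t nu x ^ 2 + (ka_t nu x * hh1 nu x) / (1 + h) + hh1 nu x ^ 2 / (4 * (1 + h) ^ 2))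
      by (field; lra).
    rewrite Ek2, Ek3, Ek4.
    assert (Hh1 : 1 + h = (8 * P ^ 3 + P ^ 2 + 6 * n * P + 5 * n ^ 2) / (8 * P ^ 3))
      by (unfold h; field; lra).
    rewrite Hh1. unfold hp, hpp, defect_num.
    assert (0 < 8 * P ^ 3 + P ^ 2 + 6 * n * P + 5 * n ^ 2).
    { pose proof (pow_lt P 3 HP). pose proof (pow_lt P 2 HP). pose proof (pow2_ge_0 n).
      assert (0 <= n * P) by (apply Rmult_le_pos; lra). lra. }
    field. repeat split; lra. }
  assert (0 < defect_num P n / (4096 * (P + n) * P ^ 11 * (1 + h) ^ 2)).
  { apply Rdiv_lt_0_compat; [apply defect_num_pos; assumption|].
    repeat apply Rmult_lt_0_compat; try lra; apply pow_lt; lra. }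
  lra.
Qed.

(** * Behaviour of the comparison phases at infinity *)

Lemma gap_large (nu x : R) : 0 <= nu -> 2 * nu + 1 < x -> x ^ 2 / 2 <= gap nu x.
Proof. intros Hn Hx. unfold gap. nra. Qed.

Lemma bigO_inv_gap (nu : R) : 0 <= nu -> bigO_inv (fun x => / gap nu x).
Proof.
  intros Hn. exists 2, (2 * nu + 1). intros x Hx Hp.
  pose proof (gap_large nu x Hn Hx) as G.
  rewrite Rabs_right by (left; apply Rinv_0_lt_compat; nra).
  replace (2 / x) with (/ (x / 2)) by (field; lra).
  apply Rinv_le_contravar; nra.
Qed.

Lemma bigO_x_gap (nu : R) : 0 <= nu -> bigO_inv (fun x => x * / gap nu x).
Proof.
  intros Hn. exists 2, (2 * nu + 1). intros x Hx Hp.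
  pose proof (gap_large nu x Hn Hx) as G.
  assert (P : 0 < gap nu x) by nra.
  rewrite Rabs_right by (apply Rle_ge, Rmult_le_pos; [lra|left; apply Rinv_0_lt_compat, P]).
  apply Rle_div_l; [exact P|]. replace (2 / x * gap nu x) with (gap nu x * 2 / x) by (field; lra).
  apply Rle_div_r; nra.
Qed.

Lemma bigO_sqrt_gap (nu : R) : 0 <= nu -> bigO_inv (fun x => / sqrt (gap nu x)).
Proof.
  intros Hn. exists 2, (2 * nu + 1). intros x Hx Hp.
  pose proof (gap_large nu x Hn Hx) as G.
  assert (L : x / 2 <= sqrt (gap nu x)).
  { rewrite <- (sqrt_pow2 (x / 2)) by lra. apply sqrt_le_1_alt. nra. }
  rewrite Rabs_right by (left; apply Rinv_0_lt_compat; lra).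
  replace (2 / x) with (/ (x / 2)) by (field; lra).
  apply Rinv_le_contravar; lra.
Qed.

Lemma bigO_sqrt_gap_sub (nu : R) : 0 <= nu -> bigO_inv (fun x => sqrt (gap nu x) - x).
Proof.
  intros Hn. exists (nu ^ 2), (2 * nu + 1). intros x Hx Hp.
  pose proof (gap_large nu x Hn Hx) as G. pose proof (sqrt_pos (gap nu x)) as S.
  assert (P : 0 < gap nu x) by nra.
  assert (E : (x - sqrt (gap nu x)) * (x + sqrt (gap nu x)) = nu ^ 2).
  { replace ((x - sqrt (gap nu x)) * (x + sqrt (gap nu x))) with (x ^ 2 - sqrt (gap nu x) ^ 2) by ring.
    rewrite pow2_sqrt by lra. unfold gap. ring. }
  assert (0 <= x - sqrt (gap nu x)).
  { assert (sqrt (gap nu x) <= x); [|lra]. rewrite <- (sqrt_pow2 x) at 2 by lra.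
    apply sqrt_le_1_alt. unfold gap. pose proof (pow2_ge_0 nu). lra. }
  rewrite Rabs_left1 by lra. apply Rle_div_r; [lra|]. nra.
Qed.

Lemma vanish_psi_t (nu : R) : 0 <= nu -> vanish (fun x => psi_t nu x - 1).
Proof.
  intros Hn.
  apply vanish_ext with (X := 0) (f := fun x => (sqrt (gap nu x) - x) * / x).
  - intros x Hx. unfold psi_t. field. lra.
  - apply vanish_mult; [|apply vanish_inv].
    apply vanish_ebounded, bigO_inv_vanish, bigO_sqrt_gap_sub, Hn.
Qed.

Lemma vanish_hh_like (nu a b c : R) : 0 <= nu ->
  vanish (fun x => a * / gap nu x + (b / gap nu x ^ 2 + c / gap nu x ^ 3)).
Proof.
  intros Hn. pose proof (bigO_inv_vanish _ (bigO_inv_gap nu Hn)) as V.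
  pose proof (vanish_ebounded _ V) as B.
  apply vanish_ext with (X := nu) (f := fun x => (a + (b * / gap nu x + c * (/ gap nu x * / gap nu x))) * / gap nu x).
  - intros x Hx. pose proof (gap_pos nu x (conj Hn Hx)). field. lra.
  - apply vanish_mult; [|exact V].
    apply ebounded_plus; [apply ebounded_const|]. apply ebounded_plus; apply ebounded_scal; [exact B|].
    apply ebounded_mult; exact B.
Qed.

Lemma vanish_hh (nu : R) : 0 <= nu -> vanish (hh nu).
Proof.
  intros Hn.
  apply vanish_ext with (X := nu) (f := fun x => / 8 * / gap nu x +
    (6 * nu ^ 2 / 8 / gap nu x ^ 2 + 5 * (nu ^ 2) ^ 2 / 8 / gap nu x ^ 3)).
  - intros x Hx. pose proof (gap_pos nu x (conj Hn Hx)). rewrite hh_gap by assumption. field. lra.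
  - apply vanish_hh_like, Hn.
Qed.

Lemma vanish_hh1 (nu : R) : 0 <= nu -> vanish (hh1 nu).
Proof.
  intros Hn.
  apply vanish_ext with (X := nu) (f := fun x => (x * / gap nu x) * (- / 4 * / gap nu x +
    (- 12 * nu ^ 2 / 4 / gap nu x ^ 2 + - 15 * (nu ^ 2) ^ 2 / 4 / gap nu x ^ 3))).
  - intros x Hx. pose proof (gap_pos nu x (conj Hn Hx)). unfold hh1, hp. field. lra.
  - apply vanish_mult; [|apply vanish_hh_like, Hn].
    apply vanish_ebounded, bigO_inv_vanish, bigO_x_gap, Hn.
Qed.

Lemma vanish_ka_t (nu : R) : 0 <= nu -> vanish (ka_t nu).
Proof.
  intros Hn.
  apply vanish_ext with (X := nu) (f := fun x => (nu ^ 2 / 2 * / gap nu x) * / x).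
  - intros x Hx. pose proof (gap_pos nu x (conj Hn Hx)). unfold ka_t. field. split; lra.
  - apply vanish_mult; [|apply vanish_inv]. apply ebounded_scal, vanish_ebounded, bigO_inv_vanish, bigO_inv_gap, Hn.
Qed.

Lemma vanish_psi_l (nu : R) : 0 <= nu -> vanish (fun x => psi_l nu x - 1).
Proof.
  intros Hn.
  apply vanish_ext with (X := nu) (f := fun x =>
    1 * ((1 + hh nu x) * (psi_t nu x - 1)) + 1 * hh nu x).
  - intros x Hx. unfold psi_l. ring.
  - apply vanish_lin; [|apply vanish_hh, Hn]. apply vanish_mult; [|apply vanish_psi_t, Hn].
    apply ebounded_plus; [apply ebounded_const|apply vanish_ebounded, vanish_hh, Hn].
Qed.

Lemma vanish_ka_l (nu : R) : 0 <= nu -> vanish (ka_l nu).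
Proof.
  intros Hn.
  apply vanish_ext with (X := nu) (f := fun x =>
    1 * ka_t nu x + 1 * (hh1 nu x / (2 * (1 + hh nu x)))).
  - intros x Hx. unfold ka_l. ring.
  - apply vanish_lin; [apply vanish_ka_t, Hn|].
    apply vanish_le with (g := hh1 nu) (X := nu); [|apply vanish_hh1, Hn].
    intros x Hx. pose proof (hh_nonneg nu x (conj Hn Hx)).
    rewrite Rabs_div, (Rabs_right (2 * _)) by lra.
    apply Rle_div_l; [lra|]. rewrite <- (Rmult_1_r (Rabs (hh1 nu x))) at 1.
    apply Rmult_le_compat_l; [apply Rabs_pos|lra].
Qed.

Lemma vanish_acos (nu : R) : vanish (fun x => acos (nu / x) - PI / 2).
Proof.
  assert (L : is_lim (fun x => acos (nu * / x)) p_infty (acos 0)).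
  { apply (is_lim_comp_continuous (fun x => nu * / x) acos).
    - apply (vanish_mult (fun _ => nu)); [apply ebounded_const|apply vanish_inv].
    - apply (ex_derive_continuous acos). eexists. apply derive_acos. lra. }
  rewrite acos_0 in L. unfold vanish.
  replace (Finite 0) with (Finite (PI / 2 - PI / 2)) by (f_equal; ring).
  apply is_lim_minus'; [exact L|apply is_lim_const].
Qed.

Lemma vanish_theta_tilde (nu : R) : 0 <= nu ->
  vanish (fun x => theta_tilde nu x - (x - phase nu)).
Proof.
  intros Hn.
  apply vanish_ext with (X := 0) (f := fun x =>
    1 * (sqrt (gap nu x) - x) + - nu * (acos (nu / x) - PI / 2)).
  - intros x Hx. unfold theta_tilde, phase, halfang. fold (gap nu x). field.
  - apply vanish_lin; [apply bigO_inv_vanish, bigO_sqrt_gap_sub, Hn|apply vanish_acos].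
Qed.

Lemma vanish_corr (nu : R) : 0 <= nu -> vanish (corr nu).
Proof.
  intros Hn.
  apply vanish_ext with (X := nu) (f := fun x =>
    (/ 8 + 5 * nu ^ 2 / 24 * / gap nu x) * / sqrt (gap nu x)).
  - intros x Hx. pose proof (gap_pos nu x (conj Hn Hx)) as P. pose proof (sqrt_lt_R0 _ P).
    unfold corr. replace (x ^ 2) with (gap nu x + nu ^ 2) by (unfold gap; ring). field. lra.
  - apply vanish_mult; [|apply bigO_inv_vanish, bigO_sqrt_gap, Hn].
    apply ebounded_plus; [apply ebounded_const|].
    apply ebounded_scal, vanish_ebounded, bigO_inv_vanish, bigO_inv_gap, Hn.
Qed.

Lemma vanish_theta_low (nu : R) : 0 <= nu ->
  vanish (fun x => theta_low nu x - (x - phase nu)).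
Proof.
  intros Hn.
  apply vanish_ext with (X := nu) (f := fun x =>
    1 * (theta_tilde nu x - (x - phase nu)) + -1 * corr nu x).
  - intros x Hx. rewrite theta_low_eq by (split; assumption). ring.
  - apply vanish_lin; [apply vanish_theta_tilde, Hn|apply vanish_corr, Hn].
Qed.

(** * Behaviour of the comparison phases at the turning point *)

Lemma atan_le (t : R) : 0 <= t -> atan t <= t.
Proof.
  intros Ht. destruct (MVT_gen atan 0 t (fun s => / (1 + s ^ 2))) as [c [_ E]].
  - intros s _. auto_derive; [exact I|]. unfold Rsqr. field. nra.
  - intros s _. apply continuity_smooth. auto_derive. exact I.
  - rewrite atan_0, !Rminus_0_r in E. rewrite E.
    assert (/ (1 + c ^ 2) <= 1).
    { rewrite <- Rinv_1. apply Rinv_le_contravar; [lra|]. pose proof (pow2_ge_0 c); lra. }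
    nra.
Qed.

(** With [t = sqrt (x^2 - nu^2) / nu] this is [nu * atan t <= nu * t]. *)
Lemma theta_tilde_ge (nu x : R) : 0 <= nu < x -> - (PI / 4) <= theta_tilde nu x.
Proof.
  intros H. pose proof (gap_pos nu x H) as P. pose proof (sqrt_lt_R0 _ P) as S.
  unfold theta_tilde. fold (gap nu x).
  assert (nu * acos (nu / x) <= sqrt (gap nu x)); [|lra].
  destruct (Req_dec nu 0) as [->|Hn]; [lra|].
  assert (Hq : 0 < nu / x) by (apply Rdiv_lt_0_compat; lra).
  rewrite acos_atan by exact Hq.
  assert (Es : sqrt (1 - (nu / x)²) / (nu / x) = sqrt (gap nu x) / nu).
  { replace (1 - (nu / x)²) with (gap nu x / x ^ 2) by (unfold gap, Rsqr; field; lra).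
    rewrite sqrt_div_alt by nra. rewrite sqrt_pow2 by lra. field. lra. }
  rewrite Es.
  apply Rle_trans with (nu * (sqrt (gap nu x) / nu)).
  - apply Rmult_le_compat_l; [lra|]. apply atan_le, Rdiv_le_0_compat; lra.
  - apply Req_le. field. exact Hn.
Qed.

Lemma theta_tilde_le (nu x : R) : 0 <= nu -> theta_tilde nu x <= sqrt (gap nu x) - PI / 4.
Proof.
  intros H. unfold theta_tilde. fold (gap nu x).
  pose proof (acos_bound (nu / x)). assert (0 <= nu * acos (nu / x)) by (apply Rmult_le_pos; lra). lra.
Qed.

Lemma corr_ge (nu x : R) : 0 <= nu < x -> / (8 * sqrt (gap nu x)) <= corr nu x.
Proof.
  intros H. pose proof (gap_pos nu x H) as P. pose proof (sqrt_lt_R0 _ P) as S.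
  unfold corr.
  replace (/ (8 * sqrt (gap nu x))) with (3 * gap nu x / (24 * (gap nu x * sqrt (gap nu x)))) by (field; lra).
  apply Rmult_le_compat_r.
  - left; apply Rinv_0_lt_compat. repeat apply Rmult_lt_0_compat; lra.
  - unfold gap. pose proof (pow2_ge_0 nu). lra.
Qed.

(** Test points above [nu] at which the elementary bounds on the comparison phases
    become explicit. *)
Lemma near_turning (nu e : R) : 0 <= nu -> 0 < e ->
  nu < sqrt (nu ^ 2 + e ^ 2) /\ sqrt (gap nu (sqrt (nu ^ 2 + e ^ 2))) = e.
Proof.
  intros Hn He. assert (0 < e ^ 2) by nra. pose proof (pow2_ge_0 nu).
  split.
  - rewrite <- (sqrt_pow2 nu) at 1 by exact Hn. apply sqrt_lt_1_alt. lra.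
  - unfold gap. rewrite pow2_sqrt by lra.
    replace (nu ^ 2 + e ^ 2 - nu ^ 2) with (e ^ 2) by ring. apply sqrt_pow2. lra.
Qed.

(** * The phase of the Bessel functions *)

Definition modsq (nu x : R) : R := bessel_J nu x ^ 2 + bessel_Y nu x ^ 2.

Definition is_phase (nu : R) (th : R -> R) : Prop :=
  forall x, 0 < x ->
    is_derive th x (kamp ^ 2 / (x * modsq nu x)) /\
    bessel_J nu x = sqrt (modsq nu x) * cos (th x) /\
    bessel_Y nu x = sqrt (modsq nu x) * sin (th x).

Lemma modsq_pos (nu x : R) : 0 < x -> 0 < modsq nu x.
Proof.
  intros Hx. unfold modsq. pose proof (wronskian_J_Y nu x Hx) as W. pose proof kamp_pos.
  unfold wronskian in W.
  destruct (Req_dec (bessel_J nu x) 0) as [E|E].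
  - destruct (Req_dec (bessel_Y nu x) 0) as [E2|E2].
    + rewrite E, E2 in W. assert (0 < kamp ^ 2) by (apply pow_lt; assumption). lra.
    + pose proof (pow2_gt_0 _ E2). pose proof (pow2_ge_0 (bessel_J nu x)). lra.
  - pose proof (pow2_gt_0 _ E). pose proof (pow2_ge_0 (bessel_Y nu x)). lra.
Qed.

Lemma Phi_near_0 (nu : R) : 0 <= nu -> exists x1, 0 < x1 <= 1 /\
  forall x, 0 < x <= x1 -> 0 < Phi nu ((x / 2) ^ 2) <= 2 * rGamma (nu + 1) /\
     (0 < nu -> 0 < nu * Phi nu ((x / 2) ^ 2) - x ^ 2 / 2 * Phi (nu + 1) ((x / 2) ^ 2)).
Proof.
  intros Hn. assert (G : 0 < rGamma (nu + 1)) by (apply rGamma_pos; lra).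
  assert (G2 : 0 < rGamma (nu + 1 + 1)) by (apply rGamma_pos; lra).
  assert (C : forall m e, 0 < e -> exists d, 0 < d /\ forall y, Rabs y < d ->
     Rabs (Phi m y - rGamma (m + 1)) < e).
  { intros m e He.
    destruct (derive_cont_pt _ _ _ (is_derive_Phi m 0) e He) as [d [Hd H]].
    exists d. split; [exact Hd|]. intros y Hy. rewrite <- Phi_0.
    destruct (Req_dec y 0) as [->|Hy0]; [rewrite Rminus_diag, Rabs_R0; exact He|].
    apply H. split; [split; [exact I|auto]|]. simpl. unfold Rdist. rewrite Rminus_0_r. exact Hy. }
  destruct (C nu (rGamma (nu + 1) / 2)) as [d1 [Hd1 H1]]; [lra|].
  destruct (C (nu + 1) (rGamma (nu + 1 + 1))) as [d2 [Hd2 H2]]; [lra|].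
  assert (HE : exists e, 0 < e /\ (0 < nu -> e * (4 * rGamma (nu + 1 + 1)) <= nu * rGamma (nu + 1))).
  { destruct (Req_dec nu 0) as [Z|Z].
    - exists 1. split; lra.
    - exists (nu * rGamma (nu + 1) / (4 * rGamma (nu + 1 + 1))). split.
      + apply Rdiv_lt_0_compat; [apply Rmult_lt_0_compat|]; lra.
      + intros _. apply Req_le. field. lra. }
  destruct HE as [e [He HE]].
  set (x1 := Rmin (Rmin 1 e) (Rmin d1 d2)).
  assert (X0 : 0 < x1) by (repeat apply Rmin_glb_lt; lra).
  assert (X1 : x1 <= 1) by (eapply Rle_trans; [apply Rmin_l|apply Rmin_l]).
  assert (Xe : x1 <= e) by (eapply Rle_trans; [apply Rmin_l|apply Rmin_r]).
  assert (Xd1 : x1 <= d1) by (eapply Rle_trans; [apply Rmin_r|apply Rmin_l]).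
  assert (Xd2 : x1 <= d2) by (eapply Rle_trans; [apply Rmin_r|apply Rmin_r]).
  exists x1. split; [lra|]. intros x Hx.
  assert (Hy : Rabs ((x / 2) ^ 2) < x1).
  { rewrite Rabs_right by (apply Rle_ge, pow2_ge_0). nra. }
  specialize (H1 ((x / 2) ^ 2) ltac:(lra)). specialize (H2 ((x / 2) ^ 2) ltac:(lra)).
  apply Rabs_lt_between in H1. apply Rabs_lt_between in H2.
  set (A := Phi nu ((x / 2) ^ 2)) in *. set (B := Phi (nu + 1) ((x / 2) ^ 2)) in *.
  split; [lra|]. intros Hn0. specialize (HE Hn0).
  assert (B1 : x ^ 2 / 2 * B < x ^ 2 / 2 * (2 * rGamma (nu + 1 + 1)))
    by (apply Rmult_lt_compat_l; [nra|lra]).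
  assert (B2 : x ^ 2 / 2 * (2 * rGamma (nu + 1 + 1)) <= e * rGamma (nu + 1 + 1)).
  { replace (x ^ 2 / 2 * (2 * rGamma (nu + 1 + 1))) with (x ^ 2 * rGamma (nu + 1 + 1)) by field.
    apply Rmult_le_compat_r; [lra|]. nra. }
  assert (B3 : nu * (rGamma (nu + 1) / 2) < nu * A) by (apply Rmult_lt_compat_l; lra).
  assert (0 < nu * rGamma (nu + 1)) by (apply Rmult_lt_0_compat; lra). lra.
Qed.

Lemma continuity_J (nu x : R) : 0 < x -> continuity_pt (bessel_J nu) x.
Proof. intros Hx. exact (derive_cont_pt _ _ _ (proj1 (bessel_sol_J nu x Hx))). Qed.

Lemma J_small_bounds (nu : R) : 0 <= nu -> exists x1 M, 0 < x1 /\ 0 < M /\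
  forall x, 0 < x <= x1 -> 0 < bessel_J nu x <= M /\ (0 < nu -> 0 < x * bessel_J' nu x).
Proof.
  intros Hn. destruct (Phi_near_0 nu Hn) as [x1 [H1 H]].
  assert (G : 0 < rGamma (nu + 1)) by (apply rGamma_pos; lra).
  exists x1, (2 * rGamma (nu + 1)). split; [lra|]. split; [lra|].
  intros x Hx. destruct (H x Hx) as [HP HQ].
  pose proof (Rpower_pos (x / 2) nu) as P.
  assert (P1 : Rpower (x / 2) nu <= 1).
  { unfold Rpower. rewrite <- exp_0. apply exp_le.
    assert (ln (x / 2) <= 0) by (rewrite <- ln_1; apply ln_le; lra). nra. }
  split.
  - rewrite bessel_J_Phi. split; [apply Rmult_lt_0_compat; lra|].
    rewrite <- (Rmult_1_l (2 * _)). apply Rmult_le_compat; lra.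
  - intros Hn0. specialize (HQ Hn0).
    replace (x * bessel_J' nu x) with (Rpower (x / 2) nu *
       (nu * Phi nu ((x / 2) ^ 2) - x ^ 2 / 2 * Phi (nu + 1) ((x / 2) ^ 2))).
    + apply Rmult_lt_0_compat; assumption.
    + unfold bessel_J'. rewrite !bessel_J_Phi, Rpower_plus, Rpower_1 by lra. field. lra.
Qed.

(** Near the origin [J > 0] and [Y / J] decreases to minus infinity, since its
    derivative is [kamp^2 / (x J^2)] with [J] bounded. *)
Lemma phase_exists (nu : R) : 0 <= nu -> exists th, is_phase nu th /\
  (forall x, 0 < x -> - (PI / 2) < th x) /\
  (forall e, 0 < e -> exists x, 0 < x /\ th x < - (PI / 2) + e).
Proof.
  intros Hn. pose proof kamp_pos as K. pose proof PI_RGT_0 as HP.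
  destruct (J_small_bounds nu Hn) as [x1 [M [H1 [HM HJ]]]].
  set (J := bessel_J nu) in *. set (Y := bessel_Y nu).
  assert (J1 : 0 < J x1) by (apply HJ; lra).
  set (t0 := atan (Y x1 / J x1)).
  assert (Hsq : sqrt (1 + (Y x1 / J x1)²) = sqrt (modsq nu x1) / J x1).
  { replace (1 + (Y x1 / J x1)²) with (modsq nu x1 / J x1 ^ 2)
      by (unfold modsq, Rsqr; fold J Y; field; lra).
    rewrite sqrt_div_alt by nra. rewrite sqrt_pow2 by lra. reflexivity. }
  pose proof (sqrt_lt_R0 _ (modsq_pos nu x1 H1)) as Hm1.
  destruct (angle_lift 0 x1 t0 J Y (bessel_J' nu) (bessel_Y' nu)) as [th [Hth0 Hth]].
  - exact H1.
  - intros x Hx. apply (bessel_sol_J nu x Hx).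
  - intros x Hx. apply (bessel_sol_Y nu x Hx).
  - intros x Hx. exact (derive_cont_pt _ _ _ (proj2 (bessel_sol_J nu x Hx))).
  - intros x Hx. exact (derive_cont_pt _ _ _ (proj2 (bessel_sol_Y nu x Hx))).
  - intros x Hx. apply (modsq_pos nu x Hx).
  - unfold t0. rewrite cos_atan, Hsq. change (J x1 ^ 2 + Y x1 ^ 2) with (modsq nu x1). field. split; lra.
  - unfold t0. rewrite sin_atan, Hsq. change (J x1 ^ 2 + Y x1 ^ 2) with (modsq nu x1). field. split; lra.
  - assert (Ph : is_phase nu th).
    { intros x Hx. destruct (Hth x Hx) as [D [EJ EY]]. split; [|split; [exact EJ|exact EY]].
      eapply derive_eq; [exact D|].
      pose proof (wronskian_J_Y nu x Hx) as W. unfold wronskian in W.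
      pose proof (modsq_pos nu x Hx) as Hq.
      fold J Y in W. rewrite <- W. unfold modsq in *. fold J Y in Hq |- *. field. lra. }
    assert (Dth : forall x, 0 < x -> 0 < kamp ^ 2 / (x * modsq nu x)).
    { intros x Hx. apply Rdiv_lt_0_compat; [apply pow_lt, K|].
      apply Rmult_lt_0_compat; [exact Hx|apply modsq_pos, Hx]. }
    assert (Cth : forall x, 0 < x -> continuity_pt th x)
      by (intros x Hx; exact (derive_cont_pt _ _ _ (proj1 (Ph x Hx)))).
    assert (Small : forall x, 0 < x <= x1 -> - (PI / 2) < th x < PI / 2).
    { intros x Hx. apply (trapped th 0 (- (PI / 2)) (PI / 2) x1 x); try lra; try assumption.
      - intros t Ht. rewrite Rmin_right, Rmax_left in Ht by lra.
        assert (Pt : 0 < t <= x1) by lra.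
        destruct (Ph t ltac:(lra)) as [_ [E _]].
        pose proof (proj1 (proj1 (HJ t Pt))) as Pos. unfold J in Pos. rewrite E in Pos.
        split; intros Z; rewrite Z in Pos; [rewrite cos_neg in Pos|]; rewrite cos_PI2 in Pos; lra.
      - rewrite Hth0. unfold t0. pose proof (atan_bound (Y x1 / J x1)). lra. }
    exists th. split; [exact Ph|]. split.
    + intros x Hx. destruct (Rle_dec x x1) as [L|L]; [apply Small; lra|].
      apply Rlt_trans with (th x1); [apply Small; lra|].
      apply (increasing_of_pos_derive th (fun t => kamp ^ 2 / (t * modsq nu t)) 0); [|exact H1|lra].
      intros t Ht. split; [apply Ph, Ht|apply Dth, Ht].
    + intros e He.
      set (e' := Rmin e 1).
      assert (He' : 0 < e' <= 1) by (split; [apply Rmin_glb_lt; lra|apply Rmin_r]).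
      set (T := tan (- (PI / 2) + e')).
      set (m := kamp ^ 2 / M ^ 2).
      assert (Hm : 0 < m) by (apply Rdiv_lt_0_compat; apply pow_lt; assumption).
      set (h := fun x => Y x / J x - m * ln x).
      assert (Dh : forall x, 0 < x <= x1 -> is_derive h x (kamp ^ 2 / (x * J x ^ 2) - m / x)).
      { intros x Hx. destruct (HJ x Hx) as [[P _] _].
        pose proof (wronskian_J_Y nu x ltac:(lra)) as W. unfold wronskian in W. fold J Y in W.
        unfold h. eapply derive_eq.
        - apply derive_minus.
          + apply derive_div; [lra| |]; [apply (bessel_sol_Y nu x); lra|apply (bessel_sol_J nu x); lra].
          + apply is_derive_scal. instantiate (1 := / x). auto_derive; [lra|ring].
        - rewrite <- W. fold J Y. field. lra. }
      set (x2 := Rmin x1 (exp ((T - h x1) / m - 1))).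
      assert (X2 : 0 < x2 <= x1).
      { split; [apply Rmin_glb_lt; [lra|apply exp_pos]|apply Rmin_l]. }
      exists x2. split; [lra|].
      assert (Hh : h x2 <= h x1).
      { apply (increasing_of_derive h (fun x => kamp ^ 2 / (x * J x ^ 2) - m / x)); [lra| |].
        - intros t Ht. apply Dh. lra.
        - intros c Hc. destruct (HJ c ltac:(lra)) as [[P Q] _].
          replace (kamp ^ 2 / (c * J c ^ 2) - m / c)
            with (kamp ^ 2 * (M ^ 2 - J c ^ 2) / (c * J c ^ 2 * M ^ 2)) by (unfold m; field; lra).
          apply Rdiv_le_0_compat.
          + apply Rmult_le_pos; [apply pow2_ge_0|]. assert (J c ^ 2 <= M ^ 2) by (apply pow_incr; lra). lra.
          + apply Rmult_lt_0_compat; [apply Rmult_lt_0_compat|]; [lra|apply pow_lt; lra..]. }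
      assert (HY : Y x2 / J x2 < T).
      { assert (ln x2 <= (T - h x1) / m - 1).
        { rewrite <- (ln_exp ((T - h x1) / m - 1)). apply ln_le; [lra|apply Rmin_r]. }
        assert (m * ln x2 <= T - h x1 - m).
        { apply Rle_trans with (m * ((T - h x1) / m - 1)); [apply Rmult_le_compat_l; lra|].
          apply Req_le. field. lra. }
        unfold h in Hh at 1. lra. }
      apply Rlt_le_trans with (- (PI / 2) + e'); [|pose proof (Rmin_l e 1); unfold e'; lra].
      apply Rnot_le_lt. intros Hle.
      destruct (Ph x2 ltac:(lra)) as [_ [EJ EY]]. fold J Y in EJ, EY.
      pose proof (Small x2 ltac:(lra)) as [S1 S2].
      pose proof (sqrt_lt_R0 _ (modsq_pos nu x2 ltac:(lra))) as Hq.
      assert (Et : Y x2 / J x2 = tan (th x2)).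
      { rewrite EJ, EY. unfold tan. assert (0 < cos (th x2)) by (apply cos_gt_0; lra). field. lra. }
      rewrite Et in HY. unfold T in HY.
      destruct (Rle_lt_or_eq_dec _ _ Hle) as [L|L].
      * pose proof (tan_increasing (- (PI / 2) + e') (th x2) ltac:(lra) L ltac:(lra)). lra.
      * rewrite <- L in HY. lra.
Qed.

(** * Positivity of [J] slightly beyond the turning point *)

(** The power series is alternating with decreasing terms for [(x/2)^2 <= 3/4]. *)
Lemma J_pos_small_order (nu x : R) : 0 <= nu -> 0 < x -> x ^ 2 <= 3 -> 0 < bessel_J nu x.
Proof.
  intros Hn Hx H3. rewrite bessel_J_Phi. apply Rmult_lt_0_compat; [apply Rpower_pos|].
  set (y := (x / 2) ^ 2). assert (Hy : 0 <= y <= 3 / 4) by (unfold y; nra).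
  set (U := fun m => rGamma (nu + INR m + 1) / INR (fact m) * y ^ m).
  assert (Upos : forall m, 0 <= U m).
  { intros m. pose proof (pos_INR m). unfold U. apply Rmult_le_pos; [|apply pow_le; lra].
    apply Rdiv_le_0_compat; [left; apply rGamma_pos; lra|apply INR_fact_lt_0]. }
  assert (Urec : forall m, U (S m) = U m * (y / (INR (S m) * (nu + INR m + 1)))).
  { intros m. unfold U. pose proof (pos_INR m).
    rewrite (rGamma_rec (nu + INR m + 1)), fact_simpl, mult_INR, S_INR.
    replace (nu + (INR m + 1) + 1) with (nu + INR m + 1 + 1) by ring.
    change (y ^ S m) with (y * y ^ m). pose proof (INR_fact_lt_0 m). field. lra. }
  assert (Udec : Un_decreasing U).
  { intros m. rewrite Urec. rewrite <- (Rmult_1_r (U m)) at 2.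
    apply Rmult_le_compat_l; [apply Upos|]. pose proof (pos_INR m).
    rewrite S_INR. apply Rle_div_l; nra. }
  assert (HS : is_series (fun m => (-1) ^ m * U m) (Phi nu y)).
  { eapply is_series_ext; [|apply (PSeries_correct _ _ (ex_pseries_bcoef nu y))].
    intros m. simpl. unfold bcoef, U, scal; simpl; unfold mult; simpl.
    rewrite pow_n_pow. field. apply INR_fact_neq_0. }
  assert (U0 : Un_cv U 0).
  { apply is_lim_seq_Reals. apply is_lim_seq_abs_0.
    assert (L : is_lim_seq (fun m => (-1) ^ m * U m) 0).
    { apply ex_series_lim_0. eexists; exact HS. }
    apply is_lim_seq_abs_0 in L. eapply is_lim_seq_ext; [|exact L].
    intros m. simpl. rewrite Rabs_mult, pow_1_abs. ring. }
  destruct (alternated_series_ineq U (Phi nu y) 0 Udec U0) as [L _].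
  { apply is_lim_seq_Reals. eapply is_lim_seq_ext; [|exact HS].
    intros m. simpl. rewrite sum_n_Reals. apply sum_eq. intros i _. unfold tg_alt. reflexivity. }
  eapply Rlt_le_trans; [|exact L]. simpl. unfold tg_alt. rewrite Urec.
  assert (P0 : 0 < U 0%nat).
  { unfold U. simpl. rewrite Rmult_1_r. apply Rdiv_lt_0_compat; [apply rGamma_pos; lra|lra]. }
  simpl. rewrite Rplus_0_r.
  assert (y / (1 * (nu + 1)) <= 3 / 4).
  { apply Rle_div_l; nra. }
  nra.
Qed.

Lemma derive_xJ' (nu x : R) : 0 < x ->
  is_derive (fun x => x * bessel_J' nu x) x ((nu ^ 2 - x ^ 2) / x * bessel_J nu x).
Proof.
  intros Hx. eapply derive_eq.
  - apply (derive_mult (fun x => x)); [apply derive_id|apply (bessel_sol_J nu x Hx)].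
  - cbv beta. field. lra.
Qed.

Lemma J_pos_of_nonzero (nu x1 x : R) : 0 < x1 -> 0 < x -> 0 < bessel_J nu x1 ->
  (forall t, Rmin x1 x <= t <= Rmax x1 x -> bessel_J nu t <> 0) -> 0 < bessel_J nu x.
Proof.
  intros H1 Hx Hp Hne.
  destruct (Rtotal_order 0 (bessel_J nu x)) as [L|[L|L]]; [exact L| |].
  - exfalso. apply (Hne x); [split; [apply Rmin_r|apply Rmax_r]|auto].
  - exfalso. destruct (ivt (bessel_J nu) x x1 0) as [z [Hz E]].
    + intros t Ht. apply continuity_J. eapply Rlt_le_trans; [|apply Ht]. apply Rmin_glb_lt; assumption.
    + lra.
    + rewrite Rmin_comm, Rmax_comm in Hz. exact (Hne z Hz E).
Qed.

(** The product [x J J'] is nondecreasing on [(0, nu]], so neither factor can vanish. *)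
Lemma J_pos_to_nu (nu x : R) : 0 < nu -> 0 < x <= nu -> 0 < bessel_J nu x /\ 0 < x * bessel_J' nu x.
Proof.
  intros Hn Hx. destruct (J_small_bounds nu) as [x1 [M [H1 [_ HJ]]]]; [lra|].
  destruct (Rle_dec x x1) as [L|L].
  { destruct (HJ x ltac:(lra)) as [[P _] Q]. split; [exact P|apply Q, Hn]. }
  destruct (HJ x1 ltac:(lra)) as [[P _] Q]. specialize (Q Hn).
  assert (G : forall t, x1 <= t <= x -> 0 < bessel_J nu t * (t * bessel_J' nu t)).
  { intros t Ht. apply Rlt_le_trans with (bessel_J nu x1 * (x1 * bessel_J' nu x1)).
    - apply Rmult_lt_0_compat; assumption.
    - apply (increasing_of_derive (fun t => bessel_J nu t * (t * bessel_J' nu t))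
        (fun t => bessel_J' nu t * (t * bessel_J' nu t) + bessel_J nu t * ((nu ^ 2 - t ^ 2) / t * bessel_J nu t))).
      + lra.
      + intros s Hs. apply (derive_mult (bessel_J nu) (fun t => t * bessel_J' nu t));
          [apply (bessel_sol_J nu s); lra|apply derive_xJ'; lra].
      + intros s Hs.
        assert (0 <= (nu ^ 2 - s ^ 2) / s) by (apply Rdiv_le_0_compat; nra).
        pose proof (pow2_ge_0 (bessel_J nu s)). pose proof (pow2_ge_0 (bessel_J' nu s)).
        assert (0 <= s * bessel_J' nu s ^ 2) by (apply Rmult_le_pos; lra).
        assert (0 <= (nu ^ 2 - s ^ 2) / s * bessel_J nu s ^ 2) by (apply Rmult_le_pos; lra).
        lra. }
  assert (PJ : 0 < bessel_J nu x).
  { apply (J_pos_of_nonzero nu x1 x); try lra. intros t Ht Z.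
    rewrite Rmin_left, Rmax_right in Ht by lra. specialize (G t Ht). rewrite Z in G. lra. }
  split; [exact PJ|]. specialize (G x ltac:(lra)). nra.
Qed.

(** Comparison with [cos (K ln (x / nu))], which solves the equation with the
    constant potential [K^2] in the variable [ln x].  The quotient [Rt] of the two
    solutions and their Wronskian [W] have a nondecreasing product. *)
Lemma J_pos_beyond_nu (nu K x : R) : 0 < nu -> 0 < K -> K ^ 3 <= nu ^ 2 ->
  nu <= x -> x ^ 2 <= nu ^ 2 + K ^ 2 -> 0 < bessel_J nu x.
Proof.
  intros Hn HK HK3 Hx1 Hx2.
  destruct (J_pos_to_nu nu nu Hn ltac:(lra)) as [P Q].
  set (s := fun t => K * ln (t / nu)).
  assert (Hs : forall t, nu <= t <= x -> 0 <= s t <= 1 / 2).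
  { intros t Ht. unfold s.
    assert (L0 : 0 <= ln (t / nu)).
    { rewrite <- ln_1. apply ln_le; [lra|]. apply Rle_div_r; lra. }
    assert (L1 : 2 * ln (t / nu) <= K ^ 2 / nu ^ 2).
    { replace (2 * ln (t / nu)) with (ln ((t / nu) ^ 2)).
      - assert (Hp : 0 < (t / nu) ^ 2) by (apply pow_lt, Rdiv_lt_0_compat; lra).
        assert (Hl : ln ((t / nu) ^ 2) <= (t / nu) ^ 2 - 1).
        { rewrite <- (ln_exp ((t / nu) ^ 2 - 1)). apply ln_le; [exact Hp|].
          pose proof (exp_ineq1_le ((t / nu) ^ 2 - 1)). lra. }
        eapply Rle_trans; [exact Hl|].
        replace ((t / nu) ^ 2 - 1) with ((t ^ 2 - nu ^ 2) / nu ^ 2) by (field; lra).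
        apply Rmult_le_compat_r; [left; apply Rinv_0_lt_compat, pow_lt, Hn|].
        assert (t ^ 2 <= x ^ 2) by (apply pow_incr; lra). lra.
      - replace ((t / nu) ^ 2) with (t / nu * (t / nu)) by ring.
        rewrite ln_mult by (apply Rdiv_lt_0_compat; lra). ring. }
    split; [apply Rmult_le_pos; lra|].
    apply Rle_trans with (K * (K ^ 2 / nu ^ 2 / 2)); [apply Rmult_le_compat_l; lra|].
    replace (K * (K ^ 2 / nu ^ 2 / 2)) with (K ^ 3 / nu ^ 2 / 2) by (field; lra).
    assert (K ^ 3 / nu ^ 2 <= 1) by (apply Rle_div_l; [apply pow_lt, Hn|lra]). lra. }
  assert (Hc : forall t, nu <= t <= x -> 0 < cos (s t)).
  { intros t Ht. specialize (Hs t Ht). pose proof PI2_1. apply cos_gt_0; lra. }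
  set (Rt := fun t => bessel_J nu t / cos (s t)).
  set (W := fun t => cos (s t) * (t * bessel_J' nu t) + K * (sin (s t) * bessel_J nu t)).
  assert (Dsv : forall t, nu <= t <= x -> is_derive s t (K / t)).
  { intros t Ht. unfold s. auto_derive; [apply Rdiv_lt_0_compat; lra|]. field. lra. }
  assert (G : forall t, nu <= t <= x -> 0 < Rt t * W t).
  { intros t Ht. apply Rlt_le_trans with (Rt nu * W nu).
    - unfold Rt, W. assert (E : s nu = 0) by (unfold s, Rdiv; rewrite Rinv_r, ln_1 by lra; ring).
      rewrite E, cos_0, sin_0. apply Rmult_lt_0_compat; lra.
    - apply (increasing_of_derive (fun t => Rt t * W t)
        (fun t => W t / (t * cos (s t) ^ 2) * W t
                  + Rt t * (cos (s t) * ((nu ^ 2 + K ^ 2 - t ^ 2) / t * bessel_J nu t)))).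
      + lra.
      + intros r Hr. assert (Hr0 : 0 < r) by lra. pose proof (Hc r ltac:(lra)) as C.
        assert (Dc : is_derive (fun t => cos (s t)) r (- sin (s r) * (K / r)))
          by (apply derive_comp; [apply is_derive_cos|apply Dsv; lra]).
        assert (Ds : is_derive (fun t => sin (s t)) r (cos (s r) * (K / r)))
          by (apply derive_comp; [apply is_derive_sin|apply Dsv; lra]).
        pose proof (proj1 (bessel_sol_J nu r Hr0)) as DJ.
        apply derive_mult.
        * unfold Rt. eapply derive_eq; [apply derive_div; [lra|exact DJ|exact Dc]|].
          unfold W. field. lra.
        * unfold W. eapply derive_eq.
          -- apply derive_plus; [apply derive_mult; [exact Dc|apply derive_xJ', Hr0]|].
             apply is_derive_scal. apply derive_mult; [exact Ds|exact DJ].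
          -- cbv beta. field. lra.
      + intros r Hr. pose proof (Hc r ltac:(lra)) as C.
        replace (W r / (r * cos (s r) ^ 2) * W r
                  + Rt r * (cos (s r) * ((nu ^ 2 + K ^ 2 - r ^ 2) / r * bessel_J nu r)))
          with (W r ^ 2 / (r * cos (s r) ^ 2) + (nu ^ 2 + K ^ 2 - r ^ 2) / r * bessel_J nu r ^ 2)
          by (unfold Rt; field; lra).
        assert (r ^ 2 <= x ^ 2) by (apply pow_incr; lra).
        assert (0 <= W r ^ 2 / (r * cos (s r) ^ 2)).
        { apply Rdiv_le_0_compat; [apply pow2_ge_0|]. apply Rmult_lt_0_compat; [lra|apply pow_lt, C]. }
        assert (0 <= (nu ^ 2 + K ^ 2 - r ^ 2) / r * bessel_J nu r ^ 2).
        { apply Rmult_le_pos; [|apply pow2_ge_0]. apply Rdiv_le_0_compat; lra. }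
        lra. }
  apply (J_pos_of_nonzero nu nu x); try lra. intros t Ht Z.
  rewrite Rmin_left, Rmax_right in Ht by lra. specialize (G t Ht). unfold Rt in G. rewrite Z in G.
  unfold Rdiv in G. rewrite !Rmult_0_l in G. lra.
Qed.

(** At [x0] the function [J] has not vanished yet, although [theta_low] has already
    come within a bounded distance of [theta_tilde].  For large [nu] the natural scale
    is [x0^2 - nu^2 = nu^(4/3)]; for small [nu] a fixed point works. *)
Lemma J_pos_witness (nu : R) : 0 <= nu ->
  exists x0, nu < x0 /\ corr nu x0 <= 1 /\ forall x, 0 < x <= x0 -> 0 < bessel_J nu x.
Proof.
  intros Hn. destruct (Rle_dec nu 1) as [L|L].
  - exists (sqrt 3). assert (H3 : sqrt 3 ^ 2 = 3) by (apply pow2_sqrt; lra).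
    pose proof (sqrt_pos 3) as Hp.
    split; [|split].
    + nra.
    + unfold corr, gap. rewrite H3.
      assert (Hg : 2 <= 3 - nu ^ 2) by nra.
      assert (Hs : 1 <= sqrt (3 - nu ^ 2)) by (rewrite <- sqrt_1; apply sqrt_le_1_alt; lra).
      apply Rle_div_l; [nra|]. nra.
    + intros x Hx. apply J_pos_small_order; try lra. rewrite <- H3. apply pow_incr; lra.
  - set (K := Rpower nu (2 / 3)).
    assert (HK : 0 < K) by apply Rpower_pos.
    assert (HK3 : K ^ 3 = nu ^ 2).
    { rewrite <- !Rpower_pow by (try exact HK; lra). unfold K. rewrite Rpower_mult. f_equal. simpl. field. }
    assert (HKn : K <= nu).
    { apply Rnot_lt_le. intros H. assert (nu ^ 3 < K ^ 3) by (rewrite <- !tech_pow_Rmult; nra). nra. }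
    destruct (near_turning nu K Hn HK) as [T1 T2].
    set (x0 := sqrt (nu ^ 2 + K ^ 2)) in *.
    assert (E0 : x0 ^ 2 = nu ^ 2 + K ^ 2) by (apply pow2_sqrt; nra).
    exists x0. split; [exact T1|split].
    + unfold corr. rewrite T2. unfold gap. rewrite E0.
      replace (24 * ((nu ^ 2 + K ^ 2 - nu ^ 2) * K)) with (24 * nu ^ 2) by (rewrite <- HK3; ring).
      apply Rle_div_l; [nra|]. nra.
    + intros x Hx. destruct (Rle_dec x nu) as [Lx|Lx].
      * apply J_pos_to_nu; lra.
      * apply (J_pos_beyond_nu nu K); try lra.
        rewrite <- E0. apply pow_incr; lra.
Qed.

(** * Two-sided bounds for the Bessel phase *)

(** The substitution [u = sqrt x f] removes the first-order term. *)
Definition normal1 (f f1 : R -> R) (x : R) : R := sqrt x * (f1 x + f x / (2 * x)).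

Lemma derive_normal (nu x : R) (f f1 : R -> R) : 0 < x -> bessel_sol nu f f1 ->
  is_derive (fun x => sqrt x * f x) x (normal1 f f1 x) /\
  is_derive (normal1 f f1) x (- (potential nu x * (sqrt x * f x))).
Proof.
  intros Hx S. destruct (S x Hx) as [D D1]. split.
  - apply sqrt_mult_derive; assumption.
  - unfold normal1. eapply derive_eq.
    + apply (sqrt_mult_derive (fun x => f1 x + f x / (2 * x))); [exact Hx|].
      apply derive_plus; [exact D1|]. apply derive_div; [lra|exact D|].
      instantiate (1 := 2). auto_derive; [exact I|ring].
    + unfold potential. field. lra.
Qed.

Lemma wave_normal1 (A a : R) (f f1 : R -> R) : wave A a f f1 ->
  vanish (fun x => normal1 f f1 x + A * sin (x - a)).
Proof.
  intros [F F1].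
  apply vanish_ext with (X := 0) (f := fun x =>
    1 * (sqrt x * f1 x + A * sin (x - a)) + / 2 * ((sqrt x * f x) * / x)).
  - intros x Hx. unfold normal1. field. lra.
  - apply vanish_lin; [exact F1|]. apply vanish_mult; [|apply vanish_inv].
    eapply ebounded_close; [|exact F]. apply ebounded_scal, ebounded_cos_shift.
Qed.

Lemma continuity_potential (nu x : R) : 0 < x -> continuity_pt (potential nu) x.
Proof.
  intros Hx. apply continuity_smooth. unfold potential. auto_derive. 
  apply (pow_nonzero x 2). lra.
Qed.

Lemma continuity_ka1_t (nu x : R) : 0 <= nu < x -> continuity_pt (ka1_t nu) x.
Proof.
  intros H. pose proof (gap_pos nu x H) as P. apply continuity_smooth.
  unfold ka1_t, gap in *. auto_derive.
  apply Rgt_not_eq. apply Rmult_lt_0_compat; [nra|]. apply (pow_lt _ 2 P).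
Qed.

Lemma continuity_ka1_l (nu x : R) : 0 <= nu < x -> continuity_pt (ka1_l nu) x.
Proof.
  intros H. pose proof (gap_pos nu x H) as P. pose proof (hh_nonneg nu x H) as Hh.
  pose proof (derive_cont_pt _ _ _ (derive_hh nu x H)) as C0.
  pose proof (derive_cont_pt _ _ _ (derive_hh1 nu x H)) as C1.
  assert (C2 : continuity_pt (hh2 nu) x).
  { apply continuity_smooth. unfold hh2, hp, hpp, gap in *. auto_derive.
    repeat split; try (apply (pow_nonzero _ 2); lra); try (apply (pow_nonzero _ 3); lra);
      try (apply (pow_nonzero _ 4); lra); try (apply (pow_nonzero _ 5); lra). }
  assert (Cc : forall c, continuity_pt (fun _ : R => c) x).
  { intros c. apply continuity_smooth. auto_derive. exact I. }
  assert (C3 : continuity_pt (fun x => 1 + hh nu x) x) by (apply (continuity_pt_plus (fun _ => 1)); auto).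
  apply (continuity_pt_plus (ka1_t nu)); [apply continuity_ka1_t, H|].
  apply (continuity_pt_div (fun x => hh2 nu x * (1 + hh nu x) - hh1 nu x ^ 2)
           (fun x => 2 * (1 + hh nu x) ^ 2)).
  - apply (continuity_pt_minus (fun x => hh2 nu x * (1 + hh nu x)) (fun x => hh1 nu x ^ 2)).
    + apply (continuity_pt_mult (hh2 nu)); assumption.
    + apply (continuity_pt_mult (hh1 nu) (fun x => hh1 nu x * 1)); [exact C1|].
      apply (continuity_pt_mult (hh1 nu) (fun _ => 1)); auto.
  - apply (continuity_pt_mult (fun _ => 2)); [apply Cc|].
    apply (continuity_pt_mult (fun x => 1 + hh nu x) (fun x => (1 + hh nu x) * 1)); [exact C3|].
    apply (continuity_pt_mult (fun x => 1 + hh nu x) (fun _ => 1)); auto.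
  - apply Rgt_not_eq. apply Rmult_lt_0_compat; [lra|]. apply (pow_lt _ 2). lra.
Qed.

Lemma phase_compare (nu L : R) (th th2 psi ka ka1 : R -> R) (x0 : R) :
  0 <= nu -> is_phase nu th -> nu < x0 ->
  (forall x, nu < x -> is_derive th2 x (psi x) /\ is_derive psi x (2 * ka x * psi x) /\
     is_derive ka x (ka1 x) /\ continuity_pt ka1 x /\ 0 < psi x) ->
  vanish (fun x => psi x - 1) -> vanish ka ->
  vanish (fun x => th2 x - (x - phase nu)) -> vanish (fun x => th x - (x - phase nu) - L) ->
  exists z w, z x0 = th x0 - th2 x0 /\ vanish (fun x => z x - L) /\
    (forall x, nu < x -> 0 <= w x /\
       is_derive z x ((potential nu x - (psi x ^ 2 + ka1 x - ka x ^ 2)) * w x)) /\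
    ~ (forall x, x0 < x -> w x = 0).
Proof.
  intros Hn Hph H0 D2 Vpsi Vka V2 Vth. pose proof kamp_pos as K.
  destruct (wave_J nu) as [WJ WJ1]. destruct (wave_Y nu) as [WY WY1].
  apply (phase_shift nu kamp (phase nu) (kamp ^ 2) L (potential nu)
    (fun x => sqrt x * bessel_J nu x) (normal1 (bessel_J nu) (bessel_J' nu))
    (fun x => sqrt x * bessel_Y nu x) (normal1 (bessel_Y nu) (bessel_Y' nu))
    (fun x => sqrt x * sqrt (modsq nu x)) th th2 psi ka ka1 x0).
  - exact Hn.
  - exact K.
  - apply pow_lt, K.
  - exact H0.
  - intros x Hx. apply derive_normal; [lra|apply bessel_sol_J].
  - intros x Hx. apply derive_normal; [lra|apply bessel_sol_Y].
  - intros x Hx. assert (Hx0 : 0 < x) by lra. rewrite <- (wronskian_J_Y nu x Hx0).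
    rewrite wronskian_sqrt by exact Hx0. unfold normal1. field. lra.
  - intros x Hx. assert (Hx0 : 0 < x) by lra. destruct (Hph x Hx0) as [_ [EJ EY]].
    split; [|split].
    + apply Rmult_lt_0_compat; apply sqrt_lt_R0; [exact Hx0|apply modsq_pos, Hx0].
    + rewrite EJ at 1. ring.
    + rewrite EY at 1. ring.
  - intros x Hx. assert (Hx0 : 0 < x) by lra. exact (derive_cont_pt _ _ _ (proj1 (Hph x Hx0))).
  - intros x Hx. apply continuity_potential. lra.
  - exact WJ.
  - apply wave_normal1, wave_J.
  - eapply vanish_ext; [|exact WY]. intros x _; simpl.
    replace (x - (phase nu + PI / 2)) with (x - phase nu - PI / 2) by ring.
    rewrite cos_minus_PI2. reflexivity.
  - eapply vanish_ext; [|apply (wave_normal1 _ _ _ _ (wave_Y nu))]. intros x _; simpl.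
    replace (x - (phase nu + PI / 2)) with (x - phase nu - PI / 2) by ring.
    rewrite sin_minus_PI2. ring.
  - exact D2.
  - exact Vpsi.
  - exact Vka.
  - apply vanish_ext with (X := 0) (f := fun x =>
      1 * (th x - (x - phase nu) - L) + -1 * (th2 x - (x - phase nu))).
    + intros x _. ring.
    + apply vanish_lin; assumption.
  Unshelve. all: exact 0.
Qed.

Lemma psi_t_pos (nu x : R) : 0 <= nu < x -> 0 < psi_t nu x.
Proof.
  intros H. unfold psi_t. apply Rdiv_lt_0_compat; [apply sqrt_lt_R0, gap_pos, H|lra].
Qed.

Lemma psi_l_pos (nu x : R) : 0 <= nu < x -> 0 < psi_l nu x.
Proof.
  intros H. pose proof (hh_nonneg nu x H). apply Rmult_lt_0_compat; [apply psi_t_pos, H|lra].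
Qed.

Lemma phase_lt_tilde (nu L x : R) (th : R -> R) : 0 <= nu -> is_phase nu th ->
  vanish (fun x => th x - (x - phase nu) - L) -> nu < x -> th x < theta_tilde nu x + L.
Proof.
  intros Hn Hph V Hx.
  destruct (phase_compare nu L th (theta_tilde nu) (psi_t nu) (ka_t nu) (ka1_t nu) x)
    as [z [w [Ez [Vz [Hz Nz]]]]]; try assumption.
  - intros t Ht. assert (H : 0 <= nu < t) by lra.
    split; [apply derive_theta_tilde, H|]. split; [apply derive_psi_t, H|].
    split; [apply derive_ka_t, H|]. split; [apply continuity_ka1_t, H|apply psi_t_pos, H].
  - apply vanish_psi_t, Hn.
  - apply vanish_ka_t, Hn.
  - apply vanish_theta_tilde, Hn.
  - assert (- L < - z x); [|lra].
    apply (monotone_limit (fun t => - z t)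
      (fun t => - ((potential nu t - (psi_t nu t ^ 2 + ka1_t nu t - ka_t nu t ^ 2)) * w t)) x (- L)).
    + intros t Ht. apply (is_derive_opp z). apply Hz. lra.
    + intros t Ht. destruct (Hz t ltac:(lra)) as [Hw _]. pose proof (tilde_below nu t ltac:(lra)). nra.
    + intros Hall. apply Nz. intros t Ht. specialize (Hall t Ht). simpl in Hall.
      pose proof (tilde_below nu t ltac:(lra)).
      apply Rmult_eq_reg_l with (potential nu t - (psi_t nu t ^ 2 + ka1_t nu t - ka_t nu t ^ 2)); lra.
    + apply vanish_ext with (X := 0) (f := fun t => -1 * (z t - L)).
      * intros t _. ring.
      * apply vanish_mult; [apply ebounded_const|exact Vz].
Qed.

Lemma low_lt_phase (nu L x : R) (th : R -> R) : 0 <= nu -> is_phase nu th ->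
  vanish (fun x => th x - (x - phase nu) - L) -> nu < x -> theta_low nu x + L < th x.
Proof.
  intros Hn Hph V Hx.
  destruct (phase_compare nu L th (theta_low nu) (psi_l nu) (ka_l nu) (ka1_l nu) x)
    as [z [w [Ez [Vz [Hz Nz]]]]]; try assumption.
  - intros t Ht. assert (H : 0 <= nu < t) by lra.
    split; [apply derive_theta_low, H|]. split; [apply derive_psi_l, H|].
    split; [apply derive_ka_l, H|]. split; [apply continuity_ka1_l, H|apply psi_l_pos, H].
  - apply vanish_psi_l, Hn.
  - apply vanish_ka_l, Hn.
  - apply vanish_theta_low, Hn.
  - assert (L < z x); [|lra].
    apply (monotone_limit z
      (fun t => (potential nu t - (psi_l nu t ^ 2 + ka1_l nu t - ka_l nu t ^ 2)) * w t) x L).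
    + intros t Ht. apply Hz. lra.
    + intros t Ht. destruct (Hz t ltac:(lra)) as [Hw _]. pose proof (low_above nu t ltac:(lra)). nra.
    + intros Hall. apply Nz. intros t Ht. specialize (Hall t Ht). simpl in Hall.
      pose proof (low_above nu t ltac:(lra)).
      apply Rmult_eq_reg_l with (potential nu t - (psi_l nu t ^ 2 + ka1_l nu t - ka_l nu t ^ 2)); lra.
    + exact Vz.
Qed.

Lemma reduce_angle (t : R) : exists m : Z, - PI <= t - 2 * PI * IZR m <= PI.
Proof.
  pose proof PI_RGT_0 as HP.
  exists (up (t / (2 * PI) - / 2)).
  destruct (archimed (t / (2 * PI) - / 2)) as [A B].
  set (m := IZR (up (t / (2 * PI) - / 2))) in *.
  assert (E : t = 2 * PI * (t / (2 * PI))) by (field; lra).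
  split.
  - rewrite E at 1. nra.
  - rewrite E at 1. nra.
Qed.

(** The asymptotics fix the direction [(cos th, sin th)], hence [th] modulo [2 PI]. *)
Lemma phase_limit (nu : R) (th : R -> R) : 0 <= nu -> is_phase nu th ->
  exists m : Z, vanish (fun x => th x - (x - phase nu) - 2 * PI * IZR m).
Proof.
  intros Hn Hph. pose proof kamp_pos as K. pose proof PI_RGT_0 as HP.
  destruct (wave_J nu) as [WJ _]. destruct (wave_Y nu) as [WY _].
  set (g := fun x => x - phase nu).
  assert (V : vanish (fun x => cos (th x - g x) - 1)).
  { apply (angles_close kamp (fun x => sqrt x * sqrt (modsq nu x)) (fun _ => kamp) th g g K).
    - eapply vanish_ext; [|exact WJ]. intros x Hx; simpl.
      destruct (Hph x Hx) as [_ [EJ _]]. rewrite EJ. unfold g. ring.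
    - eapply vanish_ext; [|exact WY]. intros x Hx; simpl.
      destruct (Hph x Hx) as [_ [_ EY]]. rewrite EY.
      replace (x - (phase nu + PI / 2)) with (x - phase nu - PI / 2) by ring.
      rewrite cos_minus_PI2. unfold g. ring.
    - apply vanish_ext with (X := 0) (f := fun x => 0 * / x); [intros; ring|].
      apply vanish_mult; [apply ebounded_const|apply vanish_inv].
    - apply vanish_ext with (X := 0) (f := fun x => 0 * / x); [intros; ring|].
      apply vanish_mult; [apply ebounded_const|apply vanish_inv].
    - intros x. apply Rmult_le_pos; apply sqrt_pos.
    - intros _. lra. }
  assert (V' := V). rewrite vanish_spec in V'. destruct (V' 1 Rlt_0_1) as [X0 HX].
  set (X := Rmax X0 0). pose proof (Rmax_l X0 0) as M1. pose proof (Rmax_r X0 0) as M2.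
  assert (Hcos : forall x, X < x -> 0 < cos (th x - g x)).
  { intros x Hx. specialize (HX x ltac:(unfold X in Hx; lra)). apply Rabs_lt_between in HX. lra. }
  destruct (reduce_angle (th (X + 1) - g (X + 1))) as [m Hm].
  exists m.
  set (f := fun x => th x - g x - 2 * PI * IZR m).
  assert (Ec : forall x, cos (f x) = cos (th x - g x)).
  { intros x. unfold f.
    replace (th x - g x - 2 * PI * IZR m) with (th x - g x + 2 * IZR (- m) * PI)
      by (rewrite opp_IZR; ring).
    destruct (Z.le_ge_cases 0 (- m)) as [Hm0|Hm0].
    - rewrite <- (Z2Nat.id (- m)) by exact Hm0. rewrite <- INR_IZR_INZ. apply cos_period.
    - rewrite <- (cos_period _ (Z.to_nat m)). f_equal.
      rewrite INR_IZR_INZ, Z2Nat.id by lia. rewrite opp_IZR. ring. }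
  assert (Hpi : forall x, X < x -> f x <> - PI /\ f x <> PI).
  { intros x Hx. specialize (Hcos x Hx). rewrite <- Ec in Hcos.
    split; intros E; rewrite E in Hcos; [rewrite cos_neg in Hcos|]; rewrite cos_PI in Hcos; lra. }
  assert (Hf : forall x, X < x -> - PI < f x < PI).
  { intros x Hx. apply (trapped f X (- PI) PI (X + 1) x).
    - intros t Ht. apply (continuity_pt_minus (fun x => th x - g x) (fun _ => 2 * PI * IZR m)).
      + apply (continuity_pt_minus th g).
        * assert (Ht0 : 0 < t) by (unfold X in Ht; lra).
          exact (derive_cont_pt _ _ _ (proj1 (Hph t Ht0))).
        * apply continuity_smooth. unfold g. auto_derive. exact I.
      + apply continuity_smooth. auto_derive. exact I.
    - lra.
    - exact Hx.
    - intros t Ht. apply Hpi. eapply Rlt_le_trans; [|apply Ht]. apply Rmin_glb_lt; lra.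
    - destruct (Hpi (X + 1) ltac:(lra)) as [N1 N2]. unfold f in *.
      destruct Hm as [[A|A] [B|B]]; try (exfalso; apply N1; rewrite A; reflexivity);
        try (exfalso; apply N2; exact B). split; assumption. }
  apply (small_of_cos f X Hf).
  apply vanish_ext with (X := 0) (f := fun x => cos (th x - g x) - 1); [|exact V].
  intros x _. rewrite Ec. reflexivity.
Qed.

Lemma phase_increasing (nu x y : R) (th : R -> R) : is_phase nu th -> 0 < x -> x < y -> th x < th y.
Proof.
  intros Hph Hx Hy.
  apply (increasing_of_pos_derive th (fun t => kamp ^ 2 / (t * modsq nu t)) 0); [|exact Hx|exact Hy].
  intros t Ht. split; [apply Hph, Ht|].
  apply Rdiv_lt_0_compat; [apply pow_lt, kamp_pos|].
  apply Rmult_lt_0_compat; [exact Ht|apply modsq_pos, Ht].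
Qed.

(** The limit is a multiple of [2 PI]; near [nu] the phase exceeds [- PI/2]
    while the upper comparison phase is close to [- PI/4], and at a point where
    [J] has not yet vanished the lower one exceeds the phase minus [2 PI]. *)
Lemma phase_limit_0 (nu : R) (th : R -> R) : 0 <= nu -> is_phase nu th ->
  (forall x, 0 < x -> - (PI / 2) < th x) ->
  (forall e, 0 < e -> exists x, 0 < x /\ th x < - (PI / 2) + e) ->
  vanish (fun x => th x - (x - phase nu) - 0).
Proof.
  intros Hn Hph Hlow Hinf. destruct (phase_limit nu th Hn Hph) as [m V].
  pose proof PI2_1 as HP.
  assert (M1 : (-1 < m)%Z).
  { destruct (near_turning nu (1 / 10) Hn) as [T1 T2]; [lra|].
    set (x := sqrt (nu ^ 2 + (1 / 10) ^ 2)) in *.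
    pose proof (phase_lt_tilde nu _ x th Hn Hph V T1) as U.
    pose proof (theta_tilde_le nu x Hn) as U2. rewrite T2 in U2.
    pose proof (Hlow x ltac:(lra)) as U3.
    apply lt_IZR. apply Rmult_lt_reg_l with PI; lra. }
  assert (M2 : (m < 1)%Z).
  { destruct (J_pos_witness nu Hn) as [x0 [W1 [W2 W3]]].
    pose proof (low_lt_phase nu _ x0 th Hn Hph V W1) as U.
    rewrite theta_low_eq in U by lra.
    pose proof (theta_tilde_ge nu x0 ltac:(lra)) as U2.
    assert (U3 : th x0 < PI / 2).
    { destruct (Hinf 1 Rlt_0_1) as [x1 [P1 P2]].
      destruct (Rle_dec x0 x1) as [L|L].
      - destruct L as [L|L].
        + pose proof (phase_increasing nu x0 x1 th Hph ltac:(lra) L). lra.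
        + rewrite L. lra.
      - apply (trapped th 0 (- (PI / 2)) (PI / 2) x1 x0); try lra.
        + intros t Ht. exact (derive_cont_pt _ _ _ (proj1 (Hph t Ht))).
        + intros t Ht. rewrite Rmin_left, Rmax_right in Ht by lra.
          destruct (Hph t ltac:(lra)) as [_ [E _]].
          pose proof (W3 t ltac:(lra)) as Pos. rewrite E in Pos.
          split; intros Z; rewrite Z in Pos; [rewrite cos_neg in Pos|]; rewrite cos_PI2 in Pos; lra.
        + split; [apply Hlow, P1|lra]. }
    apply lt_IZR. apply Rmult_lt_reg_l with PI; lra. }
  assert (m = 0%Z) by lia. subst m.
  apply vanish_ext with (2 := V) (X := 0). intros x _. ring.
Qed.

(** * Zeros *)

Lemma phase_surjective (nu y : R) (th : R -> R) : is_phase nu th ->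
  (forall e, 0 < e -> exists x, 0 < x /\ th x < - (PI / 2) + e) ->
  vanish (fun x => th x - (x - phase nu) - 0) ->
  - (PI / 2) < y -> exists x, 0 < x /\ th x = y.
Proof.
  intros Hph Hinf V Hy.
  destruct (Hinf (y + PI / 2)) as [x1 [P1 P2]]; [lra|].
  rewrite vanish_spec in V. destruct (V 1 Rlt_0_1) as [X HX].
  set (x2 := Rmax (Rmax X 1) (y + phase nu + 2) + 1).
  pose proof (Rmax_l (Rmax X 1) (y + phase nu + 2)). pose proof (Rmax_r (Rmax X 1) (y + phase nu + 2)).
  pose proof (Rmax_l X 1). pose proof (Rmax_r X 1).
  specialize (HX x2 ltac:(unfold x2; lra)). apply Rabs_lt_between in HX.
  assert (Hx2 : 0 < x2) by (unfold x2; lra).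
  destruct (ivt th x1 x2 y) as [z [Hz E]].
  - intros t Ht. assert (Ht0 : 0 < t) by (eapply Rlt_le_trans; [|apply Ht]; apply Rmin_glb_lt; assumption).
    exact (derive_cont_pt _ _ _ (proj1 (Hph t Ht0))).
  - unfold x2 in *. lra.
  - exists z. split; [|exact E]. eapply Rlt_le_trans; [|apply Hz]. apply Rmin_glb_lt; assumption.
Qed.

(** No zero lies strictly between consecutive levels of the phase, so the recursion
    defining the zeros visits the levels one after the other, starting with the
    first level above [- PI/2]. *)
Lemma kth_pos_zero_phase (f th : R -> R) (b : R) : 0 < b <= PI ->
  (forall x y, 0 < x -> x < y -> th x < th y) ->
  (forall x, 0 < x -> - (PI / 2) < th x) ->
  (forall y, - (PI / 2) < y -> exists x, 0 < x /\ th x = y) ->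
  (forall x, 0 < x -> (f x = 0 <-> cos (th x - b) = 0)) ->
  forall k, (1 <= k)%nat ->
    0 < kth_pos_zero f k /\ th (kth_pos_zero f k) = b + PI * (INR k - 3 / 2).
Proof.
  intros Hb Hinc Hlow Hsurj Hf. pose proof PI_RGT_0 as HP.
  set (lev := fun k => b + PI * (INR k - 3 / 2)).
  assert (Hlt : forall x y, 0 < x -> 0 < y -> (x < y <-> th x < th y)).
  { intros x y Hx Hy. split; [apply Hinc, Hx|]. intros H.
    destruct (Rtotal_order x y) as [L|[L|L]]; [exact L|subst; lra|].
    specialize (Hinc y x Hy L). lra. }
  assert (Hinj : forall x y, 0 < x -> 0 < y -> th x = th y -> x = y).
  { intros x y Hx Hy E. destruct (Rtotal_order x y) as [L|[L|L]]; [|exact L|];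
      apply Hlt in L; try assumption; lra. }
  assert (Hzero : forall k x, (1 <= k)%nat -> 0 < x -> th x = lev k -> f x = 0).
  { intros k x Hk Hx E. apply Hf; [exact Hx|]. rewrite E. unfold lev.
    replace (b + PI * (INR k - 3 / 2) - b) with (- (PI / 2) + PI * (INR k - 1)) by field.
    destruct k as [|k]; [lia|]. rewrite S_INR. replace (INR k + 1 - 1) with (INR k) by ring.
    apply cos_eq_0_1. exists (Z.of_nat k - 1)%Z. rewrite minus_IZR, <- INR_IZR_INZ. field. }
  (* [after k w]: the position [w] separates the levels up to [k] from the later ones. *)
  set (after := fun k w => 0 <= w /\ forall x, 0 < x -> (w < x <-> lev k < th x)).
  assert (Hnext : forall k w z, after k w ->
     (is_next_zero f w z <-> 0 < z /\ th z = lev (S k))).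
  { intros k w z [Hw Hwx].
    assert (Hlev : - (PI / 2) < lev (S k)).
    { unfold lev. rewrite S_INR. pose proof (pos_INR k).
      assert (0 <= PI * INR k) by (apply Rmult_le_pos; lra). lra. }
    destruct (Hsurj (lev (S k)) Hlev) as [t [Ht Et]].
    assert (Hlevlt : lev k < lev (S k)) by (unfold lev; rewrite S_INR; lra).
    assert (Hbetween : forall x, 0 < x -> lev k < th x < lev (S k) -> f x <> 0).
    { intros x Hx [L1 L2] Z. apply Hf in Z; [|exact Hx]. apply cos_eq_0_0 in Z. destruct Z as [n En].
      unfold lev in L1, L2. rewrite S_INR in L2.
      replace (th x) with (b + (IZR n * PI + PI / 2)) in L1, L2 by lra.
      assert (N1 : IZR (Z.of_nat k - 2) < IZR n).
      { rewrite minus_IZR, <- INR_IZR_INZ. apply Rmult_lt_reg_r with PI; lra. }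
      assert (N2 : IZR n < IZR (Z.of_nat k - 1)).
      { rewrite minus_IZR, <- INR_IZR_INZ. apply Rmult_lt_reg_r with PI; lra. }
      apply lt_IZR in N1, N2. lia. }
    split.
    - intros [Hwz [Hz Hno]]. assert (Hz0 : 0 < z) by lra. split; [exact Hz0|].
      assert (L1 : lev k < th z) by (apply Hwx; assumption).
      destruct (Rtotal_order (th z) (lev (S k))) as [L|[L|L]]; [|exact L|].
      + exfalso. exact (Hbetween z Hz0 (conj L1 L) Hz).
      + exfalso. apply (Hno t).
        * split; [apply Hwx; [exact Ht|lra]|]. apply Hlt; lra.
        * apply (Hzero (S k)); [lia|exact Ht|exact Et].
    - intros [Hz0 Ez]. split; [apply Hwx; [exact Hz0|lra]|]. split.
      + apply (Hzero (S k)); [lia|exact Hz0|exact Ez].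
      + intros x Hx. assert (Hx0 : 0 < x) by lra. apply Hbetween; [exact Hx0|]. split.
        * apply Hwx; [exact Hx0|apply Hx].
        * rewrite <- Ez. apply (proj1 (Hlt x z Hx0 Hz0)), Hx. }
  assert (Hafter : forall k w, (1 <= k)%nat -> 0 < w -> th w = lev k -> after k w).
  { intros k w Hk Hw E. split; [lra|]. intros x Hx. rewrite <- E. apply Hlt; assumption. }
  assert (Hafter0 : after 0%nat 0).
  { split; [lra|]. intros x Hx. split; [|intros; exact Hx]. intros _.
    specialize (Hlow x Hx). unfold lev. simpl INR. lra. }
  assert (Hk : forall k z, (1 <= k)%nat -> (is_kth_pos_zero f k z <-> 0 < z /\ th z = lev k)).
  { intros k z Hk1. revert z. destruct k as [|k]; [lia|]. clear Hk1.
    induction k as [|k IH]; intros z.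
    - change (is_kth_pos_zero f 1 z) with (exists w, w = 0 /\ is_next_zero f w z). split.
      + intros [w [-> Hw]]. apply (Hnext 0%nat 0 z Hafter0). exact Hw.
      + intros H. exists 0. split; [reflexivity|]. apply (Hnext 0%nat 0 z Hafter0). exact H.
    - change (is_kth_pos_zero f (S (S k)) z)
        with (exists w, is_kth_pos_zero f (S k) w /\ is_next_zero f w z). split.
      + intros [w [Hw Hz]]. apply IH in Hw. destruct Hw as [W1 W2].
        apply (Hnext (S k) w z); [|exact Hz]. apply Hafter; [lia|exact W1|exact W2].
      + intros H.
        assert (Hlev : - (PI / 2) < lev (S k)).
        { unfold lev. rewrite S_INR. pose proof (pos_INR k).
          assert (0 <= PI * INR k) by (apply Rmult_le_pos; lra). lra. }
        destruct (Hsurj _ Hlev) as [w [W1 W2]].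
        exists w. split; [apply IH; split; assumption|].
        apply (Hnext (S k) w z); [|exact H]. apply Hafter; [lia|exact W1|exact W2]. }
  intros k Hk1. apply Hk; [exact Hk1|].
  assert (Hlev : - (PI / 2) < lev k).
  { unfold lev. apply le_INR in Hk1. simpl INR in Hk1.
    assert (0 <= PI * (INR k - 1)) by (apply Rmult_le_pos; lra). lra. }
  destruct (Hsurj _ Hlev) as [z [Z1 Z2]].
  assert (U : exists ! z, is_kth_pos_zero f k z).
  { exists z. split; [apply Hk; [exact Hk1|split; assumption]|].
    intros z' Hz'. apply Hk in Hz'; [|exact Hk1]. apply Hinj; [exact Z1|apply Hz'|].
    rewrite Z2. symmetry. apply Hz'. }
  exact (iota_correct _ U).
Qed.

(** * Inverses of the comparison phases *)

Lemma theta_tilde_increasing (nu x y : R) : 0 <= nu -> nu < x -> x < y ->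
  theta_tilde nu x < theta_tilde nu y.
Proof.
  intros Hn. apply (increasing_of_pos_derive (theta_tilde nu) (psi_t nu) nu).
  intros t Ht. split; [apply derive_theta_tilde; lra|apply psi_t_pos; lra].
Qed.

Lemma theta_low_increasing (nu x y : R) : 0 <= nu -> nu < x -> x < y ->
  theta_low nu x < theta_low nu y.
Proof.
  intros Hn. apply (increasing_of_pos_derive (theta_low nu) (psi_l nu) nu).
  intros t Ht. split; [apply derive_theta_low; lra|apply psi_l_pos; lra].
Qed.

(** The inverse exists because [theta_low] runs from [- oo] at [nu] to [+ oo]. *)
Lemma lt_theta_low_inv (nu y c : R) : 0 <= nu -> (nu < c -> theta_low nu c < y) ->
  c < theta_low_inv nu y.
Proof.
  intros Hn Hc. pose proof PI_RGT_0 as HP.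
  assert (Ha : exists a, nu < a /\ theta_low nu a < y /\ c <= a).
  { destruct (Rlt_le_dec nu c) as [L|L].
    - exists c. split; [exact L|]. split; [apply Hc, L|lra].
    - set (e := / (8 * (Rabs y + 2))).
      pose proof (Rabs_pos y) as Y0.
      assert (He : 0 < e) by (apply Rinv_0_lt_compat; lra).
      assert (He1 : e <= 1).
      { unfold e. rewrite <- Rinv_1. apply Rinv_le_contravar; lra. }
      destruct (near_turning nu e Hn He) as [T1 T2].
      exists (sqrt (nu ^ 2 + e ^ 2)). split; [exact T1|]. split; [|lra].
      rewrite theta_low_eq by lra.
      pose proof (theta_tilde_le nu (sqrt (nu ^ 2 + e ^ 2)) Hn) as B1.
      pose proof (corr_ge nu (sqrt (nu ^ 2 + e ^ 2)) ltac:(lra)) as B2.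
      rewrite T2 in B1, B2.
      assert (E8 : / (8 * e) = Rabs y + 2) by (unfold e; field; lra).
      rewrite E8 in B2. pose proof (Rabs_maj2 y). lra. }
  destruct Ha as [a [A1 [A2 A3]]].
  pose proof (vanish_theta_low nu Hn) as V. rewrite vanish_spec in V.
  destruct (V 1 Rlt_0_1) as [X HX].
  set (x2 := Rmax (Rmax X nu) (y + phase nu + 2) + 1).
  pose proof (Rmax_l (Rmax X nu) (y + phase nu + 2)). pose proof (Rmax_r (Rmax X nu) (y + phase nu + 2)).
  pose proof (Rmax_l X nu). pose proof (Rmax_r X nu).
  specialize (HX x2 ltac:(unfold x2; lra)). apply Rabs_lt_between in HX.
  assert (Hx2 : nu < x2) by (unfold x2; lra).
  destruct (ivt (theta_low nu) a x2 y) as [z [Hz E]].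
  - intros t Ht. assert (Ht0 : nu < t) by (eapply Rlt_le_trans; [|apply Ht]; apply Rmin_glb_lt; assumption).
    exact (derive_cont_pt _ _ _ (derive_theta_low nu t (conj Hn Ht0))).
  - unfold x2 in *. lra.
  - assert (Hnz : nu < z) by (eapply Rlt_le_trans; [|apply Hz]; apply Rmin_glb_lt; assumption).
    assert (Haz : a < z).
    { apply Rnot_le_lt. intros [L|L].
      - pose proof (theta_low_increasing nu z a Hn Hnz L). lra.
      - subst z. lra. }
    assert (U : exists ! x, nu < x /\ theta_low nu x = y).
    { exists z. split; [split; assumption|]. intros x [X1 X2].
      destruct (Rtotal_order z x) as [L|[L|L]]; [|exact L|].
      - pose proof (theta_low_increasing nu z x Hn Hnz L). lra.
      - pose proof (theta_low_increasing nu x z Hn X1 L). lra. }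
    pose proof (iota_correct _ U) as [I1 I2].
    change (iota (fun x : R => nu < x /\ theta_low nu x = y)) with (theta_low_inv nu y) in I1, I2.
    destruct (Rtotal_order z (theta_low_inv nu y)) as [L|[L|L]]; [lra|lra|].
    pose proof (theta_low_increasing nu _ z Hn I1 L). lra.
Qed.

Lemma theta_tilde_at (nu : R) : theta_tilde nu nu = - (PI / 4).
Proof.
  unfold theta_tilde. rewrite Rminus_diag, sqrt_0.
  destruct (Req_dec nu 0) as [->|H]; [ring|].
  unfold Rdiv. rewrite Rinv_r, acos_1 by exact H. field.
Qed.

Lemma theta_tilde_inv_lt (nu y c : R) : 0 <= nu -> - (PI / 4) < y ->
  nu < c -> y < theta_tilde nu c -> theta_tilde_inv nu y < c.
Proof.
  intros Hn Hy Hc Hyc.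
  set (e := (y + PI / 4) / 2).
  assert (He : 0 < e) by (unfold e; lra).
  destruct (near_turning nu e Hn He) as [T1 T2].
  set (a := sqrt (nu ^ 2 + e ^ 2)) in *.
  assert (Ha : theta_tilde nu a < y).
  { pose proof (theta_tilde_le nu a Hn) as B. rewrite T2 in B. unfold e in B. lra. }
  destruct (ivt (theta_tilde nu) a c y) as [z [Hz E]].
  - intros t Ht. assert (Ht0 : nu < t) by (eapply Rlt_le_trans; [|apply Ht]; apply Rmin_glb_lt; assumption).
    exact (derive_cont_pt _ _ _ (derive_theta_tilde nu t (conj Hn Ht0))).
  - split; assumption.
  - assert (Hnz : nu < z) by (eapply Rlt_le_trans; [|apply Hz]; apply Rmin_glb_lt; assumption).
    assert (Hzc : z < c).
    { apply Rnot_le_lt. intros [L|L].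
      - pose proof (theta_tilde_increasing nu c z Hn Hc L). lra.
      - subst z. lra. }
    assert (Hgt : forall x, nu <= x -> theta_tilde nu x = y -> nu < x).
    { intros x [L|L] Ex; [exact L|]. subst x. rewrite theta_tilde_at in Ex. lra. }
    assert (U : exists ! x, nu <= x /\ theta_tilde nu x = y).
    { exists z. split; [split; [lra|exact E]|]. intros x [X1 X2].
      pose proof (Hgt x X1 X2) as X3.
      destruct (Rtotal_order z x) as [L|[L|L]]; [|exact L|].
      - pose proof (theta_tilde_increasing nu z x Hn Hnz L). lra.
      - pose proof (theta_tilde_increasing nu x z Hn X3 L). lra. }
    pose proof (iota_correct _ U) as [I1 I2].
    change (iota (fun x : R => nu <= x /\ theta_tilde nu x = y)) with (theta_tilde_inv nu y) in I1, I2.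
    pose proof (Hgt _ I1 I2) as I3.
    destruct (Rtotal_order z (theta_tilde_inv nu y)) as [L|[L|L]]; [|lra|lra].
    pose proof (theta_tilde_increasing nu z _ Hn Hnz L). lra.
Qed.

(** The lower bound requires the level to exceed [- PI/4], the value of
    [theta_tilde] at [nu]: only then is the zero known to lie beyond [nu], where the
    comparison takes place. *)
Lemma zero_bounds (nu b : R) (f : R -> R) : 0 <= nu -> 0 < b <= PI ->
  (forall x a, 0 < x -> bessel_J nu x = sqrt (modsq nu x) * cos a ->
     bessel_Y nu x = sqrt (modsq nu x) * sin a -> (f x = 0 <-> cos (a - b) = 0)) ->
  forall k, (1 <= k)%nat ->
    kth_pos_zero f k < theta_low_inv nu (b + PI * (INR k - 3 / 2)) /\
    (- (PI / 4) < b + PI * (INR k - 3 / 2) ->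
     theta_tilde_inv nu (b + PI * (INR k - 3 / 2)) < kth_pos_zero f k).
Proof.
  intros Hn Hb Hf k Hk.
  destruct (phase_exists nu Hn) as [th [Hph [Hlow Hinf]]].
  pose proof (phase_limit_0 nu th Hn Hph Hlow Hinf) as V.
  destruct (kth_pos_zero_phase f th b Hb) with (k := k) as [Hz Ez]; try assumption.
  - intros x y. apply (phase_increasing nu). exact Hph.
  - intros y. apply (phase_surjective nu); assumption.
  - intros x Hx. destruct (Hph x Hx) as [_ [EJ EY]]. apply Hf; assumption.
  - set (z := kth_pos_zero f k) in *. set (y := b + PI * (INR k - 3 / 2)) in *. split.
    + apply lt_theta_low_inv; [exact Hn|]. intros Hnz.
      pose proof (low_lt_phase nu 0 z th Hn Hph V Hnz). lra.
    + intros Hy.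
      assert (Hnz : nu < z).
      { (* Otherwise the phase at [z] is at most [- PI/4], by the upper bound just above [nu]. *)
        apply Rnot_le_lt. intros L.
        set (e := y + PI / 4).
        destruct (near_turning nu e Hn) as [T1 T2]; [unfold e; lra|].
        pose proof (phase_lt_tilde nu 0 _ th Hn Hph V T1) as U.
        pose proof (theta_tilde_le nu (sqrt (nu ^ 2 + e ^ 2)) Hn) as U2. rewrite T2 in U2.
        pose proof (phase_increasing nu z (sqrt (nu ^ 2 + e ^ 2)) th Hph Hz ltac:(lra)) as U3.
        unfold e in U, U2, U3. lra. }
      apply theta_tilde_inv_lt; try assumption.
      pose proof (phase_lt_tilde nu 0 z th Hn Hph V Hnz). lra.
Qed.

Theorem corollary1p6 :
  forall nu : R, 0 <= nu ->
    (forall k : nat, (1 <= k)%nat ->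
       theta_tilde_inv nu (PI * (INR k - 1 / 2)) < zero_j nu k
       < theta_low_inv nu (PI * (INR k - 1 / 2)))
    /\
    (forall k : nat, (1 <= k)%nat ->
       theta_tilde_inv nu (PI * (INR k - 1)) < zero_y nu k
       < theta_low_inv nu (PI * (INR k - 1)))
    /\
    (forall tau : R, 0 < tau <= 1 ->
       (forall k : nat, (2 <= k)%nat ->
          theta_tilde_inv nu (PI * (tau + INR k - 3 / 2)) < zero_c nu tau k
          < theta_low_inv nu (PI * (tau + INR k - 3 / 2)))
       /\ zero_c nu tau 1 < theta_low_inv nu (PI * (tau - 1 / 2))
       /\ (1 / 4 < tau ->
           theta_tilde_inv nu (PI * (tau - 1 / 2)) < zero_c nu tau 1)).
Proof.
  intros nu Hn. pose proof PI_RGT_0 as HP.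
  assert (Hm : forall x, 0 < x -> 0 < sqrt (modsq nu x))
    by (intros x Hx; apply sqrt_lt_R0, modsq_pos, Hx).
  assert (Hprod : forall x t, 0 < x -> (sqrt (modsq nu x) * t = 0 <-> t = 0)).
  { intros x t Hx. specialize (Hm x Hx). split; intros H.
    - apply Rmult_integral in H. destruct H; [lra|assumption].
    - rewrite H; ring. }
  assert (HkR : forall k, (1 <= k)%nat -> 0 <= PI * (INR k - 1)).
  { intros k Hk. apply le_INR in Hk. simpl INR in Hk. apply Rmult_le_pos; lra. }
  split; [|split].
  - intros k Hk. specialize (HkR k Hk).
    destruct (zero_bounds nu PI (bessel_J nu) Hn) with (k := k) as [U L]; [lra| |exact Hk|].
    + intros x a Hx EJ _. rewrite EJ, Hprod by exact Hx.
      rewrite cos_minus, cos_PI, sin_PI. split; intros; lra.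
    + replace (PI * (INR k - 1 / 2)) with (PI + PI * (INR k - 3 / 2)) by field.
      split; [apply L; lra|exact U].
  - intros k Hk. specialize (HkR k Hk).
    destruct (zero_bounds nu (PI / 2) (bessel_Y nu) Hn) with (k := k) as [U L]; [lra| |exact Hk|].
    + intros x a Hx _ EY. rewrite EY, Hprod by exact Hx. rewrite cos_minus_PI2. reflexivity.
    + replace (PI * (INR k - 1)) with (PI / 2 + PI * (INR k - 3 / 2)) by field.
      split; [apply L; lra|exact U].
  - intros tau Ht.
    assert (Hb : 0 < PI * tau <= PI) by (split; nra).
    assert (B := zero_bounds nu (PI * tau) (bessel_C nu tau) Hn Hb).
    assert (HC : forall x a, 0 < x -> bessel_J nu x = sqrt (modsq nu x) * cos a ->
      bessel_Y nu x = sqrt (modsq nu x) * sin a -> (bessel_C nu tau x = 0 <-> cos (a - PI * tau) = 0)).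
    { intros x a Hx EJ EY. rewrite <- (Hprod x (cos (a - PI * tau))) by exact Hx.
      replace (sqrt (modsq nu x) * cos (a - PI * tau)) with (bessel_C nu tau x); [reflexivity|].
      unfold bessel_C. rewrite EJ, EY, cos_minus. ring. }
    specialize (B HC). split; [|split].
    + intros k Hk. destruct (B k) as [U L]; [lia|].
      replace (PI * (tau + INR k - 3 / 2)) with (PI * tau + PI * (INR k - 3 / 2)) by ring.
      apply le_INR in Hk. simpl INR in Hk.
      assert (0 <= PI * (INR k - 2)) by (apply Rmult_le_pos; lra).
      split; [apply L; lra|exact U].
    + destruct (B 1%nat) as [U _]; [lia|]. simpl INR in U.
      replace (PI * (tau - 1 / 2)) with (PI * tau + PI * (1 - 3 / 2)) by field. exact U.
    + intros Ht4. destruct (B 1%nat) as [_ L]; [lia|]. simpl INR in L.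
      replace (PI * (tau - 1 / 2)) with (PI * tau + PI * (1 - 3 / 2)) by field. apply L. nra.
Qed.
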